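(* Let $k\ge0$ be an integer, let $T\in\mathcal T_h$ be a mesh element, and let $m_T$ be an integer with $m_T<k-1$. With the local spaces and operators of the context, let $$\hat X^k_{\mathrm{div},T}:=\big\{(w_{\mathcal G,T},w^c_{\mathcal G,T},(w_F)_{F\in\mathcal F_T})\,:\,w_{\mathcal G,T}\in\mathcal G^{k-1}(T),\ w^c_{\mathcal G,T}\in\mathcal G^{c,m_T+1}(T),\ w_F\in\mathcal P^k(F)\ \forall F\in\mathcal F_T\big\},$$ let $\hat R_{\mathrm{div},T}:X^k_{\mathrm{div},T}\to\hat X^k_{\mathrm{div},T}$ be defined by $$\hat R_{\mathrm{div},T}w_T:=(w_{\mathcal G,T},\pi^{c,m_T+1}_{\mathcal G,T}w^c_{\mathcal G,T},(w_F)_{F\in\mathcal F_T})\qquad\forall w_T\in X^k_{\mathrm{div},T},$$ and set $\hat C^k_T:=\hat R_{\mathrm{div},T}C^k_TE_{\mathrm{curl},T}:\hat X^k_{\mathrm{curl},T}\to\hat X^k_{\mathrm{div},T}$ and $\hat G^k_T:=\hat R_{\mathrm{curl},T}G^k_TE_{\mathrm{grad},T}:\hat X^k_{\mathrm{grad},T}\to\hat X^k_{\mathrm{curl},T}$. Then the exactness property fails, in the sense that $$\ker\hat C^k_T\not\subset\operatorname{Im}\hat G^k_T.$$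
   Context: **Mesh.** $\Omega\subset\mathbb R^3$ is a connected polyhedral domain with a polyhedral mesh made of sets $\mathcal T_h$ (elements), $\mathcal F_h$ (planar polygonal faces), $\mathcal E_h$ (edges), $\mathcal V_h$ (vertices), belonging to a regular mesh sequence with regularity parameter $\varrho>0$. $h_P$ is the diameter of $P$. Each $P\in\mathcal T_h\cup\mathcal F_h\cup\mathcal E_h$ contains a point $x_P$ such that the ball (of the dimension of $P$) of center $x_P$ and radius $\varrho h_P$ is contained in $P$. $\mathcal F_T,\mathcal E_T$ are the faces and edges of $T$, $\mathcal E_F$ the edges of $F$. $n_F$ is a fixed unit normal to $F$, $t_E$ a fixed unit tangent to $E$; $\omega_{TF}\in\{\pm1\}$ is such that $\omega_{TF}n_F$ points out of $T$; for $E\in\mathcal E_F$, $n_{FE}$ is the unit normal to $E$ in the plane of $F$ such that $(t_E,n_{FE},n_F)$ is right-handed, and $\omega_{FE}\in\{\pm1\}$ is such that $\omega_{FE}n_{FE}$ points out of $F$. On $F$, $\mathrm{grad}_F,\mathrm{div}_F$ are the tangential gradient and divergence, $\perp$ is the rotation of angle $-\pi/2$ in the plane of $F$ oriented by $n_F$, $\mathbf{rot}_Fr=(\mathrm{grad}_Fr)^\perp$ for scalar $r$, $\mathrm{rot}_Fz=\mathrm{div}_F(z^\perp)$ for tangent $z$. $v_{t,F}=n_F\times(v_{|F}\times n_F)$. **Boundaries selection.** For each element (resp. face) $P$ a set $\mathcal B_{s,P}$ of $\eta_P\ge2$ faces (resp. edges) of $P$ is selected, not pairwise aligned, such that $P$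 lies on one side of the hyperplane spanned by each $b\in\mathcal B_{s,P}$; with $\mathrm{dist}_{Pb}(x)=h_P^{-1}(x-x_b)\cdot n_{Pb}$, $n_{Pb}$ the unit normal to $b$ pointing into $P$, there is $\theta>0$ such that $\mathrm{dist}_{Pb}(x_{b'})\ge\theta$ for all $b\ne b'$ in $\mathcal B_{s,P}$. Set $\ell_P:=k+1-\eta_P$. **Polynomials.** $\mathcal P^\ell(P)$: polynomials of total degree $\le\ell$ on $P$; $\boldsymbol{\mathcal P}^\ell(P)$: vector version (3D on elements, tangent 2D on faces); $\mathcal P^{0,\ell}(P)$: zero-average ones. $\mathcal G^\ell(T)=\mathrm{grad}\,\mathcal P^{\ell+1}(T)$, $\mathcal G^{c,\ell}(T)=(x-x_T)\times\boldsymbol{\mathcal P}^{\ell-1}(T)$, $\mathcal R^\ell(T)=\mathrm{curl}\,\boldsymbol{\mathcal P}^{\ell+1}(T)$, $\mathcal R^{c,\ell}(T)=(x-x_T)\mathcal P^{\ell-1}(T)$, $\mathcal R^\ell(F)=\mathbf{rot}_F\mathcal P^{\ell+1}(F)$, $\mathcal R^{c,\ell}(F)=(x-x_F)\mathcal P^{\ell-1}(F)$; all these spaces are $\{0\}$ if $\ell<0$. $\pi^\ell_{\mathcal X,P}$, $\pi^{c,\ell}_{\mathcal X,P}$ are the $L^2(P)$-orthogonal projectors on $\mathcal X^\ell(P)$, $\mathcal X^{c,\ell}(P)$. $\mathcal P_c^{k+1}(\mathcal E)$: continuous functions on the union of the edges in $\mathcal E$ that are in $\mathcal P^{k+1}(E)$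 on each edge $E$; $q_E$ is the restriction to $E$. **DDR spaces.** $X^k_{\mathrm{grad},T}$: $q_T=(q_T,(q_F)_{F\in\mathcal F_T},q_{\mathcal E_T})$ with $q_T\in\mathcal P^{k-1}(T)$, $q_F\in\mathcal P^{k-1}(F)$, $q_{\mathcal E_T}\in\mathcal P_c^{k+1}(\mathcal E_T)$. $X^k_{\mathrm{curl},T}$: $v_T=(v_{\mathcal R,T},v^c_{\mathcal R,T},(v_{\mathcal R,F},v^c_{\mathcal R,F})_{F\in\mathcal F_T},(v_E)_{E\in\mathcal E_T})$ with $v_{\mathcal R,P}\in\mathcal R^{k-1}(P)$, $v^c_{\mathcal R,P}\in\mathcal R^{c,k}(P)$ for $P\in\{T\}\cup\mathcal F_T$, $v_E\in\mathcal P^k(E)$. $X^k_{\mathrm{div},T}$: $w_T=(w_{\mathcal G,T},w^c_{\mathcal G,T},(w_F)_{F\in\mathcal F_T})$ with $w_{\mathcal G,T}\in\mathcal G^{k-1}(T)$, $w^c_{\mathcal G,T}\in\mathcal G^{c,k}(T)$, $w_F\in\mathcal P^k(F)$. Replacing $T$ by $F$ denotes restriction to the components on $F$ and its edges (same for vectors). **DDR operators.** For $q_F\in X^k_{\mathrm{grad},F}$ (with face component also denoted $q_F$), $\mathsf G_F^kq_F\in\boldsymbol{\mathcal P}^k(F)$ and $\gamma_F^{k+1}q_F\in\mathcal P^{k+1}(F)$ satisfy $\int_F\mathsf G^k_Fq_F\cdot v=-\int_Fq_F\,\mathrm{div}_Fv+\sum_{E\in\mathcal E_F}\omega_{FE}\int_Eq_E(v\cdot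 n_{FE})$ for all $v\in\boldsymbol{\mathcal P}^k(F)$; $\int_F\gamma^{k+1}_Fq_F\,\mathrm{div}_Fv=-\int_F\mathsf G^k_Fq_F\cdot v+\sum_{E\in\mathcal E_F}\omega_{FE}\int_Eq_E(v\cdot n_{FE})$ for all $v\in\mathcal R^{c,k+2}(F)$. For $q_T\in X^k_{\mathrm{grad},T}$, $\mathsf G^k_Tq_T\in\boldsymbol{\mathcal P}^k(T)$ satisfies $\int_T\mathsf G^k_Tq_T\cdot v=-\int_Tq_T\,\mathrm{div}\,v+\sum_{F\in\mathcal F_T}\omega_{TF}\int_F\gamma^{k+1}_Fq_F(v\cdot n_F)$ for all $v\in\boldsymbol{\mathcal P}^k(T)$. For $v_F\in X^k_{\mathrm{curl},F}$, $C^k_Fv_F\in\mathcal P^k(F)$ and $\gamma^k_{t,F}v_F\in\boldsymbol{\mathcal P}^k(F)$ satisfy $\int_FC^k_Fv_F\,r=\int_Fv_{\mathcal R,F}\cdot\mathbf{rot}_Fr-\sum_{E\in\mathcal E_F}\omega_{FE}\int_Ev_Er$ for all $r\in\mathcal P^k(F)$; $\int_F\gamma^k_{t,F}v_F\cdot(\mathbf{rot}_Fr+w)=\int_FC^k_Fv_F\,r+\sum_{E\in\mathcal E_F}\omega_{FE}\int_Ev_Er+\int_Fv^c_{\mathcal R,F}\cdot w$ for all $(r,w)\in\mathcal P^{0,k+1}(F)\times\mathcal R^{c,k}(F)$. For $v_T\in X^k_{\mathrm{curl},T}$, $\mathsf C^k_Tv_T\in\boldsymbol{\mathcal P}^k(T)$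 satisfies $\int_T\mathsf C^k_Tv_T\cdot w=\int_Tv_{\mathcal R,T}\cdot\mathrm{curl}\,w+\sum_{F\in\mathcal F_T}\omega_{TF}\int_F\gamma^k_{t,F}v_F\cdot(w\times n_F)$ for all $w\in\boldsymbol{\mathcal P}^k(T)$. Local discrete gradient and curl: $G^k_Tq_T=(\pi^{k-1}_{\mathcal R,T}\mathsf G^k_Tq_T,\pi^{c,k}_{\mathcal R,T}\mathsf G^k_Tq_T,(\pi^{k-1}_{\mathcal R,F}\mathsf G^k_Fq_F,\pi^{c,k}_{\mathcal R,F}\mathsf G^k_Fq_F)_{F\in\mathcal F_T},(q_E')_{E\in\mathcal E_T})\in X^k_{\mathrm{curl},T}$, with derivative $q_E'$ in the direction $t_E$; $C^k_Tv_T=(\pi^{k-1}_{\mathcal G,T}\mathsf C^k_Tv_T,\pi^{c,k}_{\mathcal G,T}\mathsf C^k_Tv_T,(C^k_Fv_F)_{F\in\mathcal F_T})\in X^k_{\mathrm{div},T}$. **Serendipity spaces.** $\hat X^k_{\mathrm{grad},\bullet}$ and $\hat X^k_{\mathrm{curl},\bullet}$ ($\bullet=T,F$) are defined as $X^k_{\mathrm{grad},\bullet}$, $X^k_{\mathrm{curl},\bullet}$ but with $\hat q_P\in\mathcal P^{\ell_P}(P)$ and $\hat v^c_{\mathcal R,P}\in\mathcal R^{c,\ell_P+1}(P)$ for $P$ the element and the faces (other components unchanged). **Serendipity operators on faces.** Let $\mathcal A_F((\upsilon,\nu),(\tau,\mu))=h_F\sum_{E\in\mathcal E_F}\int_E(\upsilon\cdot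 t_E)(\tau\cdot t_E)+h_F^2\int_F\mathrm{rot}_F\upsilon\,\mathrm{rot}_F\tau+\int_F\upsilon\cdot\mu-\int_F\tau\cdot\nu$ on $[\boldsymbol{\mathcal P}^k(F)\times\mathcal R^{c,\ell_F+1}(F)]^2$. $S_{\mathrm{grad},F}\hat q_F$ (resp. $S_{\mathrm{curl},F}\hat v_F$) is the component $\sigma$ of the unique $(\sigma,\lambda)$ such that $\mathcal A_F((\sigma,\lambda),(\tau,\mu))=\mathcal L(\tau,\mu)$ for all $(\tau,\mu)$, with respectively $\mathcal L(\tau,\mu)=h_F\sum_E\int_E\hat q_E'(\tau\cdot t_E)-\int_F\hat q_F\,\mathrm{div}_F\mu+\sum_E\omega_{FE}\int_E\hat q_E(\mu\cdot n_{FE})$, $\mathcal L(\tau,\mu)=h_F\sum_E\int_E\hat v_E(\tau\cdot t_E)+h_F^2\big(\int_F\hat v_{\mathcal R,F}\cdot\mathbf{rot}_F\mathrm{rot}_F\tau-\sum_E\omega_{FE}\int_E\hat v_E\,\mathrm{rot}_F\tau\big)+\int_F\hat v^c_{\mathcal R,F}\cdot\mu$. Extensions: $E_{\mathrm{grad},F}\hat q_F=(e_F\hat q_F,\hat q_{\mathcal E_F})$ with $e_F\hat q_F\in\mathcal P^{k-1}(F)$ such that $\int_Fe_F\hat q_F\,\mathrm{div}_Fw=-\int_FS_{\mathrm{grad},F}\hat q_F\cdot w+\sum_E\omega_{FE}\int_E\hat q_E(w\cdot n_{FE})$ for all $w\in\mathcal R^{c,k}(F)$; $E_{\mathrm{curl},F}\hat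 v_F=(\hat v_{\mathcal R,F},\pi^{c,k}_{\mathcal R,F}S_{\mathrm{curl},F}\hat v_F,(\hat v_E)_E)$. Reduction: $\hat R_{\mathrm{curl},F}v_F=(v_{\mathcal R,F},\pi^{c,\ell_F+1}_{\mathcal R,F}v^c_{\mathcal R,F},(v_E)_E)$. **Serendipity operators on elements.** Let $\mathcal A_T((\upsilon,\nu),(\tau,\mu))=h_T\sum_{F\in\mathcal F_T}\int_F\upsilon_{t,F}\cdot\tau_{t,F}+h_T^2\int_T\mathrm{curl}\,\upsilon\cdot\mathrm{curl}\,\tau+\int_T\upsilon\cdot\mu-\int_T\tau\cdot\nu$ on $[\boldsymbol{\mathcal P}^k(T)\times\mathcal R^{c,\ell_T+1}(T)]^2$. $S_{\mathrm{grad},T}\hat q_T$ (resp. $S_{\mathrm{curl},T}\hat v_T$) is the component $\sigma$ of the unique $(\sigma,\lambda)$ such that $\mathcal A_T((\sigma,\lambda),(\tau,\mu))=\mathcal L(\tau,\mu)$ for all $(\tau,\mu)$, with respectively $\mathcal L(\tau,\mu)=h_T\sum_F\int_F\mathsf G^k_FE_{\mathrm{grad},F}\hat q_F\cdot\tau_{t,F}-\int_T\hat q_T\,\mathrm{div}\,\mu+\sum_F\omega_{TF}\int_F\gamma^{k+1}_FE_{\mathrm{grad},F}\hat q_F(\mu\cdot n_F)$, $\mathcal L(\tau,\mu)=h_T\sum_F\int_F\gamma^k_{t,F}E_{\mathrm{curl},F}\hat v_F\cdot\tau_{t,F}+h_T^2\big(\int_T\hat v_{\mathcal R,T}\cdot\mathrm{curl}\,\mathrm{curl}\,\tau+\sum_F\omega_{TF}\int_F\gamma^k_{t,F}E_{\mathrm{curl},F}\hat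 v_F\cdot(\mathrm{curl}\,\tau\times n_F)\big)+\int_T\hat v^c_{\mathcal R,T}\cdot\mu$. Extensions: $E_{\mathrm{grad},T}\hat q_T=(e_T\hat q_T,(e_F\hat q_F)_F,\hat q_{\mathcal E_T})$ with $e_T\hat q_T\in\mathcal P^{k-1}(T)$ such that $\int_Te_T\hat q_T\,\mathrm{div}\,w=-\int_TS_{\mathrm{grad},T}\hat q_T\cdot w+\sum_F\omega_{TF}\int_F\gamma^{k+1}_FE_{\mathrm{grad},F}\hat q_F(w\cdot n_F)$ for all $w\in\mathcal R^{c,k}(T)$; $E_{\mathrm{curl},T}\hat v_T=(\hat v_{\mathcal R,T},\pi^{c,k}_{\mathcal R,T}S_{\mathrm{curl},T}\hat v_T,(\hat v_{\mathcal R,F},\pi^{c,k}_{\mathcal R,F}S_{\mathrm{curl},F}\hat v_F)_F,(\hat v_E)_E)$. Reduction: $\hat R_{\mathrm{curl},T}v_T=(r_Tv_T,\pi^{c,\ell_T+1}_{\mathcal R,T}v^c_{\mathcal R,T},(v_{\mathcal R,F},\pi^{c,\ell_F+1}_{\mathcal R,F}v^c_{\mathcal R,F})_F,(v_E)_E)$ with $r_Tv_T\in\mathcal R^{k-1}(T)$ such that $\int_Tr_Tv_T\cdot\mathrm{curl}\,w=\int_T\mathsf C^k_Tv_T\cdot w-\sum_F\omega_{TF}\int_F\gamma^k_{t,F}E_{\mathrm{curl},F}\hat R_{\mathrm{curl},F}v_F\cdot(w\times n_F)$ for all $w\in\mathcal G^{c,k}(T)$.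
   Formalization: The degree k is assumed to be at least 1 instead of k ≥ 0: for k = 0 the space G^{c,0}(T) is {0}, so the reduction is the identity and on a tetrahedron the kernel of the curl equals the image of the gradient. *)

(* Defs.v *)
From HB Require Import structures.
From mathcomp Require Import all_boot all_order all_algebra.
From mathcomp Require Import all_classical all_reals all_analysis.
(* The notations of multinomials clash with those of mathcomp-analysis. *)
From mathcomp Require Import -(notations) mpoly.

Set Implicit Arguments.
Unset Strict Implicit.
Unset Printing Implicit Defensive.

Import Order.TTheory GRing.Theory Num.Theory.
Import numFieldNormedType.Exports.

Local Open Scope classical_set_scope.
Local Open Scope ring_scope.

Section Vectors.
Context {A : nzRingType}.

Definition dot n (u v : 'rV[A]_n) : A := \sum_i u 0 i * v 0 i.

(* Indices are added in 'I_3 = Z/3Z. *)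
Definition cross (u v : 'rV[A]_3) : 'rV[A]_3 :=
  \row_(i < 3) (u 0 (i + 1) * v 0 (i + 2) - u 0 (i + 2) * v 0 (i + 1)).

(* Rotation of angle -pi/2 in coordinates of a direct orthonormal frame. *)
Definition perp (z : 'rV[A]_2) : 'rV[A]_2 :=
  \row_(i < 2) (if i == 0 then z 0 1 else - z 0 0).

End Vectors.

Section PolynomialCalculus.
Context {R : realType}.

Definition grad n (p : mpoly n R) : 'rV[mpoly n R]_n := \row_i mderiv i p.
Definition div n (v : 'rV[mpoly n R]_n) : mpoly n R := \sum_i mderiv i (v 0 i).
Definition curl (v : 'rV[mpoly 3 R]_3) : 'rV[mpoly 3 R]_3 :=
  \row_(i < 3) (mderiv (i + 1) (v 0 (i + 2)) - mderiv (i + 2) (v 0 (i + 1))).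
Definition vrotF (r : mpoly 2 R) : 'rV[mpoly 2 R]_2 := perp (grad r).
Definition rotF (z : 'rV[mpoly 2 R]_2) : mpoly 2 R := div (perp z).

(* Total degree at most l; this is {0} when l < 0. *)
Definition Pol n (l : int) : set (mpoly n R) :=
  [set p | forall m, m \in msupp p -> (mdeg m)%:Z <= l].
Definition VPol n (l : int) : set 'rV[mpoly n R]_n :=
  [set v | forall i, Pol l (v 0 i)].

Definition shift n (c : 'rV[R]_n) : 'rV[mpoly n R]_n :=
  \row_i (mpolyX R (mnm1 i) - mpolyC n (c 0 i)).

Definition evalv n (v : 'rV[mpoly n R]_n) (x : 'rV[R]_n) : 'rV[R]_n :=
  \row_i meval (fun j => x 0 j) (v 0 i).

End PolynomialCalculus.

Arguments grad {R n}.

Section Euclidean.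
Context {R : realType}.

Definition enorm n (u : 'rV[R]_n) : R := Num.sqrt (dot u u).

Definition diam n (A : set 'rV[R]_n) : R :=
  sup [set enorm (z.1 - z.2) | z in A `*` A].

(* Bounded connected open sets lying on one side of their boundary: together
   with a boundary made of finitely many flat pieces, these are the interiors
   of finite unions of closed simplices. *)
Definition region (V : normedModType R) (A : set V) :=
  [/\ A !=set0, open A, bounded_set A, connected A & (closure A)° = A].

End Euclidean.

(* All cells are relatively open subsets of R^3.  Each face F comes with a
   centre x_F and an orthonormal frame (tau F 0, tau F 1) of its direction,
   which fixes the normal n_F := tau F 0 x tau F 1.  Each edge is the open
   segment from its vertex src E to its vertex tgt E, which fixes t_E. *)
Record mesh_data (R : realType) := MeshData {
  dom : set 'rV[R]_3 ;
  elt : finType ;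
  face : finType ;
  edge : finType ;
  vert : finType ;
  eltS : elt -> set 'rV[R]_3 ;
  faceS : face -> set 'rV[R]_3 ;
  vpos : vert -> 'rV[R]_3 ;
  src : edge -> vert ;
  tgt : edge -> vert ;
  xT : elt -> 'rV[R]_3 ;
  xF : face -> 'rV[R]_3 ;
  xE : edge -> 'rV[R]_3 ;
  tau : face -> 'I_2 -> 'rV[R]_3 ;
  omegaTF : elt -> face -> R ;
  omegaFE : face -> edge -> R }.

Section Geometry.
Context {R : realType} (M : mesh_data R).
Local Notation pt := 'rV[R]_3.
Implicit Types (T : elt M) (F : face M) (E : edge M).

Definition chart F (y : R * R) : pt :=
  xF F + y.1 *: tau F 0 + y.2 *: tau F 1.

Definition nF F : pt := cross (tau F 0) (tau F 1).

Definition hE E : R := enorm (vpos (tgt E) - vpos (src E)).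
Definition tE E : pt := (hE E)^-1 *: (vpos (tgt E) - vpos (src E)).
Definition param E (s : R) : pt := vpos (src E) + s *: tE E.
Definition edgeS E : set pt := [set param E s | s in `]0, hE E[].

(* (t_E, n_FE, n_F) is right-handed *)
Definition nFE F E : pt := cross (nF F) (tE E).

Definition hT T : R := diam (eltS T).
Definition hF F : R := diam (faceS F).

(* As eltS T and dom are open and faceS F is open in its plane, this is their
   (relative) boundary. *)
Definition bdry (A : set pt) : set pt := closure A `\` A.

Definition facesT T : {set face M} := [set F | `[< faceS F `<=` bdry (eltS T) >]].
Definition edgesF F : {set edge M} := [set E | `[< edgeS E `<=` bdry (faceS F) >]].
Definition edgesT T : {set edge M} := \bigcup_(F in facesT T) edgesF F.

(* The vector n points out of A at the points of B. *)
Definition points_out (A B : set pt) (n : pt) := forall x, B x ->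
  \forall e \near 0^'+, A (x - e *: n) /\ ~ closure A (x + e *: n).

End Geometry.

Arguments chart {R M}.
Arguments param {R M}.
Arguments edgeS {R M}.

Record mesh (R : realType) := Mesh {
  mdata :> mesh_data R ;
  dom_region : region (dom mdata) ;
  elt_region : forall T : elt mdata, region (eltS T) ;
  dom_cover : closure (dom mdata) = \bigcup_(T in [set: elt mdata]) closure (eltS T) ;
  tau_orthonormal : forall (F : face mdata) (i j : 'I_2),
    dot (tau F i) (tau F j) = (i == j)%:R ;
  face_planar : forall F : face mdata, faceS F `<=` range (chart F) ;
  face_region : forall F : face mdata,
    @region R (R * R)%type (chart F @^-1` faceS F) ;
  elt_boundary : forall T : elt mdata,
    bdry (eltS T) = \bigcup_(F in [set` facesT T]) closure (faceS F) ;
  face_interface_or_boundary : forall F : face mdata,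
    (exists T1 T2 : elt mdata,
       [/\ T1 != T2, F \in facesT T1 & F \in facesT T2]) \/
    (exists T : elt mdata, F \in facesT T /\ faceS F `<=` bdry (dom mdata)) ;
  vpos_inj : injective (@vpos R mdata) ;
  src_neq_tgt : forall E : edge mdata, src E != tgt E ;
  face_boundary : forall F : face mdata,
    bdry (faceS F) = \bigcup_(E in [set` edgesF F]) closure (edgeS E) ;
  edge_of_face : forall E : edge mdata, exists F : face mdata, E \in edgesF F ;
  vert_of_edge : forall V : vert mdata, exists E : edge mdata,
    V = src E \/ V = tgt E ;
  elt_disjoint : forall T T' : elt mdata, T != T' -> eltS T `&` eltS T' = set0 ;
  face_disjoint : forall F F' : face mdata, F != F' -> faceS F `&` faceS F' = set0 ;
  edge_disjoint : forall E E' : edge mdata, E != E' -> edgeS E `&` edgeS E' = set0 ;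
  face_edge_disjoint : forall (F : face mdata) (E : edge mdata),
    faceS F `&` edgeS E = set0 ;
  face_vert_disjoint : forall (F : face mdata) (V : vert mdata), ~ faceS F (vpos V) ;
  edge_vert_disjoint : forall (E : edge mdata) (V : vert mdata), ~ edgeS E (vpos V) ;
  omegaTF_sign : forall (T : elt mdata) (F : face mdata), F \in facesT T ->
    omegaTF T F = 1 \/ omegaTF T F = -1 ;
  omegaTF_out : forall (T : elt mdata) (F : face mdata), F \in facesT T ->
    points_out (eltS T) (faceS F) (omegaTF T F *: nF F) ;
  omegaFE_sign : forall (F : face mdata) (E : edge mdata), E \in edgesF F ->
    omegaFE F E = 1 \/ omegaFE F E = -1 ;
  omegaFE_out : forall (F : face mdata) (E : edge mdata), E \in edgesF F ->
    points_out (faceS F) (edgeS E) (omegaFE F E *: nFE F E) ;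
  rho : R ;
  rho_gt0 : 0 < rho ;
  elt_ball : forall T : elt mdata,
    [set x | enorm (x - xT T) < rho * hT T] `<=` eltS T ;
  face_ball : forall F : face mdata,
    [set x | range (chart F) x /\ enorm (x - xF F) < rho * hF F] `<=` faceS F ;
  edge_ball : forall E : edge mdata,
    [set x | range (param E) x /\ enorm (x - xE E) < rho * hE E] `<=` edgeS E ;
  xE_line : forall E : edge mdata, range (param E) (xE E) }.

Section Distance.
Context {R : realType} (M : mesh R).

(* dist_{Pb}, with n_{Pb} pointing into P *)
Definition distT (T : elt M) (F : face M) (x : 'rV[R]_3) : R :=
  (hT T)^-1 * dot (x - xF F) (- (omegaTF T F *: nF F)).
Definition distF (F : face M) (E : edge M) (x : 'rV[R]_3) : R :=
  (hF F)^-1 * dot (x - xE E) (- (omegaFE F E *: nFE F E)).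

End Distance.

Record selection (R : realType) (M : mesh R) := Selection {
  selT : elt M -> {set face M} ;
  selF : face M -> {set edge M} ;
  selT_sub : forall T, selT T \subset facesT T ;
  selF_sub : forall F, selF F \subset edgesF F ;
  selT_card : forall T, (2 <= #|selT T|)%N ;
  selF_card : forall F, (2 <= #|selF F|)%N ;
  selT_not_aligned : forall T F F', F \in selT T -> F' \in selT T -> F != F' ->
    range (chart F) <> range (chart F') ;
  selF_not_aligned : forall F E E', E \in selF F -> E' \in selF F -> E != E' ->
    range (param E) <> range (param E') ;
  selT_one_side : forall T F, F \in selT T -> forall x, eltS T x -> 0 <= distT T F x ;
  selF_one_side : forall F E, E \in selF F -> forall x, faceS F x -> 0 <= distF F E x ;
  theta : R ;
  theta_gt0 : 0 < theta ;
  selT_dist : forall T F F', F \in selT T -> F' \in selT T -> F != F' ->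
    theta <= distT T F (xF F') ;
  selF_dist : forall F E E', E \in selF F -> E' \in selF F -> E != E' ->
    theta <= distF F E (xE E') }.

Section DDR.
Context {R : realType} {M : mesh R} (B : selection M) (k : nat).
Local Notation pt := 'rV[R]_3.
Local Notation P3 := (mpoly 3 R).
Local Notation V3 := 'rV[mpoly 3 R]_3.
Local Notation P2 := (mpoly 2 R).
Local Notation V2 := 'rV[mpoly 2 R]_2.
Implicit Types (T : elt M) (F : face M) (E : edge M) (x : pt).

Definition ellT T : int := k%:Z + 1 - #|selT B T|%:Z.
Definition ellF F : int := k%:Z + 1 - #|selF B F|%:Z.

(* Polynomials on T, F, E are represented by polynomials in, respectively, the
   coordinates of R^3, the coordinates on the plane of F in the frame
   (x_F; tau F 0, tau F 1), and the arclength from src E.  In particular fields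
   on F tangent to F are given by their components in (tau F 0, tau F 1). *)
Definition evalT (p : P3) x : R := meval (fun i => x 0 i) p.
Definition evalF F (p : P2) x : R := meval (fun i => dot (x - xF F) (tau F i)) p.
Definition evalvF F (v : V2) x : pt := \sum_i evalF F (v 0 i) x *: tau F i.
Definition evalE E (q : {poly R}) x : R := q.[dot (x - vpos (src E)) (tE E)].

Definition pt3 (y : R * R * R) : pt :=
  \row_(i < 3) nth 0 [:: y.1.1; y.1.2; y.2] i.

Local Notation leb := (@lebesgue_measure R).

Definition intT T (f : pt -> R) : R :=
  \int[((leb \x leb) \x leb)%E]_(y in pt3 @^-1` eltS T) f (pt3 y).
Definition intF F (f : pt -> R) : R :=
  \int[(leb \x leb)%E]_(y in chart F @^-1` faceS F) f (chart F y).
Definition intE E (f : pt -> R) : R :=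
  \int[leb]_(s in `[0, hE E]) f (param E s).

Definition dotT T (u v : V3) : R := intT T (fun x => dot (evalv u x) (evalv v x)).
Definition dotF F (u v : V2) : R :=
  intF F (fun x => dot (evalvF F u x) (evalvF F v x)).
Definition prodT T (p q : P3) : R := intT T (fun x => evalT p x * evalT q x).
Definition prodF F (p q : P2) : R := intF F (fun x => evalF F p x * evalF F q x).

(* v_{t,F} *)
Definition trace F (v : pt) : pt := cross (nF F) (cross v (nF F)).

Definition GT (l : int) : set V3 := grad @` Pol (l + 1).
Definition GcT T (l : int) : set V3 := cross (shift (xT T)) @` VPol (l - 1).
Definition RT (l : int) : set V3 := curl @` VPol (l + 1).
Definition RcT T (l : int) : set V3 := (fun p => p *: shift (xT T)) @` Pol (l - 1).
Definition RF (l : int) : set V2 := vrotF @` Pol (l + 1).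
(* The coordinates of x_F are 0. *)
Definition RcF (l : int) : set V2 := (fun p => p *: shift 0) @` Pol (l - 1).

(* L^2-orthogonal projectors.  Here and below, [xget 0 S] is the element of S
   characterized by the equations defining S. *)
Definition projT T (X : set V3) (v : V3) : V3 :=
  xget 0 [set p | X p /\ forall w, X w -> dotT T p w = dotT T v w].
Definition projF F (X : set V2) (v : V2) : V2 :=
  xget 0 [set p | X p /\ forall w, X w -> dotF F p w = dotF F v w].

(* The families are indexed by all the faces and edges
    of the mesh; when attached to an element T (resp. a face F), only their
    values on the faces and edges of T (resp. on the edges of F) are
    meaningful. *)

Record XgradF := MkXgradF { gF : P2 ; gFE : edge M -> {poly R} }.
Record XcurlF := MkXcurlF { cRF : V2 ; cRcF : V2 ; cFE : edge M -> {poly R} }.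
Record XgradT := MkXgradT {
  gT : P3 ; gTF : face M -> P2 ; gTE : edge M -> {poly R} }.
Record XcurlT := MkXcurlT {
  cRT : V3 ; cRcT : V3 ;
  cTRF : face M -> V2 ; cTRcF : face M -> V2 ; cTE : edge M -> {poly R} }.
Record XdivT := MkXdivT { dGT : V3 ; dGcT : V3 ; dTF : face M -> P2 }.

Definition gradT_restr (q : XgradT) F : XgradF := MkXgradF (gTF q F) (gTE q).
Definition curlT_restr (v : XcurlT) F : XcurlF :=
  MkXcurlF (cTRF v F) (cTRcF v F) (cTE v).

(* The family (q_E)_E defines an element of P_c^{k+1} of the edges of T. *)
Definition Pc_edges T (q : edge M -> {poly R}) :=
  (forall E, E \in edgesT T -> (size (q E) <= k.+2)%N) /\
  exists phi : pt -> R,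
    {within \bigcup_(E in [set` edgesT T]) closure (edgeS E), continuous phi} /\
    forall E, E \in edgesT T ->
      forall x, closure (edgeS E) x -> phi x = evalE E (q E) x.

(* The gradient, curl and divergence spaces with prescribed degrees dT, dF of
   the element and face components that are affected by serendipity. *)
Definition grad_space T (dT : int) (dF : face M -> int) : set XgradT :=
  [set q | [/\ Pol dT (gT q),
               forall F, F \in facesT T -> Pol (dF F) (gTF q F)
             & Pc_edges T (gTE q)]].
Definition curl_space T (dT : int) (dF : face M -> int) : set XcurlT :=
  [set v | [/\ RT (k%:Z - 1) (cRT v), RcT T dT (cRcT v),
               forall F, F \in facesT T ->
                 RF (k%:Z - 1) (cTRF v F) /\ RcF (dF F) (cTRcF v F)
             & forall E, E \in edgesT T -> (size (cTE v E) <= k.+1)%N]].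
Definition div_space T (dT : int) : set XdivT :=
  [set w | [/\ GT (k%:Z - 1) (dGT w), GcT T dT (dGcT w)
             & forall F, F \in facesT T -> Pol k (dTF w F)]].

Definition XgradkT T := grad_space T (k%:Z - 1) (fun=> k%:Z - 1).
Definition XcurlkT T := curl_space T k (fun=> k%:Z).
Definition XdivkT T := div_space T k.

Definition hatXgradT T := grad_space T (ellT T) ellF.
Definition hatXcurlT T := curl_space T (ellT T + 1) (fun F => ellF F + 1).
Definition hatXdivT T (m : int) := div_space T (m + 1).

Definition curl_eq T (v v' : XcurlT) :=
  [/\ cRT v = cRT v', cRcT v = cRcT v',
      forall F, F \in facesT T -> cTRF v F = cTRF v' F /\ cTRcF v F = cTRcF v' F
    & forall E, E \in edgesT T -> cTE v E = cTE v' E].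
Definition div_eq T (w w' : XdivT) :=
  [/\ dGT w = dGT w', dGcT w = dGcT w'
    & forall F, F \in facesT T -> dTF w F = dTF w' F].
Definition div0 : XdivT := MkXdivT 0 0 (fun=> 0).

(* sum_E omega_FE int_E q_E (v . n_FE) *)
Definition bflux F (q : edge M -> {poly R}) (v : V2) : R :=
  \sum_(E in edgesF F) omegaFE F E *
    intE E (fun x => evalE E (q E) x * dot (evalvF F v x) (nFE F E)).
(* sum_E omega_FE int_E v_E r *)
Definition bcirc F (v : edge M -> {poly R}) (r : P2) : R :=
  \sum_(E in edgesF F) omegaFE F E *
    intE E (fun x => evalE E (v E) x * evalF F r x).

Definition GFk F (q : XgradF) : V2 :=
  xget 0 [set g | VPol k g /\ forall v, VPol k v ->
    dotF F g v = - prodF F (gF q) (div v) + bflux F (gFE q) v].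

Definition gammaF F (q : XgradF) : P2 :=
  xget 0 [set g | Pol (k%:Z + 1) g /\ forall v, RcF (k%:Z + 2) v ->
    prodF F g (div v) = - dotF F (GFk F q) v + bflux F (gFE q) v].

Definition CFk F (v : XcurlF) : P2 :=
  xget 0 [set c | Pol k c /\ forall r, Pol k r ->
    prodF F c r = dotF F (cRF v) (vrotF r) - bcirc F (cFE v) r].

Definition gammatF F (v : XcurlF) : V2 :=
  xget 0 [set g | VPol k g /\
    forall r w, Pol (k%:Z + 1) r -> intF F (evalF F r) = 0 -> RcF k w ->
      dotF F g (vrotF r + w) =
      prodF F (CFk F v) r + bcirc F (cFE v) r + dotF F (cRcF v) w].

Definition GTk T (q : XgradT) : V3 :=
  xget 0 [set g | VPol k g /\ forall v, VPol k v ->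
    dotT T g v = - prodT T (gT q) (div v)
      + \sum_(F in facesT T) omegaTF T F *
          intF F (fun x => evalF F (gammaF F (gradT_restr q F)) x
                           * dot (evalv v x) (nF F))].

(* sum_F omega_TF int_F g_F . (w x n_F) *)
Definition tflux T (g : face M -> V2) (w : V3) : R :=
  \sum_(F in facesT T) omegaTF T F *
    intF F (fun x => dot (evalvF F (g F) x) (cross (evalv w x) (nF F))).

Definition CTk T (v : XcurlT) : V3 :=
  xget 0 [set c | VPol k c /\ forall w, VPol k w ->
    dotT T c w = dotT T (cRT v) (curl w)
      + tflux T (fun F => gammatF F (curlT_restr v F)) w].

Definition Gk T (q : XgradT) : XcurlT :=
  MkXcurlT
    (projT T (RT (k%:Z - 1)) (GTk T q)) (projT T (RcT T k) (GTk T q))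
    (fun F => projF F (RF (k%:Z - 1)) (GFk F (gradT_restr q F)))
    (fun F => projF F (RcF k) (GFk F (gradT_restr q F)))
    (fun E => (gTE q E)^`()).

Definition Ck T (v : XcurlT) : XdivT :=
  MkXdivT
    (projT T (GT (k%:Z - 1)) (CTk T v)) (projT T (GcT T k) (CTk T v))
    (fun F => CFk F (curlT_restr v F)).

Definition AF F (u nu t mu : V2) : R :=
  hF F * \sum_(E in edgesF F)
    intE E (fun x => dot (evalvF F u x) (tE E) * dot (evalvF F t x) (tE E))
  + hF F ^+ 2 * prodF F (rotF u) (rotF t)
  + dotF F u mu - dotF F t nu.

(* The solution (sigma, lambda) of A_F((sigma, lambda), .) = L. *)
Definition solveF F (L : V2 -> V2 -> R) : V2 * V2 :=
  xget (0, 0) [set s | [/\ VPol k s.1, RcF (ellF F + 1) s.2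
    & forall t mu, VPol k t -> RcF (ellF F + 1) mu -> AF F s.1 s.2 t mu = L t mu]].

Definition SgradF F (q : XgradF) : V2 :=
  (solveF F (fun t mu =>
    hF F * \sum_(E in edgesF F)
      intE E (fun x => evalE E (gFE q E)^`() x * dot (evalvF F t x) (tE E))
    - prodF F (gF q) (div mu) + bflux F (gFE q) mu)).1.

Definition ScurlF F (v : XcurlF) : V2 :=
  (solveF F (fun t mu =>
    hF F * \sum_(E in edgesF F)
      intE E (fun x => evalE E (cFE v E) x * dot (evalvF F t x) (tE E))
    + hF F ^+ 2 * (dotF F (cRF v) (vrotF (rotF t)) - bcirc F (cFE v) (rotF t))
    + dotF F (cRcF v) mu)).1.

Definition eF F (q : XgradF) : P2 :=
  xget 0 [set e | Pol (k%:Z - 1) e /\ forall w, RcF k w ->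
    prodF F e (div w) = - dotF F (SgradF F q) w + bflux F (gFE q) w].

Definition EgradF F (q : XgradF) : XgradF := MkXgradF (eF F q) (gFE q).

Definition EcurlF F (v : XcurlF) : XcurlF :=
  MkXcurlF (cRF v) (projF F (RcF k) (ScurlF F v)) (cFE v).

Definition hatRcurlF F (v : XcurlF) : XcurlF :=
  MkXcurlF (cRF v) (projF F (RcF (ellF F + 1)) (cRcF v)) (cFE v).

Definition AT T (u nu t mu : V3) : R :=
  hT T * \sum_(F in facesT T)
    intF F (fun x => dot (trace F (evalv u x)) (trace F (evalv t x)))
  + hT T ^+ 2 * dotT T (curl u) (curl t)
  + dotT T u mu - dotT T t nu.

Definition solveT T (L : V3 -> V3 -> R) : V3 * V3 :=
  xget (0, 0) [set s | [/\ VPol k s.1, RcT T (ellT T + 1) s.2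
    & forall t mu, VPol k t -> RcT T (ellT T + 1) mu ->
        AT T s.1 s.2 t mu = L t mu]].

(* sum_F omega_TF int_F (gamma_F^{k+1} E_grad,F q_F) (w . n_F) *)
Definition gflux T (q : XgradT) (w : V3) : R :=
  \sum_(F in facesT T) omegaTF T F *
    intF F (fun x => evalF F (gammaF F (EgradF F (gradT_restr q F))) x
                     * dot (evalv w x) (nF F)).

Definition SgradT T (q : XgradT) : V3 :=
  (solveT T (fun t mu =>
    hT T * \sum_(F in facesT T)
      intF F (fun x => dot (evalvF F (GFk F (EgradF F (gradT_restr q F))) x)
                           (trace F (evalv t x)))
    - prodT T (gT q) (div mu) + gflux T q mu)).1.

Definition gammatE (v : XcurlT) F : V2 := gammatF F (EcurlF F (curlT_restr v F)).

Definition ScurlT T (v : XcurlT) : V3 :=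
  (solveT T (fun t mu =>
    hT T * \sum_(F in facesT T)
      intF F (fun x => dot (evalvF F (gammatE v F) x) (trace F (evalv t x)))
    + hT T ^+ 2 * (dotT T (cRT v) (curl (curl t)) + tflux T (gammatE v) (curl t))
    + dotT T (cRcT v) mu)).1.

Definition eT T (q : XgradT) : P3 :=
  xget 0 [set e | Pol (k%:Z - 1) e /\ forall w, RcT T k w ->
    prodT T e (div w) = - dotT T (SgradT T q) w + gflux T q w].

Definition EgradT T (q : XgradT) : XgradT :=
  MkXgradT (eT T q) (fun F => eF F (gradT_restr q F)) (gTE q).

Definition EcurlT T (v : XcurlT) : XcurlT :=
  MkXcurlT (cRT v) (projT T (RcT T k) (ScurlT T v))
    (cTRF v) (fun F => projF F (RcF k) (ScurlF F (curlT_restr v F))) (cTE v).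

Definition rT T (v : XcurlT) : V3 :=
  xget 0 [set r | RT (k%:Z - 1) r /\ forall w, GcT T k w ->
    dotT T r (curl w) = dotT T (CTk T v) w
      - tflux T (fun F =>
          gammatF F (EcurlF F (hatRcurlF F (curlT_restr v F)))) w].

Definition hatRcurlT T (v : XcurlT) : XcurlT :=
  MkXcurlT (rT T v) (projT T (RcT T (ellT T + 1)) (cRcT v))
    (cTRF v) (fun F => projF F (RcF (ellF F + 1)) (cTRcF v F)) (cTE v).

Definition hatRdivT T (m : int) (w : XdivT) : XdivT :=
  MkXdivT (dGT w) (projT T (GcT T (m + 1)) (dGcT w)) (dTF w).

Definition hatCk T (m : int) (v : XcurlT) : XdivT := hatRdivT T m (Ck T (EcurlT T v)).
Definition hatGk T (q : XgradT) : XcurlT := hatRcurlT T (Gk T (EgradT T q)).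

Definition ker_hatC T (m : int) : set XcurlT :=
  [set v | hatXcurlT T v /\ div_eq T (hatCk T m v) div0].
Definition im_hatG T : set XcurlT :=
  [set v | exists2 q, hatXgradT T q & curl_eq T v (hatGk T q)].

End DDR.

(* Main.v *)
(* Take v = (v_R, 0, 0, 0, 0) with v_R = curl w0, w0 = (x - x_T) x p, where p has
   degree k - 1 and w0 is orthogonal, for the form (curl ., curl .), to
   (x - x_T) x P^{k-2}; a top degree field shows that v_R can be chosen nonzero.
   All tangential traces of E_curl v vanish, so that C_T E_curl v is tested
   against w by (v_R, curl w): this is 0 for gradients and for the fields of
   G^{c,m+1}, as m + 1 <= k - 1, hence v is in the kernel.
   If v were the reduced gradient of q, then q would be constant on the edges and
   all the face gradients G_F E_grad q would vanish, by the uniqueness in the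
   serendipity problem.  Testing r_T with w0, the square norm of v_R would be the
   flux of curl w0 against the face traces of q.  By Stokes' formula on each face,
   this is a combination of the circulations of w0 along the edges, in which each
   edge is met twice with opposite signs; so v_R = 0. *)

From HB Require Import structures.
From mathcomp Require Import all_boot all_order all_algebra.
From mathcomp Require Import all_classical all_reals all_analysis.
From mathcomp Require Import -(notations) mpoly.
From mathcomp Require Import ring lra zify.
Require Import Defs.

Import Order.TTheory GRing.Theory Num.Theory.
Import numFieldNormedType.Exports.
Local Open Scope classical_set_scope.
Local Open Scope ring_scope.

Set Implicit Arguments.
Unset Strict Implicit.
Unset Printing Implicit Defensive.

(** Nothing is assumed on the topology of the element or of its faces: they may have holes, and an
    element may touch itself along an edge. Hence the cancellations on edges and at vertices cannot
    be read off an oriented cell complex; they are derived from the pointwise meaning of the signs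
    [omegaTF] and [omegaFE], by turning around a vertex in the plane of a face and around an edge in
    the plane orthogonal to it ([rays_sum]). For the same reason no Stokes formula with general
    boundary terms is proved. The one used for the fluxes is contained in the equation that defines
    gamma_F, and the serendipity problem only needs Green's formula for polynomials that vanish on
    the boundary, obtained by slicing. The operators are values of [xget] with default 0. When an
    operator is to vanish, or to be orthogonal to a field, both the default and a true solution do;
    existence is proved for G_F, gamma_F, e_F and the projector on R^c(F), whose equations are used
    to compute. The condition k > 0 enters through the top degree field, of degree k - 1. *)

Local Notation XU i := (mpolyX _ (mnm1 i)).
Local Notation "p @_ m" := (mcoeff m p)
  (at level 3, m at level 2, left associativity, format "p @_ m").

(** * Polynomials *)

Lemma mpoly_ring_ind n (A : comNzRingType) (P : mpoly n A -> Prop) :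
  (forall c, P (mpolyC n c)) -> (forall i, P (XU i)) ->
  (forall p q, P p -> P q -> P (p + q)) ->
  (forall p q, P p -> P q -> P (p * q)) -> forall p, P p.
Proof.
move=> PC PX PD PM p; rewrite (mpolyE p); apply: big_ind => [||m _]; [by rewrite -mpolyC0|exact: PD|].
rewrite -mul_mpolyC; apply: (PM) => //.
rewrite mpolyXE_id; apply: big_ind => [||i _]; [by rewrite -mpolyC1|exact: PM|].
elim: (m i) => [|k IH]; first by rewrite expr0 -mpolyC1.
by rewrite exprS; apply: PM.
Qed.

Lemma mderivXU n (A : nzRingType) i j : mderiv i (XU j : mpoly n A) = (i == j)%:R.
Proof.
rewrite mderivX mnm1E eq_sym; case: eqVneq => [->|_]; last by rewrite scale0r.
have -> : mnm_sub (mnm1 j) (mnm1 j) = mnm0 by apply/mnmP => k; rewrite mnmBE subnn mnm0E.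
by rewrite scale1r mpolyX0.
Qed.

(** Chain rule: both sides satisfy the same Leibniz rule and agree on the generators. It serves for
    restriction to a line and for pull-back to the plane of a face. *)
Lemma mmap_derivation n (A : comNzRingType) (S : comNzRingType)
    (f : {rmorphism A -> S}) (h : 'I_n -> S) (d : S -> S) :
  (forall x y, d (x + y) = d x + d y) ->
  (forall x y, d (x * y) = d x * y + x * d y) -> (forall c, d (f c) = 0) ->
  forall p, d (mmap f h p) = \sum_i d (h i) * mmap f h (mderiv i p).
Proof.
move=> dD dM d0; elim/mpoly_ring_ind => [c|i|p q IHp IHq|p q IHp IHq].
- by rewrite mmapC d0 big1 // => i _; rewrite mderivC mmap0 mulr0.
- rewrite mmapX mmap1U (bigD1 i) //= big1 => [|j ji].
    rewrite mderivXU eqxx addr0 -mpolyC1 mmapC -[LHS]mulr1; congr (_ * _).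
    exact: (esym (rmorph1 f)).
  by rewrite mderivXU (negPf ji) mmap0 mulr0.
- rewrite mmapD dD IHp IHq -big_split; apply: eq_bigr => i _ /=.
  by rewrite mderivD mmapD mulrDr.
- have mM a b : mmap f h (a * b) = mmap f h a * mmap f h b.
    exact: (rmorphM (mmap f h)).
  rewrite mM dM IHp IHq mulr_suml mulr_sumr -big_split; apply: eq_bigr => i _ /=.
  by rewrite mderivM mmapD !mM mulrDr; ring.
Qed.

(** * Total degree, and identity theorems for polynomials *)

Section Degree.
Context {R : realType}.
Implicit Types (n : nat) (l : int).

Lemma PolP n l (p : mpoly n R) :
  Pol l p <-> forall m, p@_m != 0 -> (mdeg m)%:Z <= l.
Proof.
split=> H m; first by rewrite -mcoeff_msupp; apply: H.
by rewrite mcoeff_msupp; apply: H.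
Qed.

Lemma Pol0 n l : Pol l (0 : mpoly n R).
Proof. by apply/PolP => m; rewrite mcoeff0 eqxx. Qed.

Lemma PolD n l (p q : mpoly n R) : Pol l p -> Pol l q -> Pol l (p + q).
Proof.
move=> /PolP Hp /PolP Hq; apply/PolP => m; rewrite mcoeffD.
have [->|/Hp //] := eqVneq (p@_m) 0; rewrite add0r; exact: Hq.
Qed.

Lemma PolZ n l c (p : mpoly n R) : Pol l p -> Pol l (c *: p).
Proof.
move=> /PolP Hp; apply/PolP => m; rewrite mcoeffZ mulf_eq0 negb_or.
by case/andP => _; exact: Hp.
Qed.

Lemma PolN n l (p : mpoly n R) : Pol l p -> Pol l (- p).
Proof. by rewrite -scaleN1r; apply: PolZ. Qed.

Lemma PolB n l (p q : mpoly n R) : Pol l p -> Pol l q -> Pol l (p - q).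
Proof. by move=> Hp Hq; apply: PolD => //; apply: PolN. Qed.

Lemma Pol_le n l l' (p : mpoly n R) : l <= l' -> Pol l p -> Pol l' p.
Proof. move=> ll' H m /H; move=> /le_trans; exact. Qed.

Lemma Pol_sum n l (I : Type) (r : seq I) (P : pred I) (F : I -> mpoly n R) :
  (forall i, P i -> Pol l (F i)) -> Pol l (\sum_(i <- r | P i) F i).
Proof.
by move=> H; elim/big_ind: _ => //; [exact: Pol0|exact: PolD].
Qed.

Lemma PolM n l l' (p q : mpoly n R) : Pol l p -> Pol l' q -> Pol (l + l') (p * q).
Proof.
move=> Hp Hq m /msuppM_le/allpairsP[[a b] /= [/Hp pa /Hq qb ->]].
by rewrite mdegD PoszD lerD.
Qed.

Lemma PolC n l c : 0 <= l -> Pol l (mpolyC n c : mpoly n R).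
Proof.
by move=> l0; apply/PolP => m; rewrite mcoeffC mulf_eq0 negb_or pnatr_eq0 eqb0 negbK
  => /andP[_ /eqP ->]; rewrite mdeg0.
Qed.

Lemma PolX n l m : (mdeg m)%:Z <= l -> Pol l (mpolyX R m : mpoly n R).
Proof. by move=> H m'; rewrite msuppX inE => /eqP ->. Qed.

Lemma PolXn n l l' k (p : mpoly n R) : Pol l p -> l' = l * k%:Z -> Pol l' (p ^+ k).
Proof.
move=> Hp ->; elim: k => [|k IH]; first by rewrite mulr0 expr0 -mpolyC1; exact: PolC.
rewrite exprS; have -> : l * k.+1%:Z = l + l * k%:Z by rewrite -addn1 PoszD; ring.
exact: PolM.
Qed.

Lemma Pol_mderiv n l i (p : mpoly n R) : Pol l p -> Pol (l - 1) (mderiv i p).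
Proof.
move=> /PolP Hp; apply/PolP => m; rewrite mcoeff_mderiv => H.
have /Hp : p@_(mnm_add m (mnm1 i)) != 0.
  by apply: contra H => /eqP ->; rewrite mul0rn.
by rewrite mdegD mdeg1 PoszD; lia.
Qed.

Lemma Pol_ltr0 n l (p : mpoly n R) : l < 0 -> Pol l p -> p = 0.
Proof.
move=> l0 /PolP H; apply/mpolyP => m; rewrite mcoeff0; apply/eqP/negPn/negP => /H.
lia.
Qed.

Lemma Pol_exists n (p : mpoly n R) : exists k : nat, Pol k p.
Proof.
exists (msize p) => m /msize_mdeg_lt; rewrite lez_nat; exact: ltnW.
Qed.

Lemma Pol0C n (p : mpoly n R) : Pol 0 p -> exists c, p = mpolyC n c.
Proof.
move=> /PolP H; exists (p@_mnm0); apply/mpolyP => m; rewrite mcoeffC.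
have [->|m0] := eqVneq m mnm0; first by rewrite mulr1.
rewrite mulr0; apply/eqP/negPn/negP => /H; rewrite lez_nat leqn0 mdeg_eq0.
by rewrite (negPf m0).
Qed.

Lemma Pol_mmap n n' l (h : 'I_n -> mpoly n' R) (p : mpoly n R) :
  (forall i, Pol 1 (h i)) -> Pol l p -> Pol l (mmap (@mpolyC n' R) h p).
Proof.
move=> Hh /PolP Hp; rewrite /mmap big_seq; apply: Pol_sum => m.
rewrite mcoeff_msupp => /Hp Hm; apply: Pol_le Hm _.
rewrite -[X in Pol X]add0r; apply: PolM; first exact: PolC.
rewrite /mmap1 mdegE.
elim/big_rec2: _ => [|i k q _ IH]; first by rewrite -mpolyC1; exact: PolC.
by rewrite PoszD; apply: PolM => //; apply: PolXn (Hh i) _; rewrite mul1r.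
Qed.

Lemma mderiv_all0 n (p : mpoly n R) : (forall i, mderiv i p = 0) -> p = mpolyC n (p@_mnm0).
Proof.
move=> H; apply/mpolyP => m; rewrite mcoeffC.
have [->|m0] := eqVneq m mnm0; first by rewrite mulr1.
have [i mi] : exists i, m i != 0%N.
  apply/existsP; apply: contraNT m0 => /existsPn mi; apply/eqP/mnmP => i.
  by rewrite mnm0E; apply/eqP/negPn/mi.
have := congr1 (mcoeff (mnm_sub m (mnm1 i))) (H i); rewrite mcoeff_mderiv mcoeff0 submK.
  by move/eqP; rewrite mulr0 mulrn_eq0 /= => /eqP.
by apply/mnm_lepP => j; rewrite mnm1E; case: eqVneq => [<-|//]; rewrite lt0n.
Qed.

(** The polynomial s -> p(x + s d) as an element of [{poly R}]: integrals along edges, slices of a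
    face and identity theorems all reduce to it. *)
Definition line n (p : mpoly n R) (x d : 'rV[R]_n) : {poly R} :=
  mmap (@polyC R) (fun i => (x 0 i)%:P + d 0 i *: 'X) p.

Lemma horner_line n (p : mpoly n R) x d s :
  (line p x d).[s] = meval (fun i => (x + s *: d) 0 i) p.
Proof.
elim/mpoly_ring_ind: p => [c|i|p q IHp IHq|p q IHp IHq].
- by rewrite /line mmapC hornerC mevalC.
- by rewrite /line mmapX mmap1U mevalXU !mxE hornerD hornerC hornerZ hornerX mulrC.
- by rewrite /line mmapD hornerD mevalD -IHp -IHq.
- rewrite mevalM -IHp -IHq -hornerM; congr horner; exact: (rmorphM (mmap _ _)).
Qed.

Lemma deriv_line n (p : mpoly n R) x d :
  (line p x d)^`() = \sum_i d 0 i *: line (mderiv i p) x d.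
Proof.
rewrite /line (@mmap_derivation _ _ _ _ _ (@deriv R)).
- by apply: eq_bigr => i _; rewrite derivD derivC derivZ derivX add0r -scalerAl mul1r.
- exact: derivD.
- exact: derivM.
- exact: derivC.
Qed.

Lemma deriv_eq0_const (p : {poly R}) : p^`() = 0 -> p = (p`_0)%:P.
Proof.
move=> d0; apply/size1_polyC; rewrite leqNgt; apply/negP => sz.
have := congr1 (fun q : {poly R} => q`_((size p).-2)) d0.
rewrite coef_deriv coef0 => /eqP.
have -> : (size p).-2.+1 = (size p).-1 by lia.
rewrite mulrn_eq0 -lead_coefE lead_coef_eq0 => /orP[/eqP|/eqP e0]; first by lia.
by rewrite e0 size_poly0 in sz.
Qed.

Lemma poly_eq0_near (p : {poly R}) (e : R) : 0 < e ->
  (forall s, 0 < s < e -> p.[s] = 0) -> p = 0.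
Proof.
move=> e0 H; apply/eqP/negPn/negP => p0.
pose rs := [seq e / (2 + i%:R) | i <- iota 0 (size p)].
have : (size rs < size p)%N.
  apply: max_poly_roots => //.
    apply/allP => s /mapP[i _ ->]; apply/rootP/H.
    have i0 : (0 : R) <= i%:R by [].
    have i2 : 0 < 2 + i%:R :> R by lra.
    by rewrite divr_gt0 //= ltr_pdivrMr // ltr_pMr //; lra.
  rewrite map_inj_uniq ?iota_uniq// => i j /(mulfI (lt0r_neq0 e0))/invr_inj/addrI.
  by move/eqP; rewrite eqr_nat => /eqP.
by rewrite size_map size_iota ltnn.
Qed.

(** Induction on the degree. A derivative at a point of the cube is read off the restriction of [p]
    to a coordinate line, which is zero as it vanishes on an interval; so all derivatives are zero
    and [p] is constant. *)
Lemma mpoly_eq0_near n (p : mpoly n R) (x0 : 'rV[R]_n) (r : R) : 0 < r ->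
  (forall x : 'rV[R]_n, (forall i, `|x 0 i - x0 0 i| < r) -> meval (fun i => x 0 i) p = 0) ->
  p = 0.
Proof.
move=> r0; have [k] := Pol_exists p; elim: k p => [|k IH] p Hp H.
  have [c pc] := Pol0C Hp; move: (H x0); rewrite pc mevalC => ->; rewrite ?mpolyC0//.
  by move=> i; rewrite subrr normr0.
have dp i : mderiv i p = 0.
  apply: IH => [|x xr].
    by have := Pol_mderiv (i := i) Hp; rewrite -addn1 PoszD addrK.
  pose e := r - `|x 0 i - x0 0 i|.
  have e0 : 0 < e by rewrite subr_gt0.
  have L0 : line p x (delta_mx 0 i) = 0.
    apply: (poly_eq0_near e0) => s /andP[s0 se]; rewrite horner_line H// => j.
    rewrite !mxE eqxx /=; case: eqVneq => [->|_]; last by rewrite mulr0 addr0.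
    rewrite mulr1 addrAC; apply: le_lt_trans (ler_normD _ _) _.
    by rewrite (gtr0_norm s0) -ltrBrDl.
  have := deriv_line p x (delta_mx 0 i); rewrite L0 deriv0 (bigD1 i) //= big1.
    rewrite mxE !eqxx scale1r addr0 => /(congr1 (fun q : {poly R} => q.[0])).
    rewrite horner0 horner_line => /esym <-; apply: meval_eq => j.
    by rewrite scale0r addr0.
  by move=> j ji; rewrite mxE (negPf ji) andbF scale0r.
have [c pc] : exists c, p = mpolyC n c by exists (p@_mnm0); exact: mderiv_all0.
move: (H x0); rewrite pc mevalC => ->; rewrite ?mpolyC0//.
by move=> i; rewrite subrr normr0.
Qed.

Lemma mpoly_eq0 n (p : mpoly n R) :
  (forall x : 'rV[R]_n, meval (fun i => x 0 i) p = 0) -> p = 0.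
Proof. by move=> H; apply: (mpoly_eq0_near (x0 := 0) (@ltr01 R)) => x _. Qed.

End Degree.

(** * Finite spans and semidefinite forms *)

Section Span.
Context {R : realFieldType} {V : lmodType R}.
Implicit Types (s : seq V) (u v w : V).

(** The span is defined by recursion on the family so as to follow the recursion of Gram-Schmidt, in
    an ambient space that may have infinite dimension. *)
Fixpoint spans s w : Prop :=
  if s is v :: s' then exists a w', spans s' w' /\ w = a *: v + w' else w = 0.

Lemma spans0 s : spans s 0.
Proof. by elim: s => //= v s IH; exists 0, 0; rewrite scale0r addr0. Qed.

Lemma spansD s u v : spans s u -> spans s v -> spans s (u + v).
Proof.
elim: s u v => [|x s IH] u v /= => [-> ->|]; first by rewrite addr0.
move=> [a [u' [su ->]]] [b [v' [sv ->]]]; exists (a + b), (u' + v').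
by split; [exact: IH|rewrite scalerDl addrACA].
Qed.

Lemma spansZ s c u : spans s u -> spans s (c *: u).
Proof.
elim: s u => [|x s IH] u /= => [->|]; first by rewrite scaler0.
move=> [a [u' [su ->]]]; exists (c * a), (c *: u').
by split; [exact: IH|rewrite scalerDr scalerA].
Qed.

Lemma spans_mem s v : v \in s -> spans s v.
Proof.
elim: s => //= x s IH; rewrite inE => /orP[/eqP ->|/IH sv].
  by exists 1, 0; rewrite scale1r addr0; split=> //; exact: spans0.
by exists 0, v; rewrite scale0r add0r.
Qed.

Lemma spans_sum s (I : Type) (r : seq I) (P : pred I) (F : I -> V) :
  (forall i, P i -> spans s (F i)) -> spans s (\sum_(i <- r | P i) F i).
Proof. by move=> H; elim/big_ind: _ => //; [exact: spans0|exact: spansD]. Qed.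

Lemma spans_sub s (S : V -> Prop) : S 0 -> (forall u v, S u -> S v -> S (u + v)) ->
  (forall c u, S u -> S (c *: u)) -> (forall v, v \in s -> S v) ->
  forall w, spans s w -> S w.
Proof.
move=> S0 SD SZ; elim: s => [|x s IH] /= sS w; first by move=> ->.
move=> [a [w' [sw ->]]]; apply: (SD); first by apply/SZ/sS; rewrite mem_head.
by apply: IH => // v vs; apply: sS; rewrite inE vs orbT.
Qed.

Section Form.
Variable B : V -> V -> R.
Hypothesis BD : forall u v w, B (u + v) w = B u w + B v w.
Hypothesis BZ : forall a u w, B (a *: u) w = a * B u w.
Hypothesis BC : forall u w, B u w = B w u.
Hypothesis B0 : forall u, 0 <= B u u.

Let BDr u v w : B w (u + v) = B w u + B w v.
Proof. by rewrite BC BD !(BC w). Qed.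
Let BZr a u w : B w (a *: u) = a * B w u.
Proof. by rewrite BC BZ (BC w). Qed.

Lemma semidef_form0 u v : B u u = 0 -> B v u = 0.
Proof.
move=> Bu; apply/eqP/negPn/negP => Bvu.
(* With this [t] the square of v + t u would be -1, since B u u = 0. *)
pose t := - (B v v + 1) / (2 * B v u).
have := B0 (v + t *: u).
rewrite !(BD, BDr, BZ, BZr) Bu mulr0 mulr0 addr0 (BC u v).
have -> : t * B v u = - (B v v + 1) / 2 by rewrite /t; field.
by have := B0 v; lra.
Qed.

(* Gram-Schmidt; the functional only has to vanish on the null vectors. *)
Lemma riesz s (L : V -> R) : (forall u v, L (u + v) = L u + L v) ->
  (forall a u, L (a *: u) = a * L u) ->
  (forall w, spans s w -> B w w = 0 -> L w = 0) ->
  exists2 g, spans s g & forall w, spans s w -> B g w = L w.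
Proof.
elim: s L => [|v s IH] L LD LZ L0.
  exists 0 => // w /= ->.
  have <- : 0 *: (0 : V) = 0 by rewrite scale0r.
  by rewrite BZr LZ !mul0r.
have sub w : spans s w -> spans (v :: s) w.
  by move=> sw; exists 0, w; rewrite scale0r add0r.
have [g sg Lg] : exists2 g, spans s g & forall w, spans s w -> B g w = L w.
  by apply: IH => // w /sub; apply: L0.
(* [h] is the projection of [v] on the span of [s]. If [n = v - h] is null, the functional vanishes
   on it and [g] already works. *)
have [h sh Lh] : exists2 g, spans s g & forall w, spans s w -> B g w = B v w.
  by apply: IH => // w _; apply: semidef_form0.
have sv : spans (v :: s) v by apply: spans_mem; rewrite mem_head.
pose n := v - h.
have nE : v = n + h by rewrite subrK.
have sn : spans (v :: s) n.
  by apply: spansD => //; rewrite -scaleN1r; apply/spansZ/sub.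
have nw w : spans s w -> B n w = 0.
  by move=> sw; rewrite /n BD -scaleN1r BZ (Lh _ sw); ring.
have [n0|n0] := eqVneq (B n n) 0.
  exists g; first exact: sub.
  move=> w [a [w' [sw ->]]]; rewrite BDr BZr (Lg w')// LD LZ; congr (_ * _ + _).
  by rewrite nE BDr (Lg h)// LD (semidef_form0 _ n0) (L0 n sn n0).
exists (g + ((L n - B g n) / B n n) *: n).
  by apply: spansD; [exact: sub|exact: spansZ].
have Hn : B (g + ((L n - B g n) / B n n) *: n) n = L n by rewrite BD BZ; field.
have Hs w : spans s w -> B (g + ((L n - B g n) / B n n) *: n) w = L w.
  by move=> sw; rewrite BD BZ (nw w)// mulr0 addr0 Lg.
move=> w [a [w' [sw ->]]].
by rewrite BDr BZr (Hs w')// nE (BDr n h) Hn (Hs h)// -(LD n h) -LZ -LD.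
Qed.

End Form.
End Span.

Section PolSpan.
Context {R : realType}.

Lemma Pol_span n (l : int) :
  exists s : seq (mpoly n R), forall p, Pol l p <-> spans s p.
Proof.
case: l => [k|k]; last first.
  by exists [::] => p; split=> [|->]; [exact: Pol_ltr0|exact: Pol0].
pose s := [seq mpolyX R (bmnm m) | m : bmultinom n k.+1].
exists s => p; split=> [Hp|].
  have kp : (msize p <= k.+1)%N.
    by rewrite msizeE; apply/bigmax_leqP_seq => m /Hp; rewrite lez_nat ltnS.
  rewrite (mpolywE kp); apply: spans_sum => m _; apply/spansZ/spans_mem/mapP.
  by exists m => //; rewrite mem_enum.
apply: (spans_sub (S := fun p => Pol (Posz k) p)); [exact: Pol0|exact: PolD|exact: PolZ|].
by move=> _ /mapP[m _ ->]; apply: PolX; rewrite lez_nat -ltnS bmdeg.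
Qed.

Lemma ffPol_span n (l : int) : exists s : seq {ffun 'I_n -> mpoly n R},
  forall f : {ffun 'I_n -> mpoly n R}, (forall i, Pol l (f i)) <-> spans s f.
Proof.
have [s1 s1P] := Pol_span n l.
pose inj (i : 'I_n) (p : mpoly n R) := [ffun j => if j == i then p else 0].
exists [seq inj i p | i <- enum 'I_n, p <- s1] => f; split=> [Hf|].
  have -> : f = \sum_i inj i (f i).
    apply/ffunP => j; rewrite sum_ffunE (bigD1 j) //= ffunE eqxx big1 ?addr0//.
    by move=> i ij; rewrite ffunE eq_sym (negPf ij).
  apply: spans_sum => i _.
  have : spans s1 (f i) by apply/s1P.
  apply: (spans_sub (S := fun p => spans _ (inj i p))).
  - have -> : inj i 0 = 0 by apply/ffunP => j; rewrite !ffunE; case: ifP.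
    exact: spans0.
  - move=> u v Hu Hv.
    have -> : inj i (u + v) = inj i u + inj i v.
      by apply/ffunP => j; rewrite !ffunE; case: ifP => // _; rewrite addr0.
    exact: spansD.
  - move=> c u Hu.
    have -> : inj i (c *: u) = c *: inj i u.
      by apply/ffunP => j; rewrite !ffunE; case: ifP => // _; rewrite scaler0.
    exact: spansZ.
  - move=> p ps; apply: spans_mem; apply: allpairs_f => //; exact: mem_enum.
apply: (spans_sub (S := fun f : {ffun _} => forall i, Pol l (f i))).
- by move=> i; rewrite ffunE; exact: Pol0.
- by move=> u v Hu Hv i; rewrite ffunE; apply: PolD.
- by move=> c u Hu i; rewrite ffunE; apply: PolZ.
- move=> _ /allpairsP[[i p] /= [_ ps ->]] j; rewrite ffunE.
  by case: ifP => _; [apply/s1P/spans_mem|exact: Pol0].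
Qed.

End PolSpan.

(** * Euler operator and Poincare lemma *)

Section Euler.
Context {R : realType}.

(** The operator x . grad multiplies each monomial by its degree, so that [euler + c] is inverted
    coefficientwise for c > 0. Through [div_shift0] this governs the divergence on R^c. *)
Definition euler n (p : mpoly n R) : mpoly n R := \sum_i XU i * mderiv i p.

Lemma eulerD n (p q : mpoly n R) : euler (p + q) = euler p + euler q.
Proof.
by rewrite /euler -big_split; apply: eq_bigr => i _; rewrite mderivD mulrDr.
Qed.

Lemma mcoeff_diag n (w : multinom n -> R) (p : mpoly n R) m :
  (\sum_(m' <- msupp p) (w m' * p@_m') *: mpolyX R m')@_m = w m * p@_m.
Proof.
rewrite raddf_sum /=.
have [mp|mp] := boolP (m \in msupp p).
  rewrite (bigD1_seq m) ?msupp_uniq //= mcoeffZ mcoeffX eqxx mulr1 big1 ?addr0//.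
  by move=> i im; rewrite mcoeffZ mcoeffX (negPf im) mulr0.
rewrite (memN_msupp_eq0 mp) mulr0 big_seq big1 // => i ip.
rewrite mcoeffZ mcoeffX; case: eqVneq => [ie|]; last by rewrite mulr0.
by rewrite -ie ip in mp.
Qed.

Lemma mcoeff_euler n (p : mpoly n R) m : (euler p)@_m = (mdeg m)%:R * p@_m.
Proof.
have eX m' : euler (mpolyX R m') = (mdeg m')%:R *: mpolyX R m'.
  rewrite mdegE natr_sum scaler_suml /euler; apply: eq_bigr => i _.
  rewrite mderivX -scalerAr -mpolyXD.
  have [->|mi] := eqVneq (m' i) 0%N; first by rewrite !scale0r.
  congr (_ *: mpolyX R _); rewrite addmC submK//; apply/mnm_lepP => j.
  by rewrite mnm1E; case: eqVneq => [<-|//]; rewrite lt0n.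
have -> : euler p = \sum_(m' <- msupp p) ((mdeg m')%:R * p@_m') *: mpolyX R m'.
  rewrite {1}(mpolyE p); elim: (msupp p) => [|m' s IH].
    by rewrite !big_nil /euler big1 // => i _; rewrite mderiv0 mulr0.
  rewrite !big_cons eulerD IH; congr (_ + _).
  rewrite [(mdeg m')%:R * _]mulrC -scalerA -eX /euler scaler_sumr; apply: eq_bigr => i _.
  by rewrite mderivZ scalerAr.
exact: mcoeff_diag.
Qed.

Lemma euler_inj n (c : nat) (p q : mpoly n R) : (0 < c)%N ->
  euler p + p *+ c = euler q + q *+ c -> p = q.
Proof.
move=> c0 H; apply/mpolyP => m; have := congr1 (mcoeff m) H.
rewrite !mcoeffD !mcoeffMn !mcoeff_euler -[p@_m *+ c]mulr_natl -[q@_m *+ c]mulr_natl -!mulrDl -natrD.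
by apply: mulfI; rewrite pnatr_eq0 addn_eq0 negb_and (gtn_eqF c0) orbT.
Qed.

Lemma euler_surj n (c : nat) (l : int) (p : mpoly n R) : (0 < c)%N -> Pol l p ->
  exists2 q, Pol l q & euler q + q *+ c = p.
Proof.
move=> c0 /PolP Hp.
exists (\sum_(m <- msupp p) (((mdeg m)%:R + c%:R)^-1 * p@_m) *: mpolyX R m).
  apply/PolP => m; rewrite (mcoeff_diag (fun m => ((mdeg m)%:R + c%:R)^-1)).
  by rewrite mulf_eq0 negb_or => /andP[_ /Hp].
apply/mpolyP => m; rewrite mcoeffD mcoeffMn mcoeff_euler -[X in _ + X]mulr_natl -mulrDl.
rewrite (mcoeff_diag (fun m => ((mdeg m)%:R + c%:R)^-1)) mulrA mulfV ?mul1r//.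
by rewrite -natrD pnatr_eq0 addn_eq0 negb_and (gtn_eqF c0) orbT.
Qed.

Lemma div_shift0 n (p : mpoly n R) : div (p *: shift 0) = euler p + p *+ n.
Proof.
have -> : p *+ n = \sum_(i < n) p by rewrite sumr_const card_ord.
rewrite /div /euler -big_split.
apply: eq_bigr => i _; rewrite /= !mxE mpolyC0 subr0 mderivM mderivXU eqxx mulr1.
by rewrite mulrC.
Qed.

Lemma mderiv_euler n i (p : mpoly n R) : mderiv i (euler p) = euler (mderiv i p) + mderiv i p.
Proof.
apply/mpolyP => m; rewrite mcoeffD mcoeff_mderiv !mcoeff_euler mcoeff_mderiv.
by rewrite mdegD mdeg1 natrD mulrDl mul1r mulrnDl -mulrnAr.
Qed.

(** Poincare lemma. The potential is the integral of x . s(t x) over t in [0, 1], that is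
    [b = x . s] with the coefficient of each monomial divided by its degree. Thus [euler p = b], and
    the symmetry of the derivatives identifies grad p with s after applying [euler + 1]. *)
Lemma curlfree_grad n (l : int) (s : 'rV[mpoly n R]_n) : VPol l s ->
  (forall i j, mderiv i (s 0 j) = mderiv j (s 0 i)) ->
  exists2 p, Pol (l + 1) p & s = grad p.
Proof.
move=> Hs sC; pose b := \sum_i XU i * s 0 i.
have b0 : b@_mnm0 = 0.
  rewrite raddf_sum big1 // => i _ /=; rewrite mulrC.
  rewrite mcoeffM big1 // => -[m1 m2] /eqP /= e.
  have -> : (XU i : mpoly n R)@_(m2 : multinom n) = 0; last by rewrite mulr0.
  rewrite mcoeffX; case: eqVneq => // e2; move: e; rewrite -e2.
  move/(congr1 (fun m : multinom n => m i)); rewrite mnm0E mnmDE mnm1E eqxx /=.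
  by rewrite addn1.
have Hb : Pol (l + 1) b.
  apply: Pol_sum => i _; rewrite addrC; apply: PolM => //; apply: PolX.
  by rewrite mdeg1.
pose p : mpoly n R := \sum_(m <- msupp b) ((mdeg m)%:R^-1 * b@_m) *: mpolyX R m.
have pm m : p@_m = (mdeg m)%:R^-1 * b@_m by exact: (mcoeff_diag (fun m => (mdeg m)%:R^-1)).
have ep : euler p = b.
  apply/mpolyP => m; rewrite mcoeff_euler pm mulrA.
  have [->|m0] := eqVneq m mnm0; first by rewrite b0 mulr0.
  by rewrite mulfV ?mul1r// pnatr_eq0 mdeg_eq0.
exists p.
  apply/PolP => m; rewrite pm mulf_eq0 negb_or => /andP[_]; move/PolP: Hb; exact.
apply/rowP => i; rewrite mxE; apply: (@euler_inj _ 1) => //.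
rewrite !mulr1n -mderiv_euler ep /b raddf_sum /= (bigD1 i) //= /euler (bigD1 i) //=.
rewrite -addrA addrC -addrA [RHS]addrC; congr (_ + _).
  apply: eq_bigr => j ji; rewrite mderivM mderivXU eq_sym (negPf ji) mul0r add0r.
  by rewrite sC.
by rewrite mderivM mderivXU eqxx mul1r.
Qed.

End Euler.

(** * Division by an affine form *)

Section AffineFactor.
Context {R : realType}.

Definition affine n (c : R) (a : 'rV[R]_n) : mpoly n R :=
  mpolyC n c + \sum_i a 0 i *: XU i.

Lemma meval_affine n c (a : 'rV[R]_n) (x : 'I_n -> R) :
  meval x (affine c a) = c + \sum_i a 0 i * x i.
Proof.
rewrite mevalD mevalC raddf_sum /=; congr (_ + _).
by apply: eq_bigr => i _; rewrite mevalZ mevalXU.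
Qed.

Lemma meval_affine0 n c (a : 'rV[R]_n) : meval (fun=> 0) (affine c a) = c.
Proof. by rewrite meval_affine big1 ?addr0// => i _; rewrite mulr0. Qed.

Lemma Pol_affine n c (a : 'rV[R]_n) : Pol 1 (affine c a).
Proof.
apply: PolD; first exact: PolC.
by apply: Pol_sum => i _; apply/PolZ/PolX; rewrite mdeg1.
Qed.

(* The two arguments of the difference below agree modulo the affine form,
   and the second one is the restriction of [p] to its zero set. *)
Lemma affine_factor n c (a : 'rV[R]_n) (p : mpoly n R) : dot a a = 1 ->
  (forall x : 'rV[R]_n, meval (fun i => x 0 i) (affine c a) = 0 ->
     meval (fun i => x 0 i) p = 0) ->
  exists q, p = affine c a * q.
Proof.
move=> aa H; pose L := affine c a.
(* As [a] is a unit vector, x -> x - L(x) a is the orthogonal projection on the zero set of [L]. *)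
pose h i : mpoly n R := XU i - a 0 i *: L.
have hM p1 p2 : mmap (@mpolyC n R) h (p1 * p2) = mmap (@mpolyC n R) h p1 * mmap (@mpolyC n R) h p2.
  exact: (rmorphM (mmap (@mpolyC n R) h)).
have [q pq] : exists q, p - mmap (@mpolyC n R) h p = L * q.
  elim/mpoly_ring_ind: p {H} => [b|i|p1 p2 [q1 e1] [q2 e2]|p1 p2 [q1 e1] [q2 e2]].
  - by exists 0; rewrite mmapC subrr mulr0.
  - by exists (mpolyC n (a 0 i)); rewrite mmapX mmap1U /h opprB addrC subrK -mul_mpolyC mulrC.
  - by exists (q1 + q2); rewrite mmapD opprD addrACA e1 e2 mulrDr.
  - exists (q1 * p2 + mmap (@mpolyC n R) h p1 * q2); rewrite hM.
    by rewrite mulrDr mulrA -e1 mulrCA -e2; ring.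
exists q; rewrite -pq; suff -> : mmap (@mpolyC n R) h p = 0 by rewrite subr0.
apply: mpoly_eq0 => x.
have -> : meval (fun i => x 0 i) (mmap (@mpolyC n R) h p) =
    meval (fun i => meval (fun i => x 0 i) (h i)) p.
  elim/mpoly_ring_ind: (p) => [b|i|p1 p2 e1 e2|p1 p2 e1 e2].
  - by rewrite mmapC !mevalC.
  - by rewrite mmapX mmap1U mevalXU.
  - by rewrite mmapD !mevalD e1 e2.
  - by rewrite hM !mevalM e1 e2.
pose y := \row_i meval (fun i => x 0 i) (h i).
rewrite (meval_eq (v2 := fun i => y 0 i)); last by move=> i; rewrite mxE.
apply: H; rewrite meval_affine.
have -> : \sum_i a 0 i * y 0 i =
    \sum_i a 0 i * x 0 i - dot a a * meval (fun i => x 0 i) L.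
  rewrite /dot mulr_suml -sumrB; apply: eq_bigr => i _.
  by rewrite mxE mevalB mevalXU mevalZ mulrBr mulrA.
by rewrite aa mul1r /L meval_affine; ring.
Qed.

Lemma affine_neq0 n c (a : 'rV[R]_n) : dot a a = 1 -> affine c a != 0.
Proof.
move=> aa; apply/eqP => a0; move: (congr1 (meval (fun i => a 0 i)) a0).
move: (congr1 (meval (fun=> 0)) a0); rewrite meval_affine0 meval_affine !meval0.
by move=> ->; rewrite add0r -/(dot a a) aa => /eqP; rewrite oner_eq0.
Qed.

(** [mmeasure (@mdeg n)] is the degree plus one, so [p] has degree at least 1; degrees add because
    there are no zero divisors. *)
Lemma Pol_divl n (l : int) (p q : mpoly n R) : (2 <= mmeasure (@mdeg n) p)%N ->
  Pol l (p * q) -> Pol (l - 1) q.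
Proof.
have [->|q0] := eqVneq q 0; first by move=> _ _; exact: Pol0.
move=> p2 H; have p0 : p != 0 by apply: contraL p2 => /eqP ->; rewrite msize0.
have pq0 : p * q != 0 by rewrite mulf_neq0.
move=> m /msize_mdeg_lt mq.
have e : (mdeg (mlead (p * q))).+1 =
    (mmeasure (@mdeg n) p + mmeasure (@mdeg n) q).-1.
  by rewrite mlead_deg//; exact: msizeM.
have Hl := H _ (mlead_supp pq0); lia.
Qed.

Lemma msize_affine n c (a : 'rV[R]_n) : dot a a = 1 ->
  (2 <= mmeasure (@mdeg n) (affine c a))%N.
Proof.
move=> aa; rewrite leqNgt; apply/negP => H.
have /msize1_polyC e : (mmeasure (@mdeg n) (affine c a) <= 1)%N by rewrite -ltnS.
move: (congr1 (meval (fun i => a 0 i)) e) (congr1 (meval (fun=> 0)) e).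
rewrite meval_affine0 meval_affine !mevalC.
by rewrite -/(dot a a) aa => <- e'; lra.
Qed.

End AffineFactor.

(** * Gradient, divergence and rotation of polynomial fields *)

Section Calculus.
Context {R : realType}.

Lemma VPol0 n (l : int) : VPol l (0 : 'rV[mpoly n R]_n).
Proof. by move=> i; rewrite mxE; exact: Pol0. Qed.

Lemma VPolD n (l : int) (u v : 'rV[mpoly n R]_n) : VPol l u -> VPol l v -> VPol l (u + v).
Proof. by move=> Hu Hv i; rewrite mxE; exact: PolD. Qed.

Lemma VPolN n (l : int) (u : 'rV[mpoly n R]_n) : VPol l u -> VPol l (- u).
Proof. by move=> Hu i; rewrite mxE; exact: PolN. Qed.

Lemma VPol_le n (l l' : int) (u : 'rV[mpoly n R]_n) : l <= l' -> VPol l u -> VPol l' u.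
Proof. by move=> ll' Hu i; apply: Pol_le ll' _. Qed.

Lemma VPol_shift n (c : 'rV[R]_n) : VPol 1 (shift c).
Proof.
move=> i; rewrite mxE; apply: PolB; last exact: PolC.
by apply: PolX; rewrite mdeg1.
Qed.

Lemma VPolZ n (l l' : int) (p : mpoly n R) (u : 'rV[mpoly n R]_n) :
  Pol l p -> VPol l' u -> VPol (l + l') (p *: u).
Proof. by move=> Hp Hu i; rewrite mxE; exact: PolM. Qed.

Lemma divD n (u v : 'rV[mpoly n R]_n) : div (u + v) = div u + div v.
Proof. by rewrite /div -big_split; apply: eq_bigr => i _; rewrite mxE mderivD. Qed.

Lemma divZ n a (u : 'rV[mpoly n R]_n) : div (mpolyC n a *: u) = a *: div u.
Proof.
rewrite /div scaler_sumr; apply: eq_bigr => i _.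
by rewrite mxE mul_mpolyC mderivZ.
Qed.

Lemma gradD n (p q : mpoly n R) : grad (p + q) = grad p + grad q.
Proof. by apply/rowP => i; rewrite !mxE mderivD. Qed.

Lemma gradC n c : grad (mpolyC n c) = 0 :> 'rV[mpoly n R]_n.
Proof. by apply/rowP => i; rewrite !mxE mderivC. Qed.

Lemma ord2 (i : 'I_2) : i = 0 \/ i = 1.
Proof. by case: i => -[|[]]// p; [left|right]; apply: val_inj. Qed.

Lemma ord3 (i : 'I_3) : [\/ i = 0, i = 1 | i = 2].
Proof.
by case: i => -[|[|[]]]// p; [constructor 1|constructor 2|constructor 3]; apply: val_inj.
Qed.

Lemma row2P (A : Type) (u v : 'rV[A]_2) : u 0 0 = v 0 0 -> u 0 1 = v 0 1 -> u = v.
Proof. by move=> u0 u1; apply/rowP => i; case: (ord2 i) => ->. Qed.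

Lemma div2 (v : 'rV[mpoly 2 R]_2) : div v = mderiv 0 (v 0 0) + mderiv 1 (v 0 1).
Proof.
by rewrite /div big_ord_recl big_ord1; congr (_ + mderiv _ (v 0 _)); apply: val_inj.
Qed.

Lemma rotFE (z : 'rV[mpoly 2 R]_2) : rotF z = mderiv 0 (z 0 1) - mderiv 1 (z 0 0).
Proof. by rewrite /rotF div2 !mxE /= mderivN. Qed.

Lemma vrotFE (r : mpoly 2 R) : vrotF r = \row_i (if i == 0 then mderiv 1 r else - mderiv 0 r).
Proof. by apply/row2P; rewrite !mxE. Qed.

Lemma vrotFD (r s : mpoly 2 R) : vrotF (r + s) = vrotF r + vrotF s.
Proof. by rewrite !vrotFE; apply/row2P; rewrite !mxE/= mderivD ?opprD. Qed.

Lemma vrotFC c : vrotF (mpolyC 2 c) = 0 :> 'rV[mpoly 2 R]_2.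
Proof. by rewrite vrotFE; apply/row2P; rewrite !mxE/= mderivC ?oppr0. Qed.

Lemma div_vrotF (r : mpoly 2 R) : div (vrotF r) = 0.
Proof. by rewrite div2 vrotFE !mxE/= mderivN mderiv_comm subrr. Qed.

Lemma rotfree_grad (l : int) (s : 'rV[mpoly 2 R]_2) : VPol l s -> rotF s = 0 ->
  exists2 p, Pol (l + 1) p & s = grad p.
Proof.
move=> Hs; rewrite rotFE => /subr0_eq e; apply: curlfree_grad => // i j.
by case: (ord2 i) => ->; case: (ord2 j) => ->.
Qed.

(** [r] is a potential of the field turned by +pi/2, which is rotation-free. *)
Lemma divfree_vrotF (l : int) (v : 'rV[mpoly 2 R]_2) : VPol l v -> div v = 0 ->
  exists2 r, Pol (l + 1) r & v = vrotF r.
Proof.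
move=> Hv dv.
have Hs : VPol l (\row_i (if i == 0 then - v 0 1 else v 0 0) : 'rV[mpoly 2 R]_2).
  by move=> i; rewrite mxE; case: ifP => _; [apply: PolN|]; exact: Hv.
have [|r Hr e] := rotfree_grad Hs.
  by rewrite rotFE !mxE/= mderivN opprK -div2.
exists r => //; rewrite vrotFE; apply/row2P; rewrite !mxE/=.
  by have := congr1 (fun u : 'rV_2 => u 0 1) e; rewrite !mxE.
by have := congr1 (fun u : 'rV_2 => u 0 0) e; rewrite !mxE/= => <-; rewrite opprK.
Qed.

Lemma div_shift_surj (l : int) (p : mpoly 2 R) : Pol l p ->
  exists2 q, Pol l q & div (q *: shift 0) = p.
Proof.
move=> Hp; have [q Hq e] := euler_surj (isT : (0 < 2)%N) Hp.
by exists q; rewrite ?div_shift0.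
Qed.

Lemma div_shift_eq0 (q : mpoly 2 R) : div (q *: shift 0) = 0 -> q = 0.
Proof.
move=> e; apply: (@euler_inj _ _ 2) => //; rewrite -div_shift0 e.
by rewrite /euler big1 ?mul0rn ?addr0// => i _; rewrite mderiv0 mulr0.
Qed.

Lemma Pol_div n (l : int) (v : 'rV[mpoly n R]_n) : VPol l v -> Pol (l - 1) (div v).
Proof. by move=> Hv; apply: Pol_sum => i _; apply: Pol_mderiv. Qed.

(** The decomposition P = R + R^c on a face: [q] is chosen so that its product with x - x_F has the
    divergence of [v], and the remainder is divergence-free. *)
Lemma vrotF_shift_decomp (l : int) (v : 'rV[mpoly 2 R]_2) : VPol l v ->
  exists r q, [/\ Pol (l + 1) r, Pol (l - 1) q & v = vrotF r + q *: shift 0].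
Proof.
move=> Hv; have [q Hq e] := div_shift_surj (Pol_div Hv).
have [||r Hr er] := @divfree_vrotF l (v - q *: shift 0).
- apply: VPolD => //; apply: VPolN; rewrite -[l](subrK 1).
  by apply: VPolZ => //; exact: VPol_shift.
- have -> : - (q *: shift 0) = mpolyC 2 (- 1) *: (q *: shift 0).
    by rewrite mpolyCN mpolyC1 scaleN1r.
  by rewrite divD divZ e scaleN1r subrr.
by exists r, q; rewrite -er subrK.
Qed.

Lemma sum3 (V : nmodType) (F : 'I_3 -> V) : \sum_i F i = F 0 + F 1 + F 2.
Proof.
rewrite !big_ord_recl big_ord0 addr0 addrA; congr (F _ + F _ + F _); exact: val_inj.
Qed.

Lemma sum2 (V : nmodType) (F : 'I_2 -> V) : \sum_i F i = F 0 + F 1.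
Proof. by rewrite !big_ord_recl big_ord0 addr0; congr (F _ + F _); exact: val_inj. Qed.

End Calculus.

(** * Vector algebra in dimension 3 *)

Section Vector3.
Context {A : comNzRingType}.
Implicit Types u v w x : 'rV[A]_3.

Lemma row3P u v : u 0 0 = v 0 0 -> u 0 1 = v 0 1 -> u 0 2 = v 0 2 -> u = v.
Proof. by move=> u0 u1 u2; apply/rowP => i; case: (ord3 i) => ->. Qed.

Lemma ord3_addE : ((0 + 1 = 1 :> 'I_3) * (0 + 2 = 2 :> 'I_3) * (1 + 1 = 2 :> 'I_3)) *
  ((1 + 2 = 0 :> 'I_3) * (2 + 1 = 0 :> 'I_3) * (2 + 2 = 1 :> 'I_3)).
Proof. by repeat split; apply: val_inj. Qed.

Lemma dot3 u v : dot u v = u 0 0 * v 0 0 + u 0 1 * v 0 1 + u 0 2 * v 0 2.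
Proof. by rewrite /dot sum3. Qed.

Lemma cross0 u v : cross u v 0 0 = u 0 1 * v 0 2 - u 0 2 * v 0 1.
Proof. by rewrite mxE !ord3_addE. Qed.
Lemma cross1 u v : cross u v 0 1 = u 0 2 * v 0 0 - u 0 0 * v 0 2.
Proof. by rewrite mxE !ord3_addE. Qed.
Lemma cross2 u v : cross u v 0 2 = u 0 0 * v 0 1 - u 0 1 * v 0 0.
Proof. by rewrite mxE !ord3_addE. Qed.
Definition crossE := (cross0, cross1, cross2).

Lemma dotC n (u v : 'rV[A]_n) : dot u v = dot v u.
Proof. by apply: eq_bigr => i _; rewrite mulrC. Qed.
Lemma dotDl n (u v w : 'rV[A]_n) : dot (u + v) w = dot u w + dot v w.
Proof. by rewrite /dot -big_split; apply: eq_bigr => i _; rewrite mxE mulrDl. Qed.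
Lemma dotZl n a (u w : 'rV[A]_n) : dot (a *: u) w = a * dot u w.
Proof. by rewrite /dot mulr_sumr; apply: eq_bigr => i _; rewrite mxE mulrA. Qed.
Lemma dotDr n (u v w : 'rV[A]_n) : dot w (u + v) = dot w u + dot w v.
Proof. by rewrite dotC dotDl !(dotC w). Qed.
Lemma dotZr n a (u w : 'rV[A]_n) : dot w (a *: u) = a * dot w u.
Proof. by rewrite dotC dotZl (dotC w). Qed.
Lemma dotNl n (u w : 'rV[A]_n) : dot (- u) w = - dot u w.
Proof. by rewrite -scaleN1r dotZl mulN1r. Qed.
Lemma dotNr n (u w : 'rV[A]_n) : dot w (- u) = - dot w u.
Proof. by rewrite dotC dotNl dotC. Qed.
Lemma dotBl n (u v w : 'rV[A]_n) : dot (u - v) w = dot u w - dot v w.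
Proof. by rewrite dotDl dotNl. Qed.
Lemma dot0l n (w : 'rV[A]_n) : dot 0 w = 0.
Proof. by apply: big1 => i _; rewrite mxE mul0r. Qed.

Lemma crossDr u v w : cross u (v + w) = cross u v + cross u w.
Proof. by apply/row3P; rewrite !(mxE, ord3_addE); ring. Qed.
Lemma crossZr a u v : cross u (a *: v) = a *: cross u v.
Proof. by apply/row3P; rewrite !(mxE, ord3_addE); ring. Qed.
Lemma crossZl a u v : cross (a *: u) v = a *: cross u v.
Proof. by apply/row3P; rewrite !(mxE, ord3_addE); ring. Qed.
Lemma crossC u v : cross u v = - cross v u.
Proof. by apply/row3P; rewrite !(mxE, ord3_addE); ring. Qed.

Lemma dot_cross_cross u v w x :
  dot (cross u v) (cross w x) = dot u w * dot v x - dot u x * dot v w.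
Proof. by rewrite !dot3 !crossE; ring. Qed.

Lemma cross_cross u v w : cross u (cross v w) = dot u w *: v - dot u v *: w.
Proof. by apply/row3P; rewrite !(mxE, ord3_addE) !dot3; ring. Qed.

Lemma dot_crossC u v w : dot (cross u v) w = dot u (cross v w).
Proof. by rewrite !dot3 !crossE; ring. Qed.

Lemma dot_cross_self u v : dot u (cross u v) = 0.
Proof. by rewrite !dot3 !crossE; ring. Qed.

Lemma dot_cross_selfr u v : dot u (cross v u) = 0.
Proof. by rewrite !dot3 !crossE; ring. Qed.
End Vector3.

(** * Curl of polynomial fields *)

Section Curl.
Context {R : realType}.
Local Notation P3 := (mpoly 3 R).
Local Notation V3 := 'rV[P3]_3.

Lemma curlE (v : V3) :
  ((curl v 0 0 = mderiv 1 (v 0 2) - mderiv 2 (v 0 1)) *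
   (curl v 0 1 = mderiv 2 (v 0 0) - mderiv 0 (v 0 2)) *
   (curl v 0 2 = mderiv 0 (v 0 1) - mderiv 1 (v 0 0)))%type.
Proof. by repeat split; rewrite mxE !ord3_addE. Qed.

Lemma curlD (u v : V3) : curl (u + v) = curl u + curl v.
Proof. by apply/rowP => i; rewrite !mxE !mderivD opprD addrACA. Qed.

Lemma curlZ a (u : V3) : curl (mpolyC 3 a *: u) = mpolyC 3 a *: curl u.
Proof. by apply/rowP => i; rewrite !mxE !mul_mpolyC !mderivZ scalerBr. Qed.

Lemma curl_grad (p : P3) : curl (grad p) = 0.
Proof. by apply/rowP => i; rewrite !mxE mderiv_comm subrr. Qed.

Lemma div_curl (v : V3) : div (curl v) = 0.
Proof.
rewrite /div sum3 !curlE !mderivB.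
rewrite (mderiv_comm 0 1) (mderiv_comm 0 2) (mderiv_comm 1 2); ring.
Qed.

Lemma VPol_curl (l : int) (v : V3) : VPol l v -> VPol (l - 1) (curl v).
Proof. by move=> Hv i; rewrite mxE; apply: PolB; apply: Pol_mderiv. Qed.

Lemma VPol_cross (l l' : int) (u v : V3) : VPol l u -> VPol l' v -> VPol (l + l') (cross u v).
Proof. by move=> Hu Hv i; rewrite mxE; apply: PolB; apply: PolM. Qed.

Lemma mderiv_shift n (c : 'rV[R]_n) i j : mderiv i (shift c 0 j) = (i == j)%:R.
Proof. by rewrite mxE mderivB mderivC subr0 mderivXU. Qed.

Lemma mderiv_shiftX n (c : 'rV[R]_n) i j k : mderiv i (shift c 0 j ^+ k) =
  (i == j)%:R * (k%:R *: shift c 0 j ^+ k.-1).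
Proof.
elim: k => [|k IH]; first by rewrite expr0 -mpolyC1 mderivC scale0r mulr0.
rewrite exprS mderivM IH mderiv_shift mulrCA -mulrDr; congr (_ * _).
case: k {IH} => [|k]; first by rewrite !expr0 scale0r scale1r mulr0 addr0.
by rewrite -scalerAr -exprS -[X in X + _]scale1r -scalerDl nat1r.
Qed.

Lemma shift_power_degree n (c : 'rV[R]_n) i (k : nat) : ~ Pol (k%:Z - 1) (shift c 0 i ^+ k).
Proof.
elim: k => [|k IH].
  rewrite expr0 => /Pol_ltr0 e; have : (1 : mpoly n R) = 0 by apply: e.
  by move/eqP; rewrite oner_eq0.
move=> /(Pol_mderiv (i := i)); rewrite mderiv_shiftX eqxx mul1r => /(PolZ (c := k.+1%:R^-1)).
rewrite scalerA mulVf ?pnatr_eq0// scale1r => H; apply: IH; apply: Pol_le H.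
by rewrite -addn1 PoszD; lia.
Qed.

(** The cross product with x - c raises the degree by one and the curl lowers it, so [p] contributes
    degree at most k - 1. The component of index 1 coming from the top degree field is -(k + 2) (x_0
    - c_0)^k, which [p] cannot compensate. *)
Lemma curl_cross_top (c : 'rV[R]_3) (k : nat) (p : V3) : VPol (k%:Z - 1) p ->
  curl (cross (shift c) ((\row_i if i == 1 then shift c 0 0 ^+ k else 0) + p)) != 0.
Proof.
move=> Hp; pose g := shift c 0 0 ^+ k.
apply/eqP => /(congr1 (fun v : V3 => v 0 1)); rewrite crossDr curlD mxE [RHS]mxE.
have Hq : Pol (k%:Z - 1) (curl (cross (shift c) p) 0 1).
  have H : VPol (1 + (k%:Z - 1) - 1) (curl (cross (shift c) p)).
    by apply: VPol_curl; apply: VPol_cross => //; exact: VPol_shift.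
  have := H 1.
  by have -> : 1 + (k%:Z - 1) - 1 = k%:Z - 1 by ring.
set w := cross _ _; have w0 : w 0 0 = - (shift c 0 2 * g).
  by rewrite crossE [X in _ * X]mxE [X in _ - _ * X]mxE /= mulr0 sub0r.
have w2 : w 0 2 = shift c 0 0 ^+ k.+1.
  by rewrite crossE [X in _ * X]mxE [X in _ - _ * X]mxE /= mulr0 subr0 exprS.
rewrite curlE w0 w2 mderivN mderivM mderiv_shift !mderiv_shiftX /= !mul0r mulr0 addr0 !mul1r.
rewrite -/g -[X in - X - _]scale1r -opprD -scalerDl nat1r => e.
apply: (@shift_power_degree 3 c 0 k); rewrite -/g.
have -> : g = k.+2%:R^-1 *: curl (cross (shift c) p) 0 1.
  have /eqP := e; rewrite addrC subr_eq0 => /eqP ->.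
  by rewrite scalerA mulVf ?scale1r// pnatr_eq0.
exact: PolZ.
Qed.

End Curl.

(** * Boundaries of planar sets *)

Section Rays.
Context {R : realType}.
Implicit Types (s t x y : R).

Lemma fin_min (I : finType) (f : I -> R) : (forall i, 0 < f i) ->
  exists2 d : R, 0 < d & forall i, d <= f i.
Proof.
move=> f0; suff [d d0 H] : exists2 d : R, 0 < d & forall i, i \in enum I -> d <= f i.
  by exists d => // i; apply: H; rewrite mem_enum.
elim: (enum I) => [|i s [d d0 H]]; first by exists 1.
exists (Num.min d (f i)); first by rewrite lt_min d0 f0.
move=> j; rewrite inE => /orP[/eqP ->|/H dj]; rewrite ge_min ?lexx ?orbT//.
by rewrite dj.
Qed.

Lemma fin_max (I : finType) (f : I -> R) : exists d : R, forall i, f i < d.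
Proof.
exists (1 + \sum_i `|f i|) => i; rewrite (bigD1 i) //=.
have : 0 <= \sum_(j | j != i) `|f j| by apply: sumr_ge0.
have := ler_norm (f i); lra.
Qed.

(** Connectedness of the line, in the form: a function whose derivative is zero everywhere is
    constant. *)
Lemma locally_constant (G : R -> R) :
  (forall x, exists2 d : R, 0 < d & forall y, `|y - x| < d -> G y = G x) ->
  forall x y, G x = G y.
Proof.
move=> H x y; apply: is_derive_0_is_cst => z.
have [d d0 Hd] := H z.
apply: (@near_eq_is_derive _ _ _ (cst (G z)) G z 1 0).
apply/nbhs_ballP; exists d => //= w; rewrite /ball/= distrC => wz.
by rewrite (Hd w wz).
Qed.

Let max_lip (a x y : R) : `|Num.max a x - Num.max a y| <= `|x - y|.
Proof.
by case: (lerP a x) => h1; case: (lerP a y) => h2; case: (lerP x y) => h3;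
  solve [lra | rewrite ler_norml; apply/andP; split; lra].
Qed.

Let min_lip (a x y : R) : `|Num.min x a - Num.min y a| <= `|x - y|.
Proof.
by case: (lerP x a) => h1; case: (lerP y a) => h2; case: (lerP x y) => h3;
  solve [lra | rewrite ler_norml; apply/andP; split; lra].
Qed.

Lemma connected_itv (P : R -> Prop) (a b : R) : a <= b ->
  (forall s, a <= s <= b -> exists2 d : R, 0 < d &
    forall s', a <= s' <= b -> `|s' - s| < d -> (P s' <-> P s)) ->
  (P a <-> P b).
Proof.
(* [c] is the projection on [a, b]. Being 1-Lipschitz, it turns local constancy on the segment into
   local constancy on the whole line. *)
move=> ab H; pose c s := Num.max a (Num.min s b).
have cab s : a <= c s <= b.
  by rewrite le_max lexx /= ge_max ab ge_min lexx orbT.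
have cD s s' : `|c s' - c s| <= `|s' - s|.
  apply: le_trans (max_lip _ _ _) (min_lip _ _ _).
have := @locally_constant (fun s => (`[< P (c s) >])%:R) _ a b.
have -> : c a = a by rewrite /c min_l// maxxx.
have -> : c b = b by rewrite /c minxx max_r.
move=> e; have {e} : (`[< P a >])%:R = (`[< P b >])%:R :> R.
  apply: e => s; have [d d0 Hd] := H _ (cab s); exists d => // s' ss'.
  have [E1 E2] := Hd _ (cab s') (le_lt_trans (cD _ _) ss').
  by congr (_%:R); congr nat_of_bool; apply/asboolP/asboolP.
by do 2 case: asboolP => //; move=> _ _ /eqP; rewrite ?oner_eq0 // eq_sym oner_eq0.
Qed.

(* Counting the jumps of a piecewise constant indicator along a line. *)
Lemma crossings (I : finType) (J : pred I) (x sg : I -> R) (chi : R -> bool) :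
  (forall s, exists2 d : R, 0 < d & exists c1 c2 : bool,
     [/\ forall s', s - d < s' < s -> chi s' = c1,
         forall s', s < s' < s + d -> chi s' = c2,
         c2%:R - c1%:R = \sum_(i | J i && (x i == s)) sg i
       & (forall i, J i -> x i != s) -> chi s = c1]) ->
  forall a b, a <= b -> (forall i, J i -> a < x i < b) ->
  (chi b)%:R - (chi a)%:R = \sum_(i | J i) sg i.
Proof.
move=> H a b ab xab.
(* [L] is the left limit of [chi]. Subtracting from it the jumps located before s gives the function
   [G], which is locally constant, hence constant. *)
pose L s := `[< exists2 d : R, 0 < d & forall s', s - d < s' < s -> chi s' >].
have LE s u c : u < s -> (forall s', u < s' < s -> chi s' = c) -> L s = c.
  move=> us; case: c => Hc; last first.
    apply/asboolP => -[d d0 Hd].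
    pose s' := Num.max ((u + s) / 2) (s - d / 2).
    have us' : u < s' by rewrite lt_max; apply/orP; left; lra.
    have ds' : s - d < s' by rewrite lt_max; apply/orP; right; lra.
    have s's : s' < s by rewrite gt_max; apply/andP; split; lra.
    have := Hd s'; rewrite ds' s's Hc ?us'// => /(_ isT); by [].
  apply/asboolP; exists (s - u) => [|s']; first lra.
  by move=> /andP[s1 s2]; rewrite Hc//; apply/andP; split; lra.
pose N s := \sum_(i | J i && (x i < s)) sg i.
pose G s := (L s)%:R - N s.
have GG : forall s s', G s = G s'.
  apply: locally_constant => s; have [d d0 [c1 [c2 [H1 H2 H3 _]]]] := H s.
  have f0 i : 0 < (if x i == s then 1 else `|x i - s|).
    by case: ifPn => // xs; rewrite normr_gt0 subr_eq0.
  have [e e0 He] := fin_min f0.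
  have {}He i : x i != s -> e <= `|x i - s|.
    by move=> xs; have := He i; rewrite (negPf xs).
  exists (Num.min d e); first by rewrite lt_min d0.
  move=> s'; rewrite lt_min => /andP[s'd s'e].
  have Ls : L s = c1.
    by apply: (LE _ (s - d)) => //; rewrite ltrBlDr ltrDl.
  have [ss'|s's] := ltP s s'.
    have Ls' : L s' = c2.
      apply: (LE _ s) => // w /andP[w1 w2]; apply: H2; rewrite w1 /=.
      by move: s'd; rewrite gtr0_norm; lra.
    rewrite /G Ls Ls'; have -> : N s' = N s + (c2%:R - c1%:R); last by ring.
    rewrite H3 /N !big_mkcondr -big_split /=; apply: eq_bigr => i Ji.
    have [->|xs] := eqVneq (x i) s; first by rewrite ss' ltxx add0r.
    rewrite addr0; have := He i xs; move: s'e; rewrite gtr0_norm ?subr_gt0// => s'e.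
    have [xis|xis] := ltP (x i) s; first by rewrite (lt_trans xis ss').
    rewrite ger0_norm ?subr_ge0// => le; rewrite ltNge.
    by have -> : s' <= x i by lra.
  have Ls' : L s' = c1.
    apply: (LE _ (s - d)).
      by move: s'd; rewrite distrC ger0_norm ?subr_ge0//; lra.
    by move=> w /andP[w1 w2]; apply: H1; rewrite w1 /= (lt_le_trans w2).
  rewrite /G Ls Ls'; congr (_ - _); apply: eq_bigl => i; congr (_ && _).
  have [->|xs] := eqVneq (x i) s; first by rewrite ltxx ltNge s's.
  have := He i xs; move: s'e; rewrite distrC ger0_norm ?subr_ge0// => s'e.
  have [xis|xis] := ltP (x i) s; last by rewrite ltNge (le_trans s's xis).
  by rewrite distrC gtr0_norm ?subr_gt0// => le; apply/idP; lra.
have Lchi s : (forall i, J i -> x i != s) -> L s = chi s.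
  move=> xs; have [d d0 [c1 [c2 [H1 _ _ H4]]]] := H s.
  by rewrite H4//; apply: (LE _ (s - d)) => //; rewrite ltrBlDr ltrDl.
have := GG b a; rewrite /G !Lchi; last 2 first.
- by move=> i /xab /andP[+ _]; apply: contraTneq => ->; rewrite ltxx.
- by move=> i /xab /andP[_ +]; apply: contraTneq => ->; rewrite ltxx.
have -> : N a = 0.
  by apply: big_pred0 => i; apply/negP => /andP[/xab /andP[/lt_trans ax _] /ax]; rewrite ltxx.
have -> : N b = \sum_(i | J i) sg i.
  by apply: eq_bigl => i; case Ji : (J i) => //=; case/andP: (xab i Ji).
by rewrite subr0 => <-; ring.
Qed.

End Rays.

(** * Rays bounding a planar set around a point *)

Section PlanarRays.
Context {R : realType}.
Variables (I : finType) (J : pred I) (d1 d2 n1 n2 sg : I -> R).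
Variables (A : R -> R -> Prop) (r : R).

Definition inball (a b : R) := `|a| < r /\ `|b| < r.
Definition offrays (a b : R) :=
  forall i, J i -> forall s, 0 < s -> ~ (a = s * d1 i /\ b = s * d2 i).

Hypothesis r0 : 0 < r.
Hypothesis A_offrays : forall a b, ~ (a = 0 /\ b = 0) -> inball a b -> offrays a b ->
  exists2 d : R, 0 < d & forall a' b', `|a' - a| < d -> `|b' - b| < d -> (A a' b' <-> A a b).
Hypothesis A_ray : forall i (s : R), J i -> 0 < s -> inball (s * d1 i) (s * d2 i) ->
  exists2 d : R, 0 < d & forall e : R, 0 < e < d ->
    A (s * d1 i - e * n1 i) (s * d2 i - e * n2 i) /\
    ~ A (s * d1 i + e * n1 i) (s * d2 i + e * n2 i).
Hypothesis rays_inj : forall i j (s s' : R), J i -> J j -> 0 < s -> 0 < s' ->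
  s * d1 i = s' * d1 j -> s * d2 i = s' * d2 j -> i = j.
Hypothesis sg_sign : forall i, J i -> sg i = 1 \/ sg i = -1.
Hypothesis sg_det : forall i, J i -> 0 < sg i * (d1 i * n2 i - d2 i * n1 i).

Let offrays_scale a b s : 0 < s -> offrays a b -> offrays (s * a) (s * b).
Proof.
move=> s0 H i Ji s' s'0 [e1 e2]; apply: (H i Ji (s' / s)); first exact: divr_gt0.
have s_neq0 : s != 0 by rewrite gt_eqF.
by split; rewrite mulrAC -?e1 -?e2 mulrC mulKf.
Qed.

Let scale_neq0 (a b s : R) : 0 < s -> ~ (a = 0 /\ b = 0) -> ~ (s * a = 0 /\ s * b = 0).
Proof.
move=> s0 ab [e1 e2]; apply: ab; split; apply: (mulfI (lt0r_neq0 s0));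
by rewrite ?e1 ?e2 mulr0.
Qed.

Let small_mul (a h e k : R) : 0 < e -> `|a| <= k -> `|h| < e / (1 + k) -> `|h * a| < e.
Proof.
move=> e0 ak; have k0 : 0 <= k by apply: le_trans ak.
rewrite ltr_pdivlMr; last by lra.
by rewrite normrM => H; apply: le_lt_trans H; apply: ler_wpM2l => //; lra.
Qed.

(** Off the rays, the radius through (a, b) does not meet the boundary, so membership in [A] does
    not change along it. *)
Let A_cone a b l m : ~ (a = 0 /\ b = 0) -> offrays a b -> 0 < l -> 0 < m ->
  inball (l * a) (l * b) -> inball (m * a) (m * b) -> (A (l * a) (l * b) <-> A (m * a) (m * b)).
Proof.
move=> ab0 ab; wlog lm : l m / l <= m.
  move=> H; have [lm|/ltW ml] := leP l m; first exact: H.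
  by move=> l0 m0 bl bm; have := H _ _ ml m0 l0 bm bl; tauto.
move=> l0 m0 _ [bm1 bm2].
apply: (@connected_itv _ (fun s => A (s * a) (s * b))) => // s /andP[ls sm].
have s0 : 0 < s by apply: lt_le_trans ls.
have bs : inball (s * a) (s * b).
  split; [apply: le_lt_trans bm1|apply: le_lt_trans bm2];
  by rewrite !normrM ler_wpM2r// !gtr0_norm.
have sab0 := scale_neq0 s0 ab0.
have [d dp Hd] := A_offrays sab0 bs (offrays_scale s0 ab).
exists (d / (1 + (`|a| + `|b|))).
  by rewrite divr_gt0//; have := normr_ge0 a; have := normr_ge0 b; lra.
move=> s' _ ss'; apply: Hd; rewrite -mulrBl.
  by apply: small_mul ss' => //; rewrite lerDl.
by apply: small_mul ss' => //; rewrite lerDr.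
Qed.

(** [lam] brings (a, b) within r / 2 of the origin; [cone_ind] thus extends the germ of [A] at the
    origin to a cone, which can be followed along whole lines. *)
Definition lam (a b : R) := r / (2 * (1 + (`|a| + `|b|))).
Definition cone_ind (a b : R) := A (lam a b * a) (lam a b * b).

Let lam_gt0 a b : 0 < lam a b.
Proof. by rewrite divr_gt0//; have := normr_ge0 a; have := normr_ge0 b; lra. Qed.

Let lamE a b : lam a b * (`|a| + `|b|) < r / 2.
Proof.
rewrite /lam; set k := `|a| + `|b|; have k0 : 0 <= k by rewrite addr_ge0.
rewrite mulrAC ltr_pdivrMr; last by lra.
have : r * (k + 1) = r / 2 * (2 * (1 + k)) by field.
by move=> <-; rewrite ltr_pM2l//; lra.
Qed.

Let lam_half a b : `|lam a b * a| < r / 2 /\ `|lam a b * b| < r / 2.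
Proof.
have l0 := lam_gt0 a b; split; apply: le_lt_trans (lamE a b);
by rewrite normrM (gtr0_norm l0) ler_pM2l// ?lerDl ?lerDr.
Qed.

Let lam_ball a b : inball (lam a b * a) (lam a b * b).
Proof.
have rr : r / 2 < r by have := r0; lra.
by have [H1 H2] := lam_half a b; split; apply: lt_trans rr.
Qed.

Let cone_indE a b l : ~ (a = 0 /\ b = 0) -> offrays a b -> 0 < l -> inball (l * a) (l * b) ->
  (cone_ind a b <-> A (l * a) (l * b)).
Proof. by move=> ab0 ab l0 bl; apply: A_cone. Qed.

Variable t : R.
Definition slope i := d2 i - t * d1 i.
Hypothesis slope_neq0 : forall i, J i -> slope i != 0.

Section Line.
Variable ep : R.
Hypothesis ep_sign : ep = 1 \/ ep = -1.

(** The curve s -> (s, g2 s) is the line y = t x + ep. The ray i meets it exactly when its slope has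
    the sign of [ep], at distance |slope|^-1 along [d] and at the abscissa [xi i]. *)
Definition xi i := d1 i / `|slope i|.
Definition Je i := J i && (0 < ep * slope i).
Definition g2 s := s * t + ep.

Let epep : ep * ep = 1.
Proof. by case: ep_sign => ->; rewrite ?mulrNN mulr1. Qed.

Lemma g_neq0 s : ~ (s = 0 /\ g2 s = 0).
Proof.
by rewrite /g2 => -[-> /eqP]; rewrite mul0r add0r; case: ep_sign => ->;
  rewrite ?oppr_eq0 oner_eq0.
Qed.

Let xiE i : Je i -> xi i = `|slope i|^-1 * d1 i /\ g2 (xi i) = `|slope i|^-1 * d2 i.
Proof.
case/andP => Ji eb; split; first by rewrite mulrC.
have b0 : 0 < `|slope i| by rewrite normr_gt0 slope_neq0.
have eE : ep * `|slope i| = slope i.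
  have [bp|bn] := ltP 0 (slope i).
    by rewrite gtr0_norm//; case: ep_sign eb => ->; rewrite ?mul1r// mulN1r; lra.
  by rewrite ler0_norm//; case: ep_sign eb => ->; rewrite ?mul1r ?mulN1r ?opprK//; lra.
apply: (mulfI (lt0r_neq0 b0)); rewrite mulrA mulfV ?gt_eqF// mul1r /g2 mulrDr.
rewrite [_ * ep]mulrC eE /xi /slope; field; by rewrite gt_eqF.
Qed.

Lemma offrays_line s : (forall i, Je i -> s != xi i) -> offrays s (g2 s).
Proof.
move=> H i Ji s' s'0 [e1 e2].
have eb : ep = s' * slope i.
  by rewrite /slope; move: e2; rewrite /g2 e1; lra.
have Jei : Je i.
  rewrite /Je Ji eb -mulrA pmulr_rgt0// -expr2 exprn_even_gt0//=; exact: slope_neq0.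
have := H i Jei; rewrite /xi; have -> : `|slope i| = s'^-1.
  have : `|s' * slope i| = 1 by rewrite -eb; case: ep_sign => ->; rewrite ?normrN normr1.
  rewrite normrM gtr0_norm// => e; apply: (mulfI (lt0r_neq0 s'0)).
  by rewrite e mulfV// gt_eqF.
by rewrite invrK mulrC -e1 eqxx.
Qed.

Definition chi s := `[< cone_ind s (g2 s) >].

(** Along the line the cone can only change at the abscissas [xi i]. There, a point of the line is
    rescaled into a foot on the ray plus a multiple of the normal; the sign of this multiple is
    governed by [ep * sg i], and [A_ray] tells on which side [A] is. *)
Lemma line_crossings a b : a <= b -> (forall i, Je i -> a < xi i < b) ->
  (chi b)%:R - (chi a)%:R = \sum_(i | Je i) ep * sg i.
Proof.
apply: crossings => s0.
have f0 i : 0 < (if xi i == s0 then 1 else `|xi i - s0|).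
  by case: ifPn => // xs; rewrite normr_gt0 subr_eq0.
have [de de0 Hde] := fin_min f0.
have off s : s != s0 -> `|s - s0| < de -> offrays s (g2 s).
  move=> ss0 sd; apply: offrays_line => i _; apply/eqP => e.
  have := Hde i; rewrite -e (negPf ss0); lra.
have [i0 /andP[Ji0 /eqP xi0]|none] := pickP (fun i => Je i && (xi i == s0)); last first.
  have off0 : offrays s0 (g2 s0).
    by apply: offrays_line => i Ji; have := none i; rewrite Ji /= eq_sym => ->.
  have [l l0 [lb [lh1 lh2]]] : exists2 l, 0 < l & inball (l * s0) (l * g2 s0) /\
      (`|l * s0| < r / 2 /\ `|l * g2 s0| < r / 2).
    by exists (lam s0 (g2 s0)); [exact: lam_gt0|split; [exact: lam_ball|exact: lam_half]].
  have lz := scale_neq0 l0 (@g_neq0 s0).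
  have [d dp Hd] := A_offrays lz lb (offrays_scale l0 off0).
  pose m : R := Num.min d (r / 2); have m0 : 0 < m by rewrite lt_min dp divr_gt0.
  have k0 : 0 < 1 + l * (1 + `|t|).
    have lt1 : 0 < l * (1 + `|t|) by rewrite mulr_gt0.
    lra.
  have near s : `|s - s0| < Num.min de (m / (1 + l * (1 + `|t|))) -> chi s = chi s0.
    rewrite lt_min => /andP[sd sm].
    have [->//|ss0] := eqVneq s s0.
    have a1 : `|l * s - l * s0| < m.
      rewrite -mulrBr mulrC; apply: small_mul sm => //.
      by rewrite gtr0_norm// ler_pMr//; have := normr_ge0 t; lra.
    have a2 : `|l * g2 s - l * g2 s0| < m.
      have -> : l * g2 s - l * g2 s0 = (s - s0) * (l * t) by rewrite /g2; ring.
      by apply: small_mul sm => //; rewrite normrM gtr0_norm// ler_pM2l//; lra.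
    move: a1 a2; rewrite !lt_min => /andP[a1 a1'] /andP[a2 a2'].
    have bl : inball (l * s) (l * g2 s).
      split.
        have -> : l * s = (l * s - l * s0) + l * s0 by ring.
        by apply: le_lt_trans (ler_normD _ _) _; lra.
      have -> : l * g2 s = (l * g2 s - l * g2 s0) + l * g2 s0 by ring.
      by apply: le_lt_trans (ler_normD _ _) _; lra.
    have e1 := cone_indE (@g_neq0 s) (off s ss0 sd) l0 bl.
    have e2 := Hd _ _ a1 a2.
    have e0 := cone_indE (@g_neq0 s0) off0 l0 lb.
    by apply/asboolP/asboolP; tauto.
  exists (Num.min de (m / (1 + l * (1 + `|t|)))); first by rewrite lt_min de0 divr_gt0.
  exists (chi s0), (chi s0); split=> //.
  - by move=> s /andP[h1 h2]; apply: near; rewrite ltr_norml; apply/andP; split; lra.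
  - by move=> s /andP[h1 h2]; apply: near; rewrite ltr_norml; apply/andP; split; lra.
  - by rewrite subrr big_pred0.
have [Ji b0] := andP Ji0.
set s1 := `|slope i0|^-1; have s1p : 0 < s1 by rewrite invr_gt0 normr_gt0 slope_neq0.
have [y1 y2] := xiE Ji0; rewrite -/s1 xi0 in y1 y2.
pose D : R := d1 i0 * n2 i0 - d2 i0 * n1 i0; have sD : 0 < sg i0 * D := sg_det Ji.
have D0 : D != 0 by apply: contraTneq sD => ->; rewrite mulr0 ltxx.
(* Cramer's rule for the direction of the line in the basis attached to the ray: (1, t) = aa d + bb
   n. *)
pose bb : R := - slope i0 / D; pose aa : R := (n2 i0 - t * n1 i0) / D.
have u1 : 1 = aa * d1 i0 + bb * n1 i0 by rewrite /aa /bb /slope; move: D0; rewrite /D => D0; field.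
have u2 : t = aa * d2 i0 + bb * n2 i0 by rewrite /aa /bb /slope; move: D0; rewrite /D => D0; field.
pose ka : R := ep * sg i0.
have ka1 : ka = 1 \/ ka = -1.
  by rewrite /ka; case: ep_sign => ->; case: (sg_sign Ji) => ->; rewrite ?mulrNN ?mulr1 ?mul1r; auto.
have kabb : ka * bb < 0.
  have -> : ka * bb = - ((ep * slope i0) * (sg i0 * D) / D ^+ 2) by rewrite /ka /bb; field.
  rewrite oppr_lt0; apply: divr_gt0; first exact: mulr_gt0.
  by rewrite exprn_even_gt0.
clearbody aa bb.
(* [K] bounds the points of the line whose abscissa is within 1 of the crossing; with
   [l1 = r / (4 K)], a rescaling by less than 2 l1 brings them into the ball. *)
pose K : R := (`|s0| + 1) * (1 + `|t|) + 1.
have K1 : 1 <= K.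
  by rewrite /K lerDr mulr_ge0//; have := normr_ge0 s0; have := normr_ge0 t; lra.
have gK s : `|s - s0| < 1 -> `|s| <= K /\ `|g2 s| <= K.
  move=> ss; have sn : `|s| <= `|s0| + 1.
    have -> : s = s0 + (s - s0) by ring.
    by apply: le_trans (ler_normD _ _) _; lra.
  have t0 := normr_ge0 t; have s00 := normr_ge0 s0; have sp := normr_ge0 s.
  have st : `|s| * (1 + `|t|) <= (`|s0| + 1) * (1 + `|t|) by rewrite ler_wpM2r//; lra.
  have st0 : 0 <= `|s| * `|t| by apply: mulr_ge0.
  split; first by rewrite /K; lra.
  apply: le_trans (ler_normD _ _) _; rewrite normrM.
  have -> : `|ep| = 1 by case: ep_sign => ->; rewrite ?normrN normr1.
  by rewrite /K; lra.
pose l1 : R := r / (4 * K); have l1p : 0 < l1 by rewrite divr_gt0//; lra.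
have l1K : l1 * K = r / 4 by rewrite /l1; field; rewrite gt_eqF//; lra.
clearbody l1 K.
have ss0 : `|s0 - s0| < 1 by rewrite subrr normr0.
have b1 : inball ((l1 * s1) * d1 i0) ((l1 * s1) * d2 i0).
  rewrite -!mulrA -y1 -y2; have [k1 k2] := gK _ ss0; split; rewrite normrM gtr0_norm//.
    have : l1 * `|s0| <= l1 * K by rewrite ler_pM2l.
    by rewrite l1K; have := r0; lra.
  have : l1 * `|g2 s0| <= l1 * K by rewrite ler_pM2l.
  by rewrite l1K; have := r0; lra.
have [d dp Hd] := A_ray Ji (mulr_gt0 l1p s1p) b1.
pose d' : R := Num.min (Num.min de 1) (Num.min (s1 / 2 / (1 + `|aa|)) (d / (1 + 2 * l1 * `|bb|))).
have d'0 : 0 < d'.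
  have := normr_ge0 aa => ?.
  have : 0 <= 2 * l1 * `|bb| by rewrite !mulr_ge0// ltW.
  by move=> ?; rewrite !lt_min de0 ltr01 !divr_gt0//; lra.
have key s : s != s0 -> `|s - s0| < d' -> chi s = ((s - s0) * ka > 0).
  move=> sns; rewrite !lt_min => /andP[/andP[sde sone] /andP[saa sbb]].
  set h := s - s0 in sde sone saa sbb *.
  have haa : `|h * aa| < s1 / 2 by apply: small_mul saa => //; rewrite divr_gt0.
  have q0 : s1 / 2 < s1 + h * aa.
    by move: haa; rewrite ltr_norml => /andP[]; lra.
  have q0' : 0 < s1 + h * aa by lra.
  (* The factor [la] makes the component along the ray independent of s: the rescaled point is the
     fixed foot l1 s1 d plus e n, to which [A_ray] applies. *)
  pose la : R := l1 * s1 / (s1 + h * aa).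
  have la0 : 0 < la by rewrite divr_gt0// mulr_gt0.
  have la2 : la < 2 * l1.
    rewrite /la ltr_pdivrMr//.
    have : l1 * (s1 / 2) < l1 * (s1 + h * aa) by rewrite ltr_pM2l.
    lra.
  pose e : R := la * h * bb.
  have p1 : la * s = l1 * s1 * d1 i0 + e * n1 i0.
    have -> : s = s0 + h * 1 by rewrite /h; ring.
    by rewrite [in X in h * X]u1 y1 /e /la; field; rewrite gt_eqF.
  have p2 : la * g2 s = l1 * s1 * d2 i0 + e * n2 i0.
    have -> : g2 s = g2 s0 + h * t by rewrite /g2 /h; ring.
    by rewrite [in X in h * X]u2 y2 /e /la; field; rewrite gt_eqF.
  clearbody la.
  have ed : `|e| < d.
    have : `|h * (2 * l1 * bb)| < d.
      apply: small_mul sbb => //; rewrite !normrM (gtr0_norm l1p) ger0_norm//.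
    apply: le_lt_trans; rewrite /e !normrM (gtr0_norm la0) (gtr0_norm l1p).
    rewrite (@ger0_norm _ 2)//.
    have : la * (`|h| * `|bb|) <= 2 * l1 * (`|h| * `|bb|).
      by rewrite ler_wpM2r ?mulr_ge0// ltW.
    lra.
  have bla : inball (la * s) (la * g2 s).
    have [k1 k2] := gK _ sone; split; rewrite normrM gtr0_norm//.
      have : la * `|s| <= 2 * l1 * K by rewrite ler_pM// ltW.
      by rewrite -mulrA l1K; have := r0; lra.
    have : la * `|g2 s| <= 2 * l1 * K by rewrite ler_pM// ltW.
    by rewrite -mulrA l1K; have := r0; lra.
  have ce := cone_indE (@g_neq0 s) (off s sns sde) la0 bla.
  rewrite p1 p2 in ce.
  have hz : h != 0 by rewrite subr_eq0.
  have ekh : e * (h * ka) < 0.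
    have -> : e * (h * ka) = la * h ^+ 2 * (ka * bb) by rewrite /e; ring.
    by rewrite nmulr_llt0// mulr_gt0// exprn_even_gt0.
  have [hk|hk] := ltP 0 (h * ka).
    have e0 : e < 0 by rewrite -(pmulr_llt0 _ hk).
    apply/asboolP/ce.
    have [|H _] := Hd (- e); first by rewrite oppr_gt0 e0 /=; move: ed; rewrite ltr0_norm.
    by rewrite !mulNr !opprK in H.
  have hk' : h * ka < 0.
    rewrite lt_neqAle hk andbT mulf_eq0 negb_or hz /=.
    by case: ka1 => ->; rewrite ?oppr_eq0 oner_eq0.
  have e0 : 0 < e by rewrite -(nmulr_llt0 _ hk').
  apply/asboolP => /ce.
  by have [|_ //] := Hd e; rewrite e0 /=; move: ed; rewrite gtr0_norm.
have m1 : (-1 == 1 :> R) = false by apply/eqP; lra.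
have m2 : (1 == -1 :> R) = false by rewrite eq_sym.
exists d' => //; exists (ka == -1), (ka == 1); split.
- move=> s /andP[h1 h2].
  rewrite key ?(lt_eqF h2)//; last by rewrite ltr_norml; apply/andP; split; lra.
  case: ka1 => ->; rewrite ?eqxx ?m2.
    by apply/negbTE; rewrite -leNgt; lra.
  by apply/idP; lra.
- move=> s /andP[h1 h2].
  rewrite key ?(gt_eqF h1)//; last by rewrite ltr_norml; apply/andP; split; lra.
  case: ka1 => ->; rewrite ?eqxx ?m1.
    by apply/idP; lra.
  by apply/negbTE; rewrite -leNgt; lra.
- rewrite (bigD1 i0) /=; last by rewrite Ji0 xi0 eqxx.
  rewrite big1 ?addr0 -/ka.
    by case: ka1 => ->; rewrite ?eqxx ?m1 ?m2 ?subr0 ?sub0r.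
  move=> j /andP[/andP[Jj /eqP xj] ji0]; have [z1 z2] := xiE Jj.
  case/eqP: ji0; apply: (@rays_inj _ _ `|slope j|^-1 s1) => //; first by case/andP: Jj.
  - by rewrite invr_gt0 normr_gt0 slope_neq0//; case/andP: Jj.
  - by rewrite -z1 -y1 xj.
  - by rewrite -z2 -y2 xj.
- by move=> /(_ _ Ji0); rewrite xi0 eqxx.
Qed.

End Line.

(** Every ray crosses exactly one of the lines y = t x + 1 and y = t x - 1. Far away both lines have
    the directions (1, t) and -(1, t), which are not rays, so the cone has the same values at the
    ends of both. The two crossing counts are therefore equal, and they carry [sg] with the factors
    1 and -1. *)
Lemma rays_sum_slope : \sum_(i | J i) sg i = 0.
Proof.
have t0 := normr_ge0 t.
have [l l0 lt2] : exists2 l : R, 0 < l & l * (1 + `|t|) = r / 2.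
  exists (r / (2 * (1 + `|t|))); first by rewrite divr_gt0//; lra.
  by field; rewrite gt_eqF//; lra.
have lt0 : 0 <= l * `|t| by rewrite mulr_ge0// ltW.
have off (v : R) : v = 1 \/ v = -1 -> offrays (v * l) (v * (l * t)).
  move=> vE i Ji s s0 [e1 e2].
  have : s * slope i = 0.
    have -> : s * slope i = s * d2 i - t * (s * d1 i) by rewrite /slope; ring.
    by rewrite -e2 -e1; ring.
  by move/eqP; rewrite mulf_eq0 (negPf (slope_neq0 Ji)) gt_eqF.
have vnorm (v : R) : v = 1 \/ v = -1 -> `|v| = 1 :> R.
  by case=> ->; rewrite ?normrN normr1.
have nz (v : R) : v = 1 \/ v = -1 -> ~ (v * l = 0 /\ v * (l * t) = 0).
  move=> vE [/eqP + _]; rewrite mulf_eq0 (gt_eqF l0) orbF => /eqP v0.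
  by have := vnorm v vE; rewrite v0 normr0 => /eqP; rewrite eq_sym oner_eq0.
have lr2 : l <= r / 2 by lra.
have ltr2 : l * `|t| <= r / 2 by lra.
have vb (v : R) : v = 1 \/ v = -1 -> inball (v * l) (v * (l * t)).
  move=> /vnorm v1; split; rewrite !normrM v1 mul1r (gtr0_norm l0);
  have := r0; lra.
have one : (1 : R) = 1 \/ (1 : R) = -1 by left.
have mone : (-1 : R) = 1 \/ (-1 : R) = -1 by right.
have [dp dp0 Hp] := A_offrays (nz _ one) (vb _ one) (off _ one).
have [dm dm0 Hm] := A_offrays (nz _ mone) (vb _ mone) (off _ mone).
have [K HK] := fin_max (fun i => `|xi i|).
have [m m0 mle] : exists2 m : R, 0 < m & [/\ m <= dp, m <= dm & m <= r / 2].
  exists (Num.min dp (Num.min dm (r / 2))).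
    by rewrite !lt_min dp0 dm0 divr_gt0.
  by rewrite !ge_min !lexx !orbT.
case: mle => mp mm mr.
(* Beyond [K] there are no more crossings, and [l / s < m] puts the rescaled far points within [m]
   of l (1, t) and -l (1, t). *)
have [s [s1 sK sm]] : exists s : R, [/\ 1 <= s, K < s & l / s < m].
  have lm : 0 < l / m by rewrite divr_gt0.
  exists (1 + `|K| + l / m); have := ler_norm K; have K0 := normr_ge0 K => KK.
  split; [lra|lra|]; rewrite ltr_pdivrMr; last lra.
  rewrite mulrDr -[X in X < _](divfK (lt0r_neq0 m0)) [X in X < _]mulrC ltrDr.
  by rewrite mulr_gt0//; lra.
have s0 : 0 < s by lra.
have ls0 : 0 < l / s by rewrite divr_gt0.
have far (v ep : R) : v = 1 \/ v = -1 -> ep = 1 \/ ep = -1 ->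
    (forall a' b', `|a' - v * l| < m -> `|b' - v * (l * t)| < m ->
      (A a' b' <-> A (v * l) (v * (l * t)))) ->
    chi ep (v * s) = `[< A (v * l) (v * (l * t)) >].
  move=> vE epE HA; have v1 := vnorm v vE; have ep1 := vnorm ep epE.
  have offs : offrays (v * s) (g2 ep (v * s)).
    apply: (offrays_line epE) => i _; apply/eqP => e; have := HK i.
    by rewrite -e normrM v1 mul1r gtr0_norm//; lra.
  have p1 : l / s * (v * s) = v * l by field; rewrite gt_eqF.
  have p2 : l / s * g2 ep (v * s) = v * (l * t) + l / s * ep.
    by rewrite /g2; field; rewrite gt_eqF.
  have a1 : `|l / s * (v * s) - v * l| < m by rewrite p1 subrr normr0.
  have a2 : `|l / s * g2 ep (v * s) - v * (l * t)| < m.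
    by rewrite p2 addrAC subrr add0r normrM ep1 mulr1 gtr0_norm.
  have bl : inball (l / s * (v * s)) (l / s * g2 ep (v * s)).
    split; first by rewrite p1; have [] := vb v vE.
    rewrite p2; apply: le_lt_trans (ler_normD _ _) _.
    have -> : `|v * (l * t)| = l * `|t| by rewrite !normrM v1 mul1r gtr0_norm.
    have -> : `|l / s * ep| = l / s by rewrite normrM ep1 mulr1 gtr0_norm.
    lra.
  have e1 := cone_indE (g_neq0 epE (s := v * s)) offs ls0 bl.
  have e2 := HA _ _ a1 a2.
  by apply/asboolP/asboolP; tauto.
have chip (ep : R) : ep = 1 \/ ep = -1 -> chi ep s = `[< A (1 * l) (1 * (l * t)) >].
  move=> epE; rewrite -[s in LHS]mul1r; apply: far => // a' b' h1 h2.
  by apply: Hp; [apply: lt_le_trans h1 mp|apply: lt_le_trans h2 mp].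
have chim (ep : R) : ep = 1 \/ ep = -1 -> chi ep (- s) = `[< A (-1 * l) (-1 * (l * t)) >].
  move=> epE; rewrite -[s in LHS]mul1r -mulNr; apply: far => // a' b' h1 h2.
  by apply: Hm; [apply: lt_le_trans h1 mm|apply: lt_le_trans h2 mm].
have cross (ep : R) : ep = 1 \/ ep = -1 -> \sum_(i | Je ep i) ep * sg i =
    (`[< A (1 * l) (1 * (l * t)) >])%:R - (`[< A (-1 * l) (-1 * (l * t)) >])%:R.
  move=> epE; rewrite -(chip ep)// -(chim ep)//; apply/esym/(line_crossings epE).
    lra.
  move=> i _; have := HK i; have := ler_norm (xi i); have := ler_norm (- xi i).
  by rewrite normrN => h1 h2 h3; apply/andP; split; lra.
rewrite (bigID (fun i => 0 < slope i)) /=.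
have -> : \sum_(i | J i && (0 < slope i)) sg i = \sum_(i | Je 1 i) 1 * sg i.
  by apply: eq_big => [i|i _]; rewrite /Je mul1r.
have -> : \sum_(i | J i && ~~ (0 < slope i)) sg i = - \sum_(i | Je (-1) i) -1 * sg i.
  rewrite -sumrN; apply: eq_big => [i|i _]; last by rewrite mulN1r opprK.
  rewrite /Je; case Ji : (J i) => //=; rewrite mulN1r oppr_gt0 -leNgt.
  by rewrite le_eqVlt (negPf (slope_neq0 Ji)).
by rewrite !cross// subrr.
Qed.

End PlanarRays.

(* The boundary of [A] near the origin consists of finitely many rays, and [A]
   lies locally on one side of each of them: going around the origin, one
   enters [A] as often as one leaves it. *)
Lemma rays_sum (R : realType) (I : finType) (J : pred I) (d1 d2 n1 n2 sg : I -> R)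
    (A : R -> R -> Prop) (r : R) : 0 < r ->
  (forall a b, ~ (a = 0 /\ b = 0) -> inball r a b -> offrays J d1 d2 a b ->
    exists2 d : R, 0 < d &
      forall a' b', `|a' - a| < d -> `|b' - b| < d -> (A a' b' <-> A a b)) ->
  (forall i s, J i -> 0 < s -> inball r (s * d1 i) (s * d2 i) ->
    exists2 d : R, 0 < d & forall e, 0 < e < d ->
      A (s * d1 i - e * n1 i) (s * d2 i - e * n2 i) /\
      ~ A (s * d1 i + e * n1 i) (s * d2 i + e * n2 i)) ->
  (forall i j s s', J i -> J j -> 0 < s -> 0 < s' ->
    s * d1 i = s' * d1 j -> s * d2 i = s' * d2 j -> i = j) ->
  (forall i, J i -> sg i = 1 \/ sg i = -1) ->
  (forall i, J i -> 0 < sg i * (d1 i * n2 i - d2 i * n1 i)) ->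
  \sum_(i | J i) sg i = 0.
Proof.
move=> r0 A1 A2 A3 A4 A5.
(* [t] exceeds every d2 / d1, so that no ray has the direction (1, t) or its opposite; d1 = d2 = 0
   is excluded by the determinant. *)
pose t := 1 + \sum_i `|d2 i / d1 i|.
apply: (@rays_sum_slope R I J d1 d2 n1 n2 sg A r r0 A1 A2 A3 A4 A5 t) => i Ji.
apply/eqP => /subr0_eq e; have := A5 i Ji.
have [z|z] := eqVneq (d1 i) 0; first by rewrite e z; lra.
have ei : d2 i / d1 i = t by rewrite e mulfK.
have : d2 i / d1 i < t; last by rewrite ei ltxx.
rewrite /t (bigD1 i) //=.
have : 0 <= \sum_(j | j != i) `|d2 j / d1 j| by apply: sumr_ge0.
by have := ler_norm (d2 i / d1 i); lra.
Qed.

(** * Integrals of polynomials *)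

Section PolyIntegral.
Context {R : realType}.

Lemma meval_bounded n (p : mpoly n R) (K : R) :
  exists C : R, forall x : 'I_n -> R, (forall i, `|x i| <= K) -> `|meval x p| <= C.
Proof.
elim/mpoly_ring_ind: p => [c|i|p q [Cp Hp] [Cq Hq]|p q [Cp Hp] [Cq Hq]].
- by exists `|c| => x _; rewrite mevalC.
- by exists K => x /(_ i); rewrite mevalXU.
- exists (Cp + Cq) => x xK; rewrite mevalD; apply: le_trans (ler_normD _ _) _.
  by apply: lerD; [exact: Hp|exact: Hq].
- exists (Cp * Cq) => x xK; rewrite mevalM normrM.
  by apply: ler_pM => //; [exact: Hp|exact: Hq].
Qed.

Lemma meval_continuous n (p : mpoly n R) (x0 : 'I_n -> R) (ep : R) : 0 < ep ->
  exists2 d : R, 0 < d & forall x : 'I_n -> R, (forall i, `|x i - x0 i| < d) ->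
    `|meval x p - meval x0 p| < ep.
Proof.
elim/mpoly_ring_ind: p ep => [c|i|p q Hp Hq|p q Hp Hq] ep ep0.
- by exists 1 => // x _; rewrite !mevalC subrr normr0.
- by exists ep => // x /(_ i); rewrite !mevalXU.
- have e2 : 0 < ep / 2 by rewrite divr_gt0.
  have [d d0 Hd] := Hp _ e2; have [d' d'0 Hd'] := Hq _ e2.
  have ml : Num.min d d' <= d by rewrite ge_min lexx.
  have mr : Num.min d d' <= d' by rewrite ge_min lexx orbT.
  exists (Num.min d d'); first by rewrite lt_min d0.
  move=> x xd; rewrite !mevalD opprD addrACA; apply: le_lt_trans (ler_normD _ _) _.
  have := Hd x; have := Hd' x => h1 h2.
  have {}h1 := h1 (fun i => lt_le_trans (xd i) mr).
  have {}h2 := h2 (fun i => lt_le_trans (xd i) ml).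
  lra.
- set a := meval x0 p; set b := meval x0 q.
  pose k := 1 + `|a| + `|b|; have a0 := normr_ge0 a; have b0 := normr_ge0 b.
  have k0 : 0 < k by rewrite /k; lra.
  pose e := Num.min 1 (ep / (2 * k)).
  have e0 : 0 < e by rewrite lt_min ltr01 divr_gt0// mulr_gt0.
  have [d d0 Hd] := Hp _ e0; have [d' d'0 Hd'] := Hq _ e0.
  have ml : Num.min d d' <= d by rewrite ge_min lexx.
  have mr : Num.min d d' <= d' by rewrite ge_min lexx orbT.
  exists (Num.min d d'); first by rewrite lt_min d0.
  move=> x xd; rewrite !mevalM -/a -/b.
  have := Hd x; have := Hd' x => h1 h2.
  have {}h1 := h1 (fun i => lt_le_trans (xd i) mr).
  have {}h2 := h2 (fun i => lt_le_trans (xd i) ml).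
  rewrite -/a in h2; rewrite -/b in h1.
  have -> : meval x p * meval x q - a * b =
    (meval x p - a) * (meval x q - b) + a * (meval x q - b) + b * (meval x p - a) by ring.
  move: h1 h2; set u := meval x p - a; set v := meval x q - b; rewrite !lt_min.
  move=> /andP[v1 ve] /andP[u1 ue].
  apply: le_lt_trans (ler_normD _ _) _.
  apply: (@le_lt_trans _ _ (`|u * v| + `|a * v| + `|b * u|)).
    by rewrite lerD2r ler_normD.
  rewrite !normrM.
  have uv : `|u| * `|v| <= 1 * `|v| by rewrite ler_wpM2r// ltW.
  have av : `|a| * `|v| <= `|a| * (ep / (2 * k)) by rewrite ler_wpM2l// ltW.
  have bu : `|b| * `|u| <= `|b| * (ep / (2 * k)) by rewrite ler_wpM2l// ltW.
  have kE : k * (ep / (2 * k)) = ep / 2 by field; rewrite gt_eqF.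
  have : `|v| + `|a| * (ep / (2 * k)) + `|b| * (ep / (2 * k)) < k * (ep / (2 * k)).
    by rewrite /k; lra.
  lra.
Qed.

Context d (X : measurableType d) (mu : {measure set X -> \bar R}) (n : nat).
Variables (U : set X) (e : X -> 'I_n -> R).

(* Common to the sets over which [intT] and [intF] integrate; the last clause
   makes a polynomial that vanishes on [U] the zero polynomial. *)
Definition poly_domain :=
  [/\ measurable U, (mu U < +oo)%E, forall i, measurable_fun setT (fun y => e y i),
      exists K : R, forall y, U y -> forall i, `|e y i| <= K &
      (forall y0, U y0 -> forall ep : R, 0 < ep -> exists V, [/\ measurable V,
         V `<=` U, (0 < mu V)%E & forall y, V y -> forall i, `|e y i - e y0 i| < ep]) /\
      (exists y0 (r : R), 0 < r /\ forall x : 'rV[R]_n,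
         (forall i, `|x 0 i - e y0 i| < r) -> exists2 y, U y & forall i, e y i = x 0 i)].

Hypothesis dom : poly_domain.

Definition pint (p : mpoly n R) : R := \int[mu]_(y in U) meval (e y) p.

Lemma measurable_meval (p : mpoly n R) (D : set X) : measurable_fun D (fun y => meval (e y) p).
Proof.
have [_ _ me _ _] := dom.
apply: (@measurable_funTS _ _ _ _ D).
elim/mpoly_ring_ind: p => [c|i|p q Hp Hq|p q Hp Hq].
- by under eq_fun do rewrite mevalC; exact: measurable_cst.
- by under eq_fun do rewrite mevalXU; exact: me.
- by under eq_fun do rewrite mevalD; exact: measurable_realfun.measurable_funD.
- by under eq_fun do rewrite mevalM; exact: measurable_realfun.measurable_funM.
Qed.

Lemma integrable_meval (p : mpoly n R) : mu.-integrable U (EFin \o (fun y => meval (e y) p)).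
Proof.
have [mU muU _ [K HK] _] := dom.
apply: measurable_bounded_integrable => //; first exact: measurable_meval.
have [C HC] := meval_bounded p K.
exists C; split; first exact: num_real.
by move=> M CM y Uy; apply: le_trans (ltW CM); apply: HC; exact: HK.
Qed.

Lemma pintD (p q : mpoly n R) : pint (p + q) = pint p + pint q.
Proof.
have [mU _ _ _ _] := dom.
rewrite /pint; under eq_Rintegral do rewrite mevalD.
by rewrite RintegralD//; exact: integrable_meval.
Qed.

Lemma pintZ c (p : mpoly n R) : pint (c *: p) = c * pint p.
Proof.
have [mU _ _ _ _] := dom.
rewrite /pint; under eq_Rintegral do rewrite mevalZ.
by rewrite RintegralZl//; exact: integrable_meval.
Qed.

Lemma pint_ge0 (p : mpoly n R) : (forall y, U y -> 0 <= meval (e y) p) -> 0 <= pint p.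
Proof. exact: Rintegral_ge0. Qed.

(** If [p] were positive at a point of [U], it would exceed half that value on some [V] of positive
    measure, and the integral would be positive. Hence [p] vanishes on [U], in particular for all
    coordinates in some cube. *)
Lemma pint_pos0 (p : mpoly n R) : (forall y, U y -> 0 <= meval (e y) p) -> pint p = 0 ->
  p = 0.
Proof.
have [mU muU me _ [Hpos [y0 [r [r0 Hr]]]]] := dom.
move=> p0 Jp; apply: (@mpoly_eq0_near _ _ _ (\row_i e y0 i) r r0) => x xr.
have [|y Uy ex] := Hr x; first by move=> i; have := xr i; rewrite mxE.
rewrite (meval_eq (v2 := e y)); last by move=> i; rewrite ex.
apply/eqP/negPn/negP => py; have py0 : 0 < meval (e y) p by rewrite lt_neqAle eq_sym py p0.
have [dl dl0 Hd] := meval_continuous p (e y) (divr_gt0 py0 (ltr0n R 2)).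
have [V [mV VU muV Vd]] := Hpos y Uy dl dl0.
have iV : mu.-integrable V (EFin \o (fun y => meval (e y) p)).
  by apply: integrableS (integrable_meval p).
have muVoo : (mu V < +oo)%E by apply: le_lt_trans muU; apply: le_measure; rewrite ?inE.
have h1 : \int[mu]_(y in V) (meval (e y) p) <= pint p.
  have -> : pint p = \int[mu]_(y in V) meval (e y) p + \int[mu]_(y in U `\` V) meval (e y) p.
    rewrite /pint -Rintegral_setU//.
    - by rewrite setDUK.
    - exact: measurableD.
    - by rewrite setDUK//; exact: integrable_meval.
    - exact/disj_setPRL.
  by rewrite lerDl; apply: Rintegral_ge0 => z [Uz _]; exact: p0.
have h2 : (meval (e y) p / 2) * fine (mu V) <= \int[mu]_(y in V) (meval (e y) p).
  rewrite -Rintegral_cst//; apply: le_Rintegral => //.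
    apply: measurable_bounded_integrable => //; exists `|meval (e y) p / 2|.
    by split=> [|M cM z _]; [exact: num_real|exact: ltW].
  move=> z Vz; have := Hd (e z) (Vd z Vz); rewrite ltr_norml => /andP[h _]; lra.
have : 0 < (meval (e y) p / 2) * fine (mu V).
  by rewrite mulr_gt0 ?divr_gt0// fine_gt0// muV.
lra.
Qed.

Lemma pint_sq0 (p : mpoly n R) : pint (p * p) = 0 -> p = 0.
Proof.
move=> /pint_pos0 pp; apply/eqP; rewrite -sqrf_eq0 expr2 pp// => y _.
by rewrite mevalM -expr2 sqr_ge0.
Qed.

Lemma pint0 : pint 0 = 0.
Proof. by rewrite -[0 in LHS](scale0r 0) pintZ mul0r. Qed.

Lemma pintN (p : mpoly n R) : pint (- p) = - pint p.
Proof. by rewrite -scaleN1r pintZ mulN1r. Qed.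

Lemma pint_sum (I : Type) (s : seq I) (P : pred I) (F : I -> mpoly n R) :
  pint (\sum_(i <- s | P i) F i) = \sum_(i <- s | P i) pint (F i).
Proof. by elim/big_rec2: _ => [|i x y _ <-]; rewrite ?pint0// pintD. Qed.

Lemma pint1_gt0 : 0 < pint 1.
Proof.
have p1 y : U y -> 0 <= meval (e y) 1 by rewrite meval1.
rewrite lt_neqAle pint_ge0// andbT eq_sym; apply/eqP => /(pint_pos0 p1)/eqP.
by rewrite oner_eq0.
Qed.

End PolyIntegral.

(** * Open sets in coordinates and their measurability *)

Section Coordinates.
Context {R : realType}.

Lemma nbhs_rowP n (x : 'rV[R]_n) (V : set 'rV[R]_n) : nbhs x V <->
  exists2 e : R, 0 < e & forall y : 'rV[R]_n, (forall i, `|y 0 i - x 0 i| < e) -> V y.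
Proof.
split=> [/nbhs_ballP[e /= e0 H]|[e e0 H]].
  exists e => // y Hy; apply: H; split=> // i j; rewrite (ord1 i).
  by rewrite /ball /= distrC; exact: Hy.
apply/nbhs_ballP; exists e => //= y [_ Hy]; apply: H => i.
by have := Hy 0 i; rewrite /ball /= distrC.
Qed.

Lemma open_rowP n (A : set 'rV[R]_n) x : open A -> A x ->
  exists2 e : R, 0 < e & forall y : 'rV[R]_n, (forall i, `|y 0 i - x 0 i| < e) -> A y.
Proof. by move=> oA Ax; apply/nbhs_rowP; exact: open_nbhs_nbhs. Qed.

Lemma closure_rowP n (A : set 'rV[R]_n) (x : 'rV[R]_n) : closure A x <->
  forall e : R, 0 < e -> exists2 y : 'rV[R]_n, A y & forall i, `|y 0 i - x 0 i| < e.
Proof.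
split=> [H e e0|H V /nbhs_rowP[e e0 HV]].
  have [|y [Ay By]] := H [set y : 'rV[R]_n | forall i, `|y 0 i - x 0 i| < e].
    by apply/nbhs_rowP; exists e.
  by exists y.
by have [y Ay yx] := H e e0; exists y; split=> //; exact: HV.
Qed.

Lemma nbhs_pairP (x : R * R) (V : set (R * R)) : nbhs x V <->
  exists2 e : R, 0 < e & forall a b, `|a - x.1| < e -> `|b - x.2| < e -> V (a, b).
Proof.
split=> [/nbhs_ballP[e /= e0 H]|[e e0 H]].
  by exists e => // a b ax bx; apply: H; split; rewrite /ball /= distrC.
apply/nbhs_ballP; exists e => //= -[a b] [/= a1 b1]; apply: H;
  by rewrite distrC.
Qed.

Lemma open_pairP (A : set (R * R)) x : open A -> A x ->
  exists2 e : R, 0 < e & forall a b, `|a - x.1| < e -> `|b - x.2| < e -> A (a, b).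
Proof. by move=> oA Ax; apply/nbhs_pairP; exact: open_nbhs_nbhs. Qed.

Lemma bounded_rowP n (A : set 'rV[R]_n) : bounded_set A ->
  exists K : R, forall x, A x -> forall i, `|x 0 i| <= K.
Proof.
move=> [M [_ HM]]; exists (M + 1) => x Ax i.
have := HM (M + 1); rewrite ltrDl => /(_ ltr01 x Ax); apply: le_trans.
rewrite /Num.norm/= mx_normrE; apply: le_trans (le_bigmax _ _ (0, i)).
exact: lexx.
Qed.

Lemma bounded_pairP (A : set (R * R)) : bounded_set A ->
  exists K : R, forall x, A x -> `|x.1| <= K /\ `|x.2| <= K.
Proof.
move=> [M [_ HM]]; exists (M + 1) => x Ax.
have := HM (M + 1); rewrite ltrDl => /(_ ltr01 x Ax).
by rewrite /Num.norm/= ge_max => /andP[].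
Qed.

(** Intervals with rational ends, indexed by [nat]: a countable basis. It makes the open subsets of
    a product measurable for the product sigma-algebra, as countable unions of boxes. *)
Definition rat_itv (i : nat) : set R :=
  if unpickle i is Some (p, q) then `]ratr p, ratr (q : rat)[%classic else set0.

Lemma rat_itvP (x e : R) : 0 < e ->
  exists i, rat_itv i x /\ forall y, rat_itv i y -> `|y - x| < e.
Proof.
move=> e0; have [p] := @rat_in_itvoo R (x - e) x (ltac:(by rewrite ltrBlDr ltrDl)).
rewrite in_itv /= => /andP[p1 p2].
have [q] := @rat_in_itvoo R x (x + e) (ltac:(by rewrite ltrDl)).
rewrite in_itv /= => /andP[q1 q2].
exists (pickle (p, q)); rewrite /rat_itv pickleK; split.
  by rewrite /= in_itv /= p2 q1.
move=> y; rewrite /= in_itv /= => /andP[y1 y2].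
by rewrite ltr_norml; apply/andP; split; lra.
Qed.

Lemma measurable_rat_itv i : measurable (rat_itv i).
Proof. by rewrite /rat_itv; case: unpickle => [[p q]|]; [exact: measurable_itv|]. Qed.

Lemma measurable_open2 (V : set (R * R)) :
  (forall x, V x -> exists2 e : R, 0 < e &
     forall a b, `|a - x.1| < e -> `|b - x.2| < e -> V (a, b)) ->
  measurable V.
Proof.
move=> HV.
have -> : V = \bigcup_(i in [set: nat]) \bigcup_(j in [set j | rat_itv i `*` rat_itv j `<=` V])
    (rat_itv i `*` rat_itv j).
  apply/seteqP; split=> [[a b] Vab|x [i _ [j Hj]]]; last exact: Hj.
  have [e e0 H] := HV _ Vab.
  have [i [ia Hi]] := rat_itvP a e0; have [j [jb Hj]] := rat_itvP b e0.
  exists i => //; exists j => // -[a' b'] [/= /Hi a1 /Hj b1]; exact: H.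
apply: bigcup_measurable => i _; apply: bigcup_measurable => j _.
by apply: measurableX; exact: measurable_rat_itv.
Qed.

Lemma measurable_open3 (V : set (R * R * R)) :
  (forall x, V x -> exists2 e : R, 0 < e & forall a b c,
     `|a - x.1.1| < e -> `|b - x.1.2| < e -> `|c - x.2| < e -> V (a, b, c)) ->
  measurable V.
Proof.
move=> HV.
have -> : V = \bigcup_(i in [set: nat]) \bigcup_(j in [set: nat])
    \bigcup_(k in [set k | (rat_itv i `*` rat_itv j) `*` rat_itv k `<=` V])
    ((rat_itv i `*` rat_itv j) `*` rat_itv k).
  apply/seteqP; split=> [[[a b] c] Vab|x [i _ [j _ [k Hk]]]]; last exact: Hk.
  have [e e0 H] := HV _ Vab.
  have [i [ia Hi]] := rat_itvP a e0; have [j [jb Hj]] := rat_itvP b e0.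
  have [k [kc Hk]] := rat_itvP c e0.
  exists i => //; exists j => //; exists k => //.
  by move=> -[[a' b'] c'] [/= [/= /Hi a1 /Hj b1] /Hk c1]; exact: H.
apply: bigcup_measurable => i _; apply: bigcup_measurable => j _.
apply: bigcup_measurable => k _.
by apply: measurableX; [apply: measurableX|]; exact: measurable_rat_itv.
Qed.

Local Notation leb := (@lebesgue_measure R).

Definition coord2 (y : R * R) (i : 'I_2) : R := if i == 0 then y.1 else y.2.

Lemma leb_itvoo_gt0 (a e : R) : 0 < e -> (0 < leb `](a - e)%R, (a + e)%R[%classic)%E.
Proof.
move=> e0; rewrite lebesgue_measure_itv /= lte_fin.
have -> : a - e < a + e by lra.
by rewrite -EFinD lte_fin; lra.
Qed.

Lemma leb_itvcc_lty (K : R) : (leb `[(- K)%R, K]%classic < +oo)%E.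
Proof.
by rewrite lebesgue_measure_itv /=; case: ifP => _; rewrite ?ltry// -EFinD ltry.
Qed.

Lemma leb_box2_gt0 (y : R * R) (e : R) : 0 < e -> (0 < (leb \x leb)%E
   (`](y.1 - e)%R, (y.1 + e)%R[%classic `*` `](y.2 - e)%R, (y.2 + e)%R[%classic))%E.
Proof.
move=> e0; rewrite product_measure1E; try exact: measurable_itv.
by apply: mule_gt0; exact: leb_itvoo_gt0.
Qed.

Lemma leb_box2_lty (K : R) :
  ((leb \x leb)%E (`[(- K)%R, K]%classic `*` `[(- K)%R, K]%classic) < +oo)%E.
Proof.
rewrite product_measure1E; try exact: measurable_itv.
by apply: lte_mul_pinfty; rewrite ?ge0_fin_numE ?measure_ge0 ?leb_itvcc_lty.
Qed.

Lemma poly_domain2 (U : set (R * R)) : U !=set0 -> open U -> bounded_set U ->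
  poly_domain (leb \x leb)%E U coord2.
Proof.
move=> [y0 Uy0] oU /bounded_pairP[K HK].
have mU : measurable U by apply: measurable_open2 => x Ux; exact: open_pairP.
split=> //.
- apply: (@le_lt_trans _ _ ((leb \x leb)%E (`[(- K)%R, K]%classic `*` `[(- K)%R, K]%classic))).
    apply: le_measure; rewrite ?inE//.
      by apply: measurableX; exact: measurable_itv.
    by move=> y /HK[]; rewrite !ler_norml => h1 h2; split; rewrite /= in_itv.
  exact: leb_box2_lty.
- by move=> i; rewrite /coord2; case: (i == 0); [exact: measurable_fst|exact: measurable_snd].
- exists K => y /HK[h1 h2] i; rewrite /coord2; by case: ifP.
split.
  move=> y Uy ep ep0; have [e e0 He] := open_pairP oU Uy.
  have m0 : 0 < Num.min e ep by rewrite lt_min e0.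
  set m := Num.min e ep in m0 *.
  exists (`](y.1 - m)%R, (y.1 + m)%R[%classic `*` `](y.2 - m)%R, (y.2 + m)%R[%classic); split.
  - by apply: measurableX; exact: measurable_itv.
  - move=> [a b] [/=]; rewrite !in_itv /= => /andP[h1 h2] /andP[h3 h4].
    have me : m <= e by rewrite ge_min lexx.
    by apply: He; rewrite ltr_norml; apply/andP; split; lra.
  - exact: leb_box2_gt0.
  - move=> [a b] [/=]; rewrite !in_itv /= => /andP[h1 h2] /andP[h3 h4] i.
    have me : m <= ep by rewrite ge_min lexx orbT.
    by rewrite /coord2; case: ifP => _; rewrite ltr_norml; apply/andP; split; rewrite /=; lra.
have [e e0 He] := open_pairP oU Uy0; exists y0, e; split=> // x Hx.
exists (x 0 0, x 0 1); first by apply: He; [exact: (Hx 0)|exact: (Hx 1)].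
by move=> i; rewrite /coord2; case: (ord2 i) => ->.
Qed.

Lemma pt3E (y : R * R * R) : ((pt3 y 0 0 = y.1.1) * (pt3 y 0 1 = y.1.2) * (pt3 y 0 2 = y.2))%type.
Proof. by rewrite !mxE. Qed.

Lemma poly_domain3 (A : set 'rV[R]_3) : A !=set0 -> open A -> bounded_set A ->
  poly_domain ((leb \x leb) \x leb)%E (pt3 @^-1` A) (fun y i => pt3 y 0 i).
Proof.
move=> [y0 Ay0] oA /bounded_rowP[K HK].
have box x : A (pt3 x) -> exists2 e : R, 0 < e & forall a b c,
     `|a - x.1.1| < e -> `|b - x.1.2| < e -> `|c - x.2| < e -> A (pt3 (a, b, c)).
  move=> Ax; have [e e0 He] := open_rowP oA Ax; exists e => // a b c h1 h2 h3.
  by apply: He => i; case: (ord3 i) => ->; rewrite !pt3E.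
have mU : measurable (pt3 @^-1` A) by exact: measurable_open3.
have bx e : 0 < e -> forall y : R * R * R,
   (0 < ((leb \x leb) \x leb)%E ((`](y.1.1 - e)%R, (y.1.1 + e)%R[%classic `*`
     `](y.1.2 - e)%R, (y.1.2 + e)%R[%classic) `*` `](y.2 - e)%R, (y.2 + e)%R[%classic))%E.
  move=> e0 y; rewrite product_measure1E; [|apply: measurableX; exact: measurable_itv|exact: measurable_itv].
  by apply: mule_gt0; [exact: (leb_box2_gt0 y.1)|exact: leb_itvoo_gt0].
split=> //.
- apply: (@le_lt_trans _ _ (((leb \x leb) \x leb)%E
    ((`[(- K)%R, K]%classic `*` `[(- K)%R, K]%classic) `*` `[(- K)%R, K]%classic))).
    apply: le_measure; rewrite ?inE//.
      by apply: measurableX; [apply: measurableX|]; exact: measurable_itv.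
    move=> y /HK H; have := H 0; have := H 1; have := H 2; rewrite !pt3E !ler_norml.
    by move=> h1 h2 h3; split; [split|]; rewrite /= in_itv.
  rewrite product_measure1E; [|apply: measurableX; exact: measurable_itv|exact: measurable_itv].
  apply: lte_mul_pinfty; [exact: measure_ge0| |exact: leb_itvcc_lty].
  by rewrite ge0_fin_numE; [exact: leb_box2_lty|exact: measure_ge0].
- move=> i; case: (ord3 i) => ->; under eq_fun do rewrite pt3E.
  + by apply: (measurableT_comp measurable_fst); exact: measurable_fst.
  + by apply: (measurableT_comp measurable_snd); exact: measurable_fst.
  + exact: measurable_snd.
- by exists K => y /HK.
split.
  move=> y Uy ep ep0; have [e e0 He] := box _ Uy.
  have m0 : 0 < Num.min e ep by rewrite lt_min e0.
  set m := Num.min e ep in m0 *.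
  exists ((`](y.1.1 - m)%R, (y.1.1 + m)%R[%classic `*`
     `](y.1.2 - m)%R, (y.1.2 + m)%R[%classic) `*` `](y.2 - m)%R, (y.2 + m)%R[%classic); split.
  - by apply: measurableX; [apply: measurableX|]; exact: measurable_itv.
  - move=> [[a b] c] [/= [/=]]; rewrite !in_itv /= => /andP[h1 h2] /andP[h3 h4] /andP[h5 h6].
    have me : m <= e by rewrite ge_min lexx.
    by apply: He; rewrite ltr_norml; apply/andP; split; lra.
  - exact: bx.
  - move=> [[a b] c] [/= [/=]]; rewrite !in_itv /= => /andP[h1 h2] /andP[h3 h4] /andP[h5 h6] i.
    have me : m <= ep by rewrite ge_min lexx orbT.
    by case: (ord3 i) => ->; rewrite !pt3E ltr_norml; apply/andP; split; rewrite /=; lra.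
have [e e0 He] := open_rowP oA Ay0; exists (y0 0 0, y0 0 1, y0 0 2), e; split=> // x Hx.
have px : pt3 (x 0 0, x 0 1, x 0 2) = x by apply/row3P; rewrite pt3E.
exists (x 0 0, x 0 1, x 0 2); last by rewrite px.
by rewrite /= px; apply: He => i; have := Hx i; case: (ord3 i) => ->; rewrite !pt3E.
Qed.

End Coordinates.

(** * Integrals on segments, and Green's formula with zero boundary values *)

Section PolyReal.
Context {R : realType}.
Local Notation leb := (@lebesgue_measure R).
Implicit Types (p q : {poly R}) (a b : R).

Lemma is_derive_horner p (x : R) : is_derive x (1 : R) (fun s : R => p.[s]) (p^`()).[x].
Proof.
elim/poly_ind: p => [|p c IH].
  rewrite deriv0 horner0; have -> : (fun s : R => (0 : {poly R}).[s]) = cst 0.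
    by apply/funext => s; rewrite horner0.
  exact: is_derive_cst.
rewrite derivD derivC addr0 derivM derivX mulr1 !hornerE.
have -> : (fun s : R => (p * 'X + c%:P).[s]) = (fun s : R => p.[s]) \* id \+ cst c.
  by apply/funext => s; rewrite !hornerE.
have H1 : is_derive x (1 : R) (@id R) 1 by exact: is_derive_id.
have H := is_deriveM IH H1; have Hc := is_derive_cst c x (1 : R).
apply: is_derive_eq; rewrite /= addr0 !scaler1 -mulr_algr; rewrite /GRing.scale /=; ring.
Qed.

Lemma continuous_horner p : continuous (fun s : R => p.[s]).
Proof.
move=> x; apply: differentiable_continuous; apply/derivable1_diffP.
by have [] := is_derive_horner p x.
Qed.

Lemma integrable_horner p a b (D : set (measurableTypeR R)) : measurable D -> D `<=` `[a, b]%classic ->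
  leb.-integrable D (EFin \o (fun s => p.[s])).
Proof.
move=> mD Dab; apply: (integrableS _ mD Dab); first exact: measurable_itv.
apply: continuous_compact_integrable; first exact: segment_compact.
by apply: continuous_subspaceT; exact: continuous_horner.
Qed.

Lemma FTC_horner p a b : a <= b ->
  \int[leb]_(s in `[a, b]%classic) (p^`()).[s] = p.[b] - p.[a].
Proof.
rewrite le_eqVlt => /predU1P[->|ab].
  by rewrite set_itv1 Rintegral_set1 subrr.
rewrite /Rintegral (@continuous_FTC2 _ _ (fun s => p.[s])) => //.
- by apply: continuous_subspaceT; exact: continuous_horner.
- split.
  + by move=> x _; have [] := is_derive_horner p x.
  + by apply: cvg_at_right_filter; exact: continuous_horner.
  + by apply: cvg_at_left_filter; exact: continuous_horner.
- by move=> x _; rewrite derive1E; apply: derive_val; exact: is_derive_horner.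
Qed.

Lemma FTC_horner_oo p a b : a <= b ->
  \int[leb]_(s in `]a, b[%classic) (p^`()).[s] = p.[b] - p.[a].
Proof.
move=> ab; rewrite -FTC_horner//.
rewrite (Rintegral_itv_obnd_cbnd (b := BLeft b)); last first.
  by apply: (@integrable_horner _ (a) (b)); [exact: measurable_itv|exact: subset_itv_oo_cc].
rewrite Rintegral_itv_bndo_bndc//.
by apply: (@integrable_horner _ (a) (b)); [exact: measurable_itv|exact: subset_itv_co_cc].
Qed.

Lemma poly_antideriv p : exists q, q^`() = p.
Proof.
exists (\poly_(i < (size p).+1) (p`_i.-1 / i%:R)); apply/polyP => i.
rewrite coef_deriv coef_poly ltnS; case: ltnP => [ip|pi].
  by rewrite /= -[LHS]mulr_natr divfK// pnatr_eq0.
by rewrite mul0rn nth_default.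
Qed.

(** An antiderivative of p^2 is nondecreasing and takes equal values at both ends, so it is
    constant. *)
Lemma Rintegral_sq_eq0 p b : 0 < b ->
  \int[leb]_(s in `[0, b]%classic) (p.[s] * p.[s]) = 0 -> p = 0.
Proof.
move=> b0 H; have [q qp] := poly_antideriv (p * p).
have q1 s : 0 <= s -> s <= b -> q.[0] <= q.[s] /\ q.[s] <= q.[b].
  move=> s0 sb; split; rewrite -subr_ge0 -FTC_horner// qp; apply: Rintegral_ge0 => x _;
  by rewrite hornerM -expr2 sqr_ge0.
have qb : q.[b] = q.[0].
  apply/eqP; rewrite -subr_eq0 -FTC_horner ?ltW// qp -[X in _ == X]H; apply/eqP.
  by apply: eq_Rintegral => x _; rewrite hornerM.
have : q - (q.[0])%:P = 0.
  apply: (poly_eq0_near b0) => s /andP[s0 sb]; rewrite !hornerE.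
  by have [h1 h2] := q1 s (ltW s0) (ltW sb); apply/eqP; rewrite subr_eq0 eq_le h1 andbT -qb.
move=> /(congr1 (@deriv R)); rewrite derivB derivC subr0 deriv0 qp => /eqP.
by rewrite mulf_eq0 orbb => /eqP.
Qed.

Lemma poly_finite_roots p : p != 0 -> exists rs : seq R, forall x, root p x -> x \in rs.
Proof.
have [n] := ubnP (size p); elim: n p => // n IH p pn p0.
have [[x px]|np] := pselect (exists x, root p x); last first.
  by exists [::] => x px; case: np; exists x.
have [q pq] := factor_theorem _ _ px.
have q0 : q != 0 by apply: contraNneq p0 => q0; rewrite pq q0 mul0r.
have [|rs Hrs] := IH q _ q0.
  move: pn; rewrite pq size_mul ?polyXsubC_eq0// size_XsubC addn2 /=.
  by rewrite ltnS.
exists (x :: rs) => y; rewrite pq rootM root_XsubC inE => /orP[/Hrs ->|->//].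
by rewrite orbT.
Qed.

Section OpenSet.
Variables (U : set R) (p : {poly R}).
Hypothesis oU : forall x, U x -> exists2 e : R, 0 < e & forall y, `|y - x| < e -> U y.
Hypothesis bU : forall x, ~ U x -> (forall e : R, 0 < e -> exists2 y, U y & `|y - x| < e) ->
  p.[x] = 0.

Let mU : measurable (U : set (measurableTypeR R)).
Proof.
apply: measurable_realfun.open_measurable; rewrite openE => x Ux; have [e e0 He] := oU Ux.
by apply/nbhs_ballP; exists e => //= y; rewrite /ball /= distrC; exact: He.
Qed.

Let h x := if `[< U x >] then p.[x] else 0.

Let int_U a b : \int[leb]_(s in `]a, b[%classic `&` U) (p^`()).[s] =
  \int[leb]_(s in `]a, b[%classic) ((fun s => (p^`()).[s]) \_ U) s.
Proof. exact: Rintegral_mkcondr. Qed.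

Let integrable_U a b (c1 c2 : bool) :
  leb.-integrable [set` Interval (BSide c1 a) (BSide c2 b)]
    (EFin \o ((fun s => (p^`()).[s]) \_ U)).
Proof.
rewrite -restrict_EFin; apply/integrable_restrict => //.
apply: (@integrable_horner _ (a) (b)).
  by apply: measurableI => //; exact: measurable_itv.
move=> x [+ _]; case: c1; case: c2; rewrite /= !in_itv /= => /andP[h1 h2];
by apply/andP; split; lra.
Qed.

(** The components of [U] are never listed. [h] extends [p] by zero outside [U], and the induction
    is on a list containing the roots of [p] in the interval: it is cut at a root, and an interval
    without roots contains no boundary point of [U], so it lies inside or outside [U]. *)
Lemma Rintegral_deriv_open (rs : seq R) (a b : R) : a <= b ->
  (forall x, a < x < b -> root p x -> x \in rs) ->
  \int[leb]_(s in `]a, b[%classic `&` U) (p^`()).[s] = h b - h a.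
Proof.
elim: rs a b => [|r rs IH] a b ab Hrs; last first.
  have [/andP[ar rb]|nr] := boolP (a < r < b); last first.
    apply: IH => // x xab px; have := Hrs x xab px; rewrite inE => /orP[/eqP xr|//].
    by rewrite -xr xab in nr.
  have h1 : \int[leb]_(s in `]a, r[%classic `&` U) (p^`()).[s] = h r - h a.
    apply: IH; first exact: ltW.
    move=> x /andP[ax xr] px; have := Hrs x; rewrite ax (lt_trans xr rb) => /(_ isT px).
    by rewrite inE => /orP[/eqP xe|//]; rewrite xe ltxx in xr.
  have h2 : \int[leb]_(s in `]r, b[%classic `&` U) (p^`()).[s] = h b - h r.
    apply: IH; first exact: ltW.
    move=> x /andP[rx xb] px; have := Hrs x; rewrite xb (lt_trans ar rx) => /(_ isT px).
    by rewrite inE => /orP[/eqP xe|//]; rewrite xe ltxx in rx.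
  set g := (fun s => (p^`()).[s]) \_ U.
  have i1 : \int[leb]_(s in `]a, r]%classic) g s = h r - h a.
    by rewrite -Rintegral_itv_bndo_bndc; [rewrite -int_U|exact: integrable_U].
  have i2 : \int[leb]_(s in `]r, b[%classic) g s = h b - h r by rewrite -int_U.
  have H : \int[leb]_(s in `]a, b[%classic) g s - \int[leb]_(s in `]a, r]%classic) g s =
      \int[leb]_(s in `]r, b[%classic) g s.
    apply: (@Rintegral_itvB R g (BRight a) (BLeft b) r); first exact: integrable_U.
      by rewrite bnd_simp ltW.
    by rewrite bnd_simp.
  by rewrite int_U; move: H; rewrite i1 i2; lra.
move: ab; rewrite le_eqVlt => /predU1P[->|ab].
  by rewrite set_itvoo0 set0I Rintegral_set0 subrr.
have const x y : a < x -> x <= y -> y < b -> (U x <-> U y).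
  move=> ax xy yb; apply: connected_itv => // s /andP[xs sy].
  have [Us|nUs] := pselect (U s).
    by have [e e0 He] := oU Us; exists e => // s' _ /He.
  have [H|nH] := pselect (forall e : R, 0 < e -> exists2 y, U y & `|y - s| < e).
    have := Hrs s; rewrite (lt_le_trans ax xs) (le_lt_trans sy yb) => /(_ isT).
    by rewrite /root bU// eqxx => /(_ isT).
  have [e e0 He] : exists2 e : R, 0 < e & forall y, `|y - s| < e -> ~ U y.
    apply: contrapT => H; apply: nH => e e0; apply: contrapT => H2; apply: H.
    by exists e => // z zs Uz; apply: H2; exists z.
  by exists e => // s' _ /He nUs'; split.
pose m := (a + b) / 2; have am : a < m by rewrite /m; lra.
have mb : m < b by rewrite /m; lra.
have constm x : a < x < b -> (U x <-> U m).
  move=> /andP[ax xb]; have [xm|/ltW mx] := leP x m; first exact: const.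
  by have := const m x am mx xb; tauto.
have [Um|nUm] := pselect (U m).
  have -> : `]a, b[%classic `&` U = `]a, b[%classic.
    by apply/seteqP; split=> x; [case|rewrite /= in_itv /= => xab; split=> //; have := constm x xab; tauto].
  (* An end of the interval that is not in [U] is a boundary point of [U], where [p] vanishes in
     agreement with [h]. *)
  rewrite FTC_horner_oo ?ltW//; congr (_ - _); rewrite /h; case: asboolP => // nU; apply: bU => // e e0.
    pose s := Num.max ((a + b) / 2) (b - e / 2).
    have s1 : s < b by rewrite gt_max; apply/andP; split; lra.
    have s2 : a < s by rewrite lt_max; apply/orP; left; lra.
    have s3 : b - e / 2 <= s by rewrite le_max lexx orbT.
    have sab : a < s < b by rewrite s1 s2.
    exists s; first by have := constm s sab; tauto.
    by rewrite ltr0_norm ?subr_lt0//; lra.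
  pose s := Num.min ((a + b) / 2) (a + e / 2).
  have s1 : a < s by rewrite lt_min; apply/andP; split; lra.
  have s2 : s < b by rewrite gt_min; apply/orP; left; lra.
  have s3 : s <= a + e / 2 by rewrite ge_min lexx orbT.
  have sab : a < s < b by rewrite s1 s2.
  exists s; first by have := constm s sab; tauto.
  by rewrite gtr0_norm ?subr_gt0//; lra.
have -> : `]a, b[%classic `&` U = set0.
  apply/seteqP; split=> x //= [+ Ux]; rewrite in_itv /= => xab.
  by apply: nUm; have := constm x xab; tauto.
rewrite Rintegral_set0 /h; case: asboolP => Ub.
  have [e e0 He] := oU Ub; case: nUm.
  pose s := Num.max ((a + b) / 2) (b - e / 2).
  have s1 : s < b by rewrite gt_max; apply/andP; split; lra.
  have s2 : a < s by rewrite lt_max; apply/orP; left; lra.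
  have s3 : b - e / 2 <= s by rewrite le_max lexx orbT.
  have sab : a < s < b by rewrite s1 s2.
  have [H _] := constm s sab; apply: H.
  by apply: He; rewrite ltr0_norm ?subr_lt0//; lra.
case: asboolP => Ua; last by rewrite subrr.
have [e e0 He] := oU Ua; case: nUm.
pose s := Num.min ((a + b) / 2) (a + e / 2).
have s1 : a < s by rewrite lt_min; apply/andP; split; lra.
have s2 : s < b by rewrite gt_min; apply/orP; left; lra.
have s3 : s <= a + e / 2 by rewrite ge_min lexx orbT.
have sab : a < s < b by rewrite s1 s2.
have [H _] := constm s sab; apply: H.
by apply: He; rewrite gtr0_norm ?subr_gt0//; lra.
Qed.

Lemma integral_deriv_open_eq0 (K : R) : (forall x, U x -> `|x| <= K) ->
  (\int[leb]_s (((fun s => (p^`()).[s]) \_ U) s)%:E = 0)%E.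
Proof.
move=> HK; pose L := 1 + `|K|; have L0 : 0 < L by rewrite /L; have := normr_ge0 K; lra.
have UL x : U x -> - L < x < L.
  move=> /HK; rewrite ler_norml => /andP[h1 h2]; have := ler_norm K; rewrite /L => h3.
  by apply/andP; split; lra.
have iU : leb.-integrable U (EFin \o (fun s => (p^`()).[s])).
  apply: (@integrable_horner _ (- L) (L)) => // x /UL /andP[h1 h2].
  by rewrite /= in_itv /= !ltW.
have -> : (\int[leb]_s (((fun s => (p^`()).[s]) \_ U) s)%:E =
    \int[leb]_(s in U) ((p^`()).[s])%:E)%E.
  by rewrite [RHS]integral_mkcond; apply: eq_integral => x _; rewrite restrict_EFin.
rewrite -(fineK (integrable_fin_num mU iU)); congr EFin.
change (\int[leb]_(s in U) (p^`()).[s] = 0).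
have [->|p0] := eqVneq p 0.
  rewrite deriv0; under eq_Rintegral do rewrite horner0.
  by rewrite Rintegral_cst// mul0r.
have [rs Hrs] := poly_finite_roots p0.
have -> : U = `](- L), L[%classic `&` U.
  apply/seteqP; split=> x; last by case.
  by move=> Ux; split=> //; rewrite /= in_itv /= UL.
rewrite (@Rintegral_deriv_open rs).
- rewrite /h; case: asboolP => [/UL/andP[]|_]; first by rewrite ltxx.
  by case: asboolP => [/UL/andP[]|_]; rewrite ?ltxx// subrr.
- lra.
- by move=> x _; exact: Hrs.
Qed.

End OpenSet.

Section Green.
Variables (U : set (R * R)) (p : mpoly 2 R).
Hypotheses (U0 : U !=set0) (oU : open U) (bU : bounded_set U).
Hypothesis pU : forall x, ~ U x ->
  (forall e : R, 0 < e -> exists2 y, U y & `|y.1 - x.1| < e /\ `|y.2 - x.2| < e) ->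
  meval (coord2 x) p = 0.

(** Fubini: on each line of direction i the slice of [U] is open and the restriction of [p] vanishes
    at its boundary points, so that the inner integral is zero. *)
Lemma green_boundary0 i : pint (leb \x leb)%E U coord2 (mderiv i p) = 0.
Proof.
have dom := poly_domain2 U0 oU bU; have [mU _ _ _ _] := dom.
have [K HK] := bounded_pairP bU.
have intf := integrable_meval dom (mderiv i p).
rewrite /pint /Rintegral integral_mkcond.
set f := (X in (\int[_]_x X x)%E).
have fE z : f z = (((fun y => meval (coord2 y) (mderiv i p)) \_ U) z)%:E.
  by rewrite /f restrict_EFin.
have intf' : (leb \x leb)%E.-integrable setT f.
  exact: (iffLR (integrable_mkcond _ mU) intf).
have sec (c v : 'rV[R]_2) (V : set R) :
    (forall s, V s = U ((c + s *: v) 0 0, (c + s *: v) 0 1)) ->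
    (forall j, v 0 j = (j == i)%:R) ->
    (\int[leb]_s (((fun s => (line (mderiv i p) c v).[s]) \_ V) s)%:E = 0)%E.
  move=> VE vE; have -> : line (mderiv i p) c v = (line p c v)^`().
    rewrite deriv_line (bigD1 i) //= vE eqxx scale1r big1 ?addr0// => j /negPf ji.
    by rewrite vE ji scale0r.
  have vle j : `|v 0 j| <= 1 by rewrite vE; case: eqP => _; rewrite ?normr1 ?normr0.
  apply: (@integral_deriv_open_eq0 _ _ _ _ (K + `|c 0 i|)).
  - move=> s; rewrite VE => Us; have [e e0 He] := open_pairP oU Us.
    exists e => // s' s's; rewrite VE; apply: He; rewrite /= !mxE;
    rewrite opprD addrACA subrr add0r -mulrBl normrM;
    by apply: le_lt_trans s's; rewrite ler_piMr.
  - move=> s; rewrite VE => nUs Hs; rewrite horner_line.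
    rewrite -[RHS](@pU ((c + s *: v) 0 0, (c + s *: v) 0 1)) => //.
      by apply: meval_eq => j; rewrite /coord2; case: (ord2 j) => ->.
    move=> e e0; have [s' Vs' s's] := Hs e e0; rewrite VE in Vs'.
    exists ((c + s' *: v) 0 0, (c + s' *: v) 0 1) => //=.
    rewrite !mxE; split; rewrite opprD addrACA subrr add0r -mulrBl normrM;
    by apply: le_lt_trans s's; rewrite ler_piMr.
  - move=> s; rewrite VE => /HK[/= h1 h2].
    have -> : s = (c + s *: v) 0 i - c 0 i by rewrite !mxE vE eqxx mulr1 addrAC subrr add0r.
    apply: le_trans (ler_normB _ _) _; rewrite lerD2r.
    by case: (ord2 i) => ->.
case: (ord2 i) => i0.
  rewrite -integral21_prod_meas1// /fubini_G.
  rewrite (eq_integral (cst 0%E)) ?integral_cst ?mul0e// => y _.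
  rewrite -[RHS](sec (\row_j (if j == 0 then 0 else y)) (\row_j (j == 0)%:R) [set s | U (s, y)]).
  - apply: eq_integral => x _; apply: etrans (fE (x, y)) _; congr EFin.
    rewrite /patch; congr (if _ then _ else _).
    rewrite horner_line; apply: meval_eq => j; rewrite /coord2 !mxE.
    by case: (ord2 j) => -> /=; ring.
  - by move=> s /=; rewrite !mxE /= add0r mulr1 mulr0 addr0.
  - by move=> j; rewrite mxE i0.
rewrite -integral12_prod_meas1// /fubini_F.
rewrite (eq_integral (cst 0%E)) ?integral_cst ?mul0e// => x _.
rewrite -[RHS](sec (\row_j (if j == 0 then x else 0)) (\row_j (j == 1)%:R) [set s | U (x, s)]).
- apply: eq_integral => y _; apply: etrans (fE (x, y)) _; congr EFin.
  rewrite /patch; congr (if _ then _ else _).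
  rewrite horner_line; apply: meval_eq => j; rewrite /coord2 !mxE.
  by case: (ord2 j) => -> /=; ring.
- by move=> s /=; rewrite !mxE /= add0r mulr1 mulr0 addr0.
- by move=> j; rewrite mxE i0.
Qed.

End Green.
End PolyReal.

(** * Geometry of the mesh *)

Section VectorGeometry.
Context {R : realType}.
Implicit Types (u v w x y : 'rV[R]_3).

Lemma dot_ge0 n (u : 'rV[R]_n) : 0 <= dot u u.
Proof. by apply: sumr_ge0 => i _; rewrite -expr2 sqr_ge0. Qed.

Lemma dot_eq0 n (u : 'rV[R]_n) : dot u u = 0 -> u = 0.
Proof.
move=> /eqP; rewrite psumr_eq0 => [/allP H|i _]; last by rewrite -expr2 sqr_ge0.
apply/rowP => i; rewrite mxE; have := H i (mem_index_enum i).
by rewrite /= mulf_eq0 orbb => /eqP.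
Qed.

Lemma unit_coord n (u : 'rV[R]_n) i : dot u u = 1 -> `|u 0 i| <= 1.
Proof.
rewrite /dot (bigD1 i) //= => e; rewrite -(@ler_pXn2r _ 2) ?nnegrE// expr1n real_normK ?num_real//.
have : 0 <= \sum_(j | j != i) u 0 j * u 0 j.
  by apply: sumr_ge0 => j _; rewrite -expr2 sqr_ge0.
by rewrite expr2; lra.
Qed.

Lemma dot_small u w (e : R) : dot w w = 1 -> (forall i, `|u 0 i| < e) -> `|dot u w| < 3 * e.
Proof.
move=> w1 ue; have H i : `|u 0 i * w 0 i| < e.
  rewrite normrM; apply: le_lt_trans (ue i); rewrite ler_piMr//; exact: unit_coord.
rewrite dot3; have := H 0; have := H 1; have := H 2; rewrite !ltr_norml.
by move=> /andP[? ?] /andP[? ?] /andP[? ?]; apply/andP; split; lra.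
Qed.

Definition plane_pt (c e1 e2 : 'rV[R]_3) (a b : R) := c + a *: e1 + b *: e2.

Lemma plane_pt_near c e1 e2 a b (r : R) : dot e1 e1 = 1 -> dot e2 e2 = 1 ->
  `|a| < r -> `|b| < r -> forall i, `|plane_pt c e1 e2 a b 0 i - c 0 i| < 2 * r.
Proof.
move=> u1 u2 ar br i; rewrite !mxE.
have -> : c 0 i + a * e1 0 i + b * e2 0 i - c 0 i = a * e1 0 i + b * e2 0 i by ring.
apply: le_lt_trans (ler_normD _ _) _; rewrite !normrM.
have : `|a| * `|e1 0 i| <= `|a| by rewrite ler_piMr// unit_coord.
have : `|b| * `|e2 0 i| <= `|b| by rewrite ler_piMr// unit_coord.
lra.
Qed.

Lemma plane_ptB c e1 e2 a b a' b' : plane_pt c e1 e2 a b - plane_pt c e1 e2 a' b' =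
  (a - a') *: e1 + (b - b') *: e2.
Proof. by apply/rowP => i; rewrite !mxE; ring. Qed.

(** The remainder [z] is orthogonal to e1, e2 and n. Then cross z n = 0 by the triple product
    formula, and Lagrange's identity gives z = 0. *)
Lemma frame_decomp e1 e2 w : dot e1 e1 = 1 -> dot e2 e2 = 1 -> dot e1 e2 = 0 ->
  w = dot w e1 *: e1 + dot w e2 *: e2 + dot w (cross e1 e2) *: cross e1 e2.
Proof.
move=> u1 u2 u12; set n := cross e1 e2.
have n1 : dot n n = 1 by rewrite /n dot_cross_cross u1 u2 u12 (dotC e2) u12; ring.
have ne1 : dot n e1 = 0 by rewrite dotC dot_cross_self.
have ne2 : dot n e2 = 0 by rewrite dotC dot_cross_selfr.
set z := w - (dot w e1 *: e1 + dot w e2 *: e2 + dot w n *: n).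
suff : z = 0 by move/eqP; rewrite subr_eq0 => /eqP.
have z1 : dot z e1 = 0.
  by rewrite /z dotBl !dotDl !dotZl u1 ne1 (dotC e2) u12; ring.
have z2 : dot z e2 = 0 by rewrite /z dotBl !dotDl !dotZl u2 ne2 u12; ring.
have z3 : dot z n = 0.
  by rewrite /z dotBl !dotDl !dotZl n1 (dotC e1) (dotC e2) ne1 ne2; ring.
have zn : cross z n = 0 by rewrite /n cross_cross z1 z2 !scale0r subrr.
apply: dot_eq0; have := dot_cross_cross z n z n.
by rewrite zn dot0l z3 n1 mulr1 mul0r subr0.
Qed.

Lemma closure_dot_le (A : set 'rV[R]_3) x w (c : R) : closure A x ->
  (forall y, A y -> dot y w <= c) -> dot x w <= c.
Proof.
move=> /closure_rowP Ax H; rewrite leNgt; apply/negP => xc.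
pose k := 1 + dot w w; have k0 : 0 < k by have := dot_ge0 w; rewrite /k; lra.
have wk i : `|w 0 i| <= k.
  have : w 0 i ^+ 2 <= dot w w.
    rewrite /dot (bigD1 i) //= -expr2 lerDl; apply: sumr_ge0 => j _.
    by rewrite -expr2 sqr_ge0.
  have : 0 <= (`|w 0 i| - 1) ^+ 2 by exact: sqr_ge0.
  have := dot_ge0 w.
  by rewrite /k sqrrB real_normK ?num_real// expr1n mulr1; lra.
have [|y Ay yx] := Ax ((dot x w - c) / (3 * k)).
  by rewrite divr_gt0 ?subr_gt0// mulr_gt0.
have := H y Ay; have -> : dot y w = dot x w + dot (y - x) w by rewrite dotBl; ring.
have Hi i : `|(y - x) 0 i * w 0 i| < (dot x w - c) / 3.
  rewrite normrM; apply: (@le_lt_trans _ _ (`|(y - x) 0 i| * k)); first exact: ler_wpM2l.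
  have := yx i; rewrite !mxE ltr_pdivlMr ?mulr_gt0// => ?; lra.
rewrite (dot3 (y - x)); have := Hi 0; have := Hi 1; have := Hi 2; rewrite !ltr_norml.
move=> /andP[? ?] /andP[? ?] /andP[? ?]; lra.
Qed.

Lemma closure_dot_eq (A : set 'rV[R]_3) x w (c : R) : closure A x ->
  (forall y, A y -> dot y w = c) -> dot x w = c.
Proof.
move=> Ax H; apply/eqP; rewrite eq_le (closure_dot_le Ax) => [/=|y /H -> //].
rewrite -lerN2 -dotNr; apply: (closure_dot_le Ax) => y /H <-.
by rewrite dotNr.
Qed.

Lemma not_closure_near n (A : set 'rV[R]_n) (x : 'rV[R]_n) : ~ closure A x ->
  exists2 e : R, 0 < e & forall y : 'rV[R]_n, (forall i, `|y 0 i - x 0 i| < e) -> ~ closure A y.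
Proof.
move=> nAx; have oA : open (~` closure A) by rewrite openC; exact: closed_closure.
exact: (open_rowP oA).
Qed.

End VectorGeometry.

(** * Edges, faces and elements near a point *)

Section MeshGeometry.
Context {R : realType} (M : mesh R).
Implicit Types (T : elt M) (F : face M) (E : edge M) (V : vert M) (x y : 'rV[R]_3).

Lemma tau_unit F i : dot (tau F i) (tau F i) = 1.
Proof. by rewrite tau_orthonormal eqxx. Qed.

Lemma tau_ortho F : dot (tau F 0) (tau F 1) = 0.
Proof. by rewrite tau_orthonormal. Qed.

Lemma nF_unit F : dot (nF F) (nF F) = 1.
Proof. by rewrite dot_cross_cross !tau_unit tau_ortho mul0r mulr1 subr0. Qed.

Lemma tau_nF F i : dot (tau F i) (nF F) = 0.
Proof. by case: (ord2 i) => ->; rewrite ?dot_cross_self ?dot_cross_selfr. Qed.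

Lemma chart_plane F x : dot (x - xF F) (nF F) = 0 ->
  chart F (dot (x - xF F) (tau F 0), dot (x - xF F) (tau F 1)) = x.
Proof.
move=> H; rewrite /chart /= -addrA.
have := frame_decomp (x - xF F) (tau_unit F 0) (tau_unit F 1) (tau_ortho F).
by rewrite -/(nF F) H scale0r addr0 => <-; rewrite addrC subrK.
Qed.

Lemma planeE F x : range (chart F) x <-> dot (x - xF F) (nF F) = 0.
Proof.
split=> [[y _ <-]|/chart_plane <-]; last by eexists.
rewrite /chart; have -> : xF F + y.1 *: tau F 0 + y.2 *: tau F 1 - xF F =
  y.1 *: tau F 0 + y.2 *: tau F 1 by apply/rowP => i; rewrite !mxE; ring.
by rewrite dotDl !dotZl !tau_nF !mulr0 addr0.
Qed.

Lemma hE_gt0 E : 0 < hE E.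
Proof.
rewrite /hE /enorm sqrtr_gt0 lt_neqAle dot_ge0 andbT eq_sym; apply/eqP => /dot_eq0.
by move=> /eqP; rewrite subr_eq0 => /eqP /vpos_inj /eqP; rewrite eq_sym (negPf (src_neq_tgt E)).
Qed.

Lemma tE_unit E : dot (tE E) (tE E) = 1.
Proof.
rewrite /tE dotZl dotZr mulrA -invfM -expr2 /hE /enorm sqr_sqrtr ?dot_ge0// mulVf//.
apply/eqP => /dot_eq0 /eqP; rewrite subr_eq0 => /eqP /vpos_inj /eqP.
by rewrite eq_sym (negPf (src_neq_tgt E)).
Qed.

Lemma param_src E : param E 0 = vpos (src E).
Proof. by rewrite /param scale0r addr0. Qed.

Lemma param_tgt E : param E (hE E) = vpos (tgt E).
Proof. by rewrite /param /tE scalerA mulfV ?gt_eqF ?hE_gt0// scale1r addrC subrK. Qed.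

Lemma paramD E (s s' : R) : param E (s + s') = param E s + s' *: tE E.
Proof. by rewrite /param scalerDl addrA. Qed.

Lemma edgeSP E x : edgeS E x <-> exists2 s, 0 < s < hE E & x = param E s.
Proof.
split=> [[s /=]|[s sE ->]]; first by rewrite in_itv /= => sE <-; exists s.
by exists s => //=; rewrite in_itv.
Qed.

(** The closure stays in the line and in the two half-spaces that contain the open segment, as these
    are closed; conversely the ends are approached from inside. *)
Lemma closure_edgeP E x : closure (edgeS E) x <-> exists2 s, 0 <= s <= hE E & x = param E s.
Proof.
have h0 := hE_gt0 E; have t1 := tE_unit E; split=> [Ex|[s /andP[s0 sh] ->]].
  pose s := dot (x - vpos (src E)) (tE E); pose z := (x - vpos (src E)) - s *: tE E.
  have zt : dot z (tE E) = 0 by rewrite /z dotBl dotZl t1 mulr1 subrr.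
  have par (s' : R) w : dot (param E s') w = dot (vpos (src E)) w + s' * dot (tE E) w.
    by rewrite /param dotDl dotZl.
  have e : dot x z = dot (vpos (src E)) z.
    apply: (closure_dot_eq Ex) => y /edgeSP[s' _ ->].
    by rewrite par (dotC (tE E)) zt mulr0 addr0.
  have z0 : z = 0.
    apply: dot_eq0; have -> : dot z z = dot x z - dot (vpos (src E)) z - s * dot (tE E) z.
      by rewrite {1}/z !dotBl dotZl.
    by rewrite e subrr (dotC (tE E)) zt mulr0 subrr.
  exists s; last by apply/eqP; rewrite -subr_eq0 /param opprD addrA; apply/eqP.
  have sx : s = dot x (tE E) - dot (vpos (src E)) (tE E) by rewrite /s dotBl.
  rewrite sx subr_ge0 lerBlDr; apply/andP; split.
    rewrite -lerN2 -!dotNr; apply: (closure_dot_le Ex) => y /edgeSP[s' /andP[s'0 _] ->].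
    by rewrite par !dotNr t1; lra.
  apply: (closure_dot_le Ex) => y /edgeSP[s' /andP[_ s'1] ->].
  by rewrite par t1; lra.
apply/closure_rowP => e e0.
(* [s] is clamped to [m, hE - m], with m the minimum of e / 2 and hE / 2. *)
pose s' := Num.max (Num.min s (hE E - Num.min (e / 2) (hE E / 2))) (Num.min (e / 2) (hE E / 2)).
have [m0 me mh] : [/\ 0 < Num.min (e / 2) (hE E / 2), Num.min (e / 2) (hE E / 2) <= e / 2
    & Num.min (e / 2) (hE E / 2) <= hE E / 2].
  by rewrite lt_min !ge_min !lexx !orbT; split=> //; apply/andP; split; lra.
have [s'0 s'h ss'] : [/\ 0 < s', s' < hE E & `|s' - s| < e].
  rewrite /s'; move: (Num.min (e / 2) (hE E / 2)) m0 me mh => m m0 me mh.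
  case: (lerP s (hE E - m)) => h1.
    case: (lerP m s) => h2; split=> //; rewrite ?subrr ?normr0; try lra.
    by rewrite gtr0_norm; lra.
  case: (lerP m (hE E - m)) => h2; split; try lra.
  by rewrite ltr_norml; apply/andP; split; lra.
exists (param E s'); first by apply/edgeSP; exists s' => //; rewrite s'0 s'h.
move=> i; have := unit_coord i t1; rewrite /param; move: (tE E) => t ti.
rewrite !mxE opprD addrACA subrr add0r -mulrBl normrM.
by apply: le_lt_trans ss'; rewrite ler_piMr.
Qed.

Lemma vert_at_end E V : closure (edgeS E) (vpos V) -> V = src E \/ V = tgt E.
Proof.
move=> /closure_edgeP[s /andP[]]; rewrite le_eqVlt => /predU1P[<-|s0].
  by rewrite param_src => _ /vpos_inj; left.
rewrite le_eqVlt => /predU1P[->|sh]; first by rewrite param_tgt => /vpos_inj; right.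
by move=> e; exfalso; apply: (@edge_vert_disjoint _ M E V); apply/edgeSP; exists s; rewrite ?s0.
Qed.

Lemma bdry_faceP F x : bdry (faceS F) x <-> exists2 E, E \in edgesF F & closure (edgeS E) x.
Proof. by rewrite face_boundary; split=> [[E /= H1 H2]|[E H1 H2]]; exists E. Qed.

Lemma closure_face_plane F x : closure (faceS F) x -> dot (x - xF F) (nF F) = 0.
Proof.
move=> Fx; rewrite dotBl; apply/eqP; rewrite subr_eq0; apply/eqP.
apply: (closure_dot_eq Fx) => y Fy; have /planeE := face_planar Fy.
by rewrite dotBl => /subr0_eq.
Qed.

Let closed_edge_in_plane F E s : E \in edgesF F -> 0 <= s <= hE E ->
  dot (param E s - xF F) (nF F) = 0.
Proof.
move=> EF sh; apply: closure_face_plane.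
have /bdry_faceP[//] : exists2 E', E' \in edgesF F & closure (edgeS E') (param E s).
  by exists E => //; apply/closure_edgeP; exists s.
Qed.

Lemma tE_nF F E : E \in edgesF F -> dot (tE E) (nF F) = 0.
Proof.
move=> EF; have h0 := hE_gt0 E.
have e1 := @closed_edge_in_plane F E 0 EF (ltac:(by rewrite lexx ltW)).
have e2 := @closed_edge_in_plane F E (hE E) EF (ltac:(by rewrite lexx ltW)).
have : dot (param E (hE E) - param E 0) (nF F) = 0.
  have -> : param E (hE E) - param E 0 = (param E (hE E) - xF F) - (param E 0 - xF F).
    by rewrite opprB addrA subrK.
  by rewrite dotBl e1 e2 subrr.
have -> : param E (hE E) - param E 0 = hE E *: tE E.
  by rewrite /param scale0r addr0 addrC addKr.
by rewrite dotZl => /eqP; rewrite mulf_eq0 (gt_eqF h0) => /eqP.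
Qed.

Lemma edge_in_plane F E s : E \in edgesF F -> dot (param E s - xF F) (nF F) = 0.
Proof.
move=> EF; have e0 := @closed_edge_in_plane F E 0 EF (ltac:(by rewrite lexx ltW ?hE_gt0)).
have -> : param E s - xF F = (param E 0 - xF F) + s *: tE E.
  by rewrite param_src /param addrAC.
by rewrite dotDl e0 (dotZl s) tE_nF// mulr0 addr0.
Qed.

Lemma nFE_unit F E : E \in edgesF F -> dot (nFE F E) (nFE F E) = 1.
Proof.
by move=> EF; rewrite dot_cross_cross nF_unit tE_unit dotC tE_nF// mulr0 mulr1 subr0.
Qed.

Lemma tE_nFE F E : dot (tE E) (nFE F E) = 0.
Proof. exact: dot_cross_selfr. Qed.

Lemma nFE_nF F E : dot (nFE F E) (nF F) = 0.
Proof. by rewrite dotC dot_cross_self. Qed.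

Lemma cross_tE_nFE F E : E \in edgesF F -> cross (tE E) (nFE F E) = nF F.
Proof.
by move=> EF; rewrite /nFE cross_cross tE_unit tE_nF// scale0r subr0 scale1r.
Qed.

Lemma omegaFE_sq F E : E \in edgesF F -> omegaFE F E * omegaFE F E = 1.
Proof. by move=> /omegaFE_sign[] ->; rewrite ?mulrNN mulr1. Qed.

Lemma omegaTF_sq T F : F \in facesT T -> omegaTF T F * omegaTF T F = 1.
Proof. by move=> /omegaTF_sign[] ->; rewrite ?mulrNN mulr1. Qed.

Lemma elt_locally_constant T x : ~ bdry (eltS T) x ->
  exists2 e : R, 0 < e & forall y, (forall i, `|y 0 i - x 0 i| < e) -> (eltS T y <-> eltS T x).
Proof.
move=> nb; have [Tx|nTx] := pselect (eltS T x).
  have [_ oT _ _ _] := elt_region T; have [e e0 He] := open_rowP oT Tx.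
  by exists e => // y /He.
have [e e0 He] := @not_closure_near _ _ (eltS T) x (fun H => nb (conj H nTx)).
by exists e => // y /He nTy; split=> // /subset_closure.
Qed.

Lemma face_locally_constant F x : dot (x - xF F) (nF F) = 0 -> ~ bdry (faceS F) x ->
  exists2 e : R, 0 < e & forall y, dot (y - xF F) (nF F) = 0 ->
    (forall i, `|y 0 i - x 0 i| < e) -> (faceS F y <-> faceS F x).
Proof.
move=> px nb; have [Fx|nFx] := pselect (faceS F x).
  have [_ oF _ _ _] := face_region F.
  have cx := chart_plane px.
  have [|e e0 He] := @open_pairP _ _ (dot (x - xF F) (tau F 0), dot (x - xF F) (tau F 1)) oF.
    by rewrite /preimage /= cx.
  exists (e / 3) => [|y py yx]; first by rewrite divr_gt0.
  split=> // _; have <- := chart_plane py.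
  have yx' i : `|(y - x) 0 i| < e / 3 by have := yx i; rewrite !mxE.
  have three : 3 * (e / 3) = e by field.
  apply: He => /=; rewrite -dotBl opprB addrA subrK -three; apply: dot_small => //;
  exact: tau_unit.
have [e e0 He] := @not_closure_near _ _ (faceS F) x (fun H => nb (conj H nFx)).
by exists e => // y _ /He nFy; split=> // /subset_closure.
Qed.

Lemma near0P (P : R -> Prop) : (\forall e \near (0 : R)^'+, P e) ->
  exists2 d : R, 0 < d & forall e, 0 < e < d -> P e.
Proof.
move=> /nbhs_ballP[d /= d0 H]; exists d => // e /andP[e0 ed].
by apply: H => //; rewrite /ball /= sub0r normrN gtr0_norm.
Qed.

End MeshGeometry.

(** * Edges of a face around a vertex *)

Section BoundaryOfBoundary.
Context {R : realType} (M : mesh R).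
Implicit Types (T : elt M) (F : face M) (E : edge M) (V : vert M) (x y : 'rV[R]_3).

Lemma plane_pt_in F c a b (e1 e2 : 'rV[R]_3) : dot (c - xF F) (nF F) = 0 ->
  dot e1 (nF F) = 0 -> dot e2 (nF F) = 0 ->
  dot (plane_pt c e1 e2 a b - xF F) (nF F) = 0.
Proof.
move=> c0 h1 h2; have -> : plane_pt c e1 e2 a b - xF F = (c - xF F) + a *: e1 + b *: e2.
  by rewrite /plane_pt; apply/rowP => i; rewrite !mxE; ring.
by rewrite dotDl (dotDl (c - _)) !dotZl c0 h1 h2 !mulr0 !addr0.
Qed.

Lemma tE_frame F E : E \in edgesF F ->
  dot (tE E) (tau F 0) *: tau F 0 + dot (tE E) (tau F 1) *: tau F 1 = tE E.
Proof.
move=> EF; have := frame_decomp (tE E) (tau_unit F 0) (tau_unit F 1) (tau_ortho F).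
by rewrite -/(nF F) tE_nF// scale0r addr0 => <-.
Qed.

Lemma nFE_frame F E :
  dot (nFE F E) (tau F 0) *: tau F 0 + dot (nFE F E) (tau F 1) *: tau F 1 = nFE F E.
Proof.
have := frame_decomp (nFE F E) (tau_unit F 0) (tau_unit F 1) (tau_ortho F).
by rewrite -/(nF F) nFE_nF scale0r addr0 => <-.
Qed.

Lemma dot_frame2 (e1 e2 u v : 'rV[R]_3) :
  dot u e1 * dot v e2 - dot u e2 * dot v e1 = dot (cross u v) (cross e1 e2).
Proof. by rewrite dot_cross_cross. Qed.

(* [end_sign E V *: tE E] points from the end [V] of [E] into [E]. *)
Definition end_sign E V : R := if src E == V then 1 else -1.

Lemma end_sign_cases E V : end_sign E V = 1 \/ end_sign E V = -1.
Proof. by rewrite /end_sign; case: ifP => _; [left|right]. Qed.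

Lemma param_end E V (s : R) : (src E == V) || (tgt E == V) ->
  vpos V + (s * end_sign E V) *: tE E = param E (if src E == V then s else hE E - s).
Proof.
rewrite /end_sign; have [<- _|_ /= /eqP <-] := eqVneq (src E) V.
  by rewrite mulr1 -param_src -paramD add0r.
by rewrite mulrN1 -param_tgt -paramD.
Qed.

(** This is [rays_sum] in the plane of [F] around [V]. The rays are the edges ending at [V],
    [end_sign] directs them away from [V], and t_E x n_FE = n_F turns the determinant into a product
    of signs. *)
Lemma vertex_sum F V :
  \sum_(E in edgesF F) omegaFE F E * ((tgt E == V)%:R - (src E == V)%:R) = 0.
Proof.
pose J := [pred E | (E \in edgesF F) && ((src E == V) || (tgt E == V))].
pose sg E := end_sign E V * omegaFE F E.
suff S0 : \sum_(E | J E) sg E = 0.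
  rewrite (bigID (fun E => (src E == V) || (tgt E == V))) /= [X in _ + X]big1 ?addr0.
    rewrite -[RHS]oppr0 -[in RHS]S0 -sumrN; apply: eq_bigr => E /andP[_ EV].
    rewrite /sg /end_sign mulrC; have [e|ne] := eqVneq (src E) V.
      have /negPf -> : tgt E != V by rewrite -e eq_sym src_neq_tgt.
      by rewrite sub0r mulN1r mul1r.
    by move: EV; rewrite (negPf ne) /= => ->; rewrite subr0 mul1r mulN1r opprK.
  by move=> E /andP[_]; rewrite negb_or => /andP[/negPf -> /negPf ->]; rewrite subrr mulr0.
have [[E0 JE0]|none] := pselect (exists E, J E); last first.
  by apply: big1 => E JE; case: none; exists E.
have pV : dot (vpos V - xF F) (nF F) = 0.
  by case/andP: JE0 => EF /orP[] /eqP <-; rewrite -?param_src -?param_tgt edge_in_plane.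
(* The ball meets no closed edge of [F] that does not end at [V], and contains no other end of an
   edge. The factor 2 comes from the passage from two coordinates in the plane to those of space, as
   in [plane_pt_near]. *)
have [r [r0 rE rh]] : exists r : R, [/\ 0 < r,
    forall E, E \in edgesF F -> ~~ J E -> forall y,
      (forall i, `|y 0 i - vpos V 0 i| < 2 * r) -> ~ closure (edgeS E) y
    & forall E, 2 * r <= hE E].
  have H E : exists e : R, 0 < e /\ (E \in edgesF F -> ~~ J E -> forall y,
      (forall i, `|y 0 i - vpos V 0 i| < e) -> ~ closure (edgeS E) y).
    have [[EF nJ]|nE] := pselect (E \in edgesF F /\ ~~ J E); last first.
      by exists 1; split=> // EF nJ; case: nE.
    have nV : ~ closure (edgeS E) (vpos V).
      move=> /vert_at_end VE; move: nJ; rewrite /J /= EF /=.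
      by case: VE => ->; rewrite eqxx ?orbT.
    by have [e e0 He] := not_closure_near nV; exists e.
  have [f fP] := choice H.
  have [d d0 Hd] := fin_min (fun E => (fP E).1).
  have [d' d'0 Hd'] := fin_min (@hE_gt0 _ M).
  exists (Num.min d d' / 2); have e2 : 2 * (Num.min d d' / 2) = Num.min d d' by field.
  split; first by rewrite divr_gt0// lt_min d0.
    move=> E EF nJ y yV; apply: (fP E).2 => // i; apply: lt_le_trans (yV i) _.
    by rewrite e2; apply: le_trans (Hd E); rewrite ge_min lexx.
  by move=> E; rewrite e2; apply: le_trans (Hd' E); rewrite ge_min lexx orbT.
pose d1 E := end_sign E V * dot (tE E) (tau F 0).
pose d2 E := end_sign E V * dot (tE E) (tau F 1).
pose n1 E := omegaFE F E * dot (nFE F E) (tau F 0).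
pose n2 E := omegaFE F E * dot (nFE F E) (tau F 1).
pose P := plane_pt (vpos V) (tau F 0) (tau F 1).
have Pray E s : J E -> P (s * d1 E) (s * d2 E) = param E (if src E == V then s else hE E - s).
  move=> /andP[EF EV]; rewrite -param_end// /P /plane_pt -addrA; congr (_ + _).
  by rewrite -[in RHS](tE_frame EF) scalerDr !scalerA /d1 /d2 !mulrA.
have es2 E : end_sign E V * end_sign E V = 1.
  by case: (end_sign_cases E V) => ->; rewrite ?mulrNN mulr1.
have d12 E : J E -> d1 E * d1 E + d2 E * d2 E = 1.
  have key (t : 'rV[R]_3) : dot t (tau F 0) *: tau F 0 + dot t (tau F 1) *: tau F 1 = t ->
      dot t t = dot t (tau F 0) * dot t (tau F 0) + dot t (tau F 1) * dot t (tau F 1).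
    by move=> e; rewrite -{1}e dotDl !dotZl !(dotC (tau F _)).
  move=> /andP[EF EV]; have e := key _ (tE_frame EF); rewrite tE_unit in e; rewrite /d1 /d2.
  transitivity ((end_sign E V * end_sign E V) * (dot (tE E) (tau F 0) * dot (tE E) (tau F 0)
    + dot (tE E) (tau F 1) * dot (tE E) (tau F 1))); first by ring.
  by rewrite -e es2 mulr1.
have small E s : J E -> 0 < s -> inball r (s * d1 E) (s * d2 E) -> s < hE E.
  move=> JE s0 [b1 b2]; apply: lt_le_trans (rh E).
  rewrite -(@ltr_pXn2r _ 2) ?nnegrE ?ltW ?mulr_gt0//.
  have -> : s ^+ 2 = (s * d1 E) ^+ 2 + (s * d2 E) ^+ 2.
    by rewrite -[LHS]mulr1 -(d12 _ JE); ring.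
  have h1 : (s * d1 E) ^+ 2 < r ^+ 2 by rewrite -real_normK ?num_real// ltr_pXn2r ?nnegrE// ltW.
  have h2 : (s * d2 E) ^+ 2 < r ^+ 2 by rewrite -real_normK ?num_real// ltr_pXn2r ?nnegrE// ltW.
  have r2 : 0 <= r ^+ 2 by exact: sqr_ge0.
  have -> : (2 * r) ^+ 2 = 4 * r ^+ 2 by ring.
  lra.
have inE E s : J E -> 0 < s < hE E -> edgeS E (P (s * d1 E) (s * d2 E)).
  move=> JE /andP[s0 sh]; rewrite Pray//; apply/edgeSP.
  by case: ifP => _; eexists; try reflexivity; apply/andP; split; lra.
have rays E E' s s' : J E -> J E' -> 0 < s -> 0 < s' ->
    s * d1 E = s' * d1 E' -> s * d2 E = s' * d2 E' -> E = E'.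
  move=> JE JE' s0 s'0 e1 e2; apply/eqP/negPn/negP => EE'.
  have ss : s = s'.
    have : s ^+ 2 = s' ^+ 2.
      rewrite -[LHS]mulr1 -(d12 _ JE) -[RHS]mulr1 -(d12 _ JE').
      transitivity ((s * d1 E) ^+ 2 + (s * d2 E) ^+ 2); first by ring.
      by rewrite e1 e2; ring.
    by move/eqP; rewrite eqrXn2 ?ltW// => /eqP.
  rewrite -ss in e1 e2; have s_neq0 : s != 0 by rewrite gt_eqF.
  move/(mulfI s_neq0): e1 => e1; move/(mulfI s_neq0): e2 => e2.
  have Es : edgeS E (P (r * d1 E) (r * d2 E)).
    by apply: inE => //; have := rh E => ?; apply/andP; split; lra.
  have E's : edgeS E' (P (r * d1 E) (r * d2 E)).
    by rewrite e1 e2; apply: inE => //; have := rh E' => ?; apply/andP; split; lra.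
  have /seteqP[H _] := edge_disjoint EE'; exact: (H _ (conj Es E's)).
apply: (@rays_sum R _ J d1 d2 n1 n2 sg (fun a b => faceS F (P a b)) r) => //.
- move=> a b ab0 [ar br] off.
  have near i : `|P a b 0 i - vpos V 0 i| < 2 * r.
    by apply: plane_pt_near => //; exact: tau_unit.
  have nb : ~ bdry (faceS F) (P a b).
    move=> /bdry_faceP[E EF Eab]; have [JE|nJE] := boolP (J E); last first.
      exact: (rE E EF nJE _ near).
    have /andP[_ EV] := JE; have /closure_edgeP[s /andP[s0 sh] e] := Eab.
    pose s1 := if src E == V then s else hE E - s.
    have s10 : 0 <= s1 by rewrite /s1; case: ifP => _; rewrite ?subr_ge0.
    have e1 : P a b = P (s1 * d1 E) (s1 * d2 E).
      by rewrite Pray// e /s1; case: (src E == V) => //; rewrite opprB addrC subrK.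
    have [ea eb] : a = s1 * d1 E /\ b = s1 * d2 E.
      have := plane_ptB (vpos V) (tau F 0) (tau F 1) a b (s1 * d1 E) (s1 * d2 E).
      rewrite -/P e1 subrr => z; split.
        have := congr1 (fun u => dot u (tau F 0)) z.
        rewrite /= dot0l dotDl !dotZl tau_unit (dotC (tau F 1)) tau_ortho; lra.
      have := congr1 (fun u => dot u (tau F 1)) z.
      rewrite /= dot0l dotDl !dotZl tau_unit tau_ortho; lra.
    move: s10; rewrite le_eqVlt => /predU1P[z|s1p].
      by apply: ab0; rewrite ea eb -z !mul0r.
    exact: (off E JE s1 s1p).
  have pP a' b' : dot (P a' b' - xF F) (nF F) = 0.
    by apply: plane_pt_in => //; exact: tau_nF.
  have [e e0 He] := face_locally_constant (pP a b) nb.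
  exists (e / 2) => [|a' b' a'a b'b]; first by rewrite divr_gt0.
  apply: He => // i.
  have -> : P a' b' 0 i - P a b 0 i =
      plane_pt 0 (tau F 0) (tau F 1) (a' - a) (b' - b) 0 i - (0 : 'rV[R]_3) 0 i.
    by rewrite /P /plane_pt !mxE; ring.
  have <- : 2 * (e / 2) = e by field.
  by apply: plane_pt_near => //; exact: tau_unit.
- move=> E s JE s0 bs; have sh := small E s JE s0 bs.
  have /andP[EF _] := JE.
  have Es : edgeS E (P (s * d1 E) (s * d2 E)) by apply: inE; rewrite ?s0.
  have [d d0 Hd] := near0P (omegaFE_out EF Es).
  exists d => // e /Hd [h1 h2].
  have Pn c : P (s * d1 E + c * n1 E) (s * d2 E + c * n2 E) =
     P (s * d1 E) (s * d2 E) + c *: (omegaFE F E *: nFE F E).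
    rewrite -[in RHS](nFE_frame F E) /P /plane_pt; apply/rowP => i; rewrite !mxE /n1 /n2; ring.
  have -> : s * d1 E - e * n1 E = s * d1 E + (- e) * n1 E by ring.
  have -> : s * d2 E - e * n2 E = s * d2 E + (- e) * n2 E by ring.
  rewrite !Pn scaleNr; split=> // h3; apply: h2; exact: subset_closure.
- move=> E /andP[EF _]; rewrite /sg.
  by case: (end_sign_cases E V) => ->; case: (omegaFE_sign EF) => ->; rewrite ?mulrNN ?mulr1 ?mul1r; auto.
- move=> E /andP[EF _].
  have -> : d1 E * n2 E - d2 E * n1 E = sg E * (dot (tE E) (tau F 0) * dot (nFE F E) (tau F 1)
     - dot (tE E) (tau F 1) * dot (nFE F E) (tau F 0)).
    by rewrite /d1 /d2 /n1 /n2 /sg; ring.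
  rewrite dot_frame2 cross_tE_nFE// -/(nF F) nF_unit mulr1 /sg.
  have -> : end_sign E V * omegaFE F E * (end_sign E V * omegaFE F E) =
    (end_sign E V * end_sign E V) * (omegaFE F E * omegaFE F E) by ring.
  by rewrite es2 omegaFE_sq// mulr1.
Qed.

End BoundaryOfBoundary.

(** * Faces of an element around an edge *)

Section EdgeSum.
Context {R : realType} (M : mesh R).
Implicit Types (T : elt M) (F : face M) (E : edge M) (V : vert M) (x y : 'rV[R]_3).

Lemma edge_disjoint_closure E E' s : E != E' -> 0 < s < hE E -> ~ closure (edgeS E') (param E s).
Proof.
move=> EE' sE /closure_edgeP[s' /andP[]].
have Es : edgeS E (param E s) by apply/edgeSP; exists s.
rewrite le_eqVlt => /predU1P[<-|s'0].
  by rewrite param_src => _ e; apply: (@edge_vert_disjoint _ M E (src E')); rewrite -e.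
rewrite le_eqVlt => /predU1P[->|s'h].
  by rewrite param_tgt => e; apply: (@edge_vert_disjoint _ M E (tgt E')); rewrite -e.
move=> e; have /seteqP[H _] := edge_disjoint EE'; apply: (H (param E s)); split=> //.
by rewrite e; apply/edgeSP; exists s'; rewrite ?s'0.
Qed.

Lemma edge_disjoint_closure_face E F s : E \notin edgesF F -> 0 < s < hE E ->
  ~ closure (faceS F) (param E s).
Proof.
move=> EF sE cF; have Es : edgeS E (param E s) by apply/edgeSP; exists s.
have [Fx|nFx] := pselect (faceS F (param E s)).
  by have /seteqP[H _] := face_edge_disjoint F E; exact: (H _ (conj Fx Es)).
have /bdry_faceP[E' E'F] : bdry (faceS F) (param E s) by split.
apply: edge_disjoint_closure => //; by apply: contraNneq EF => ->.
Qed.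

Lemma rowB_scale n (z v : 'rV[R]_n) (a b : R) i :
  (z + a *: v) 0 i - (z + b *: v) 0 i = (a - b) * v 0 i.
Proof. by rewrite !mxE opprD addrACA subrr add0r -mulrBl. Qed.

Lemma plane_pt_sub (z e1 e2 : 'rV[R]_3) (a b a' b' : R) i :
  plane_pt z e1 e2 a' b' 0 i - plane_pt z e1 e2 a b 0 i =
  plane_pt 0 e1 e2 (a' - a) (b' - b) 0 i - (0 : 'rV[R]_3) 0 i.
Proof. by rewrite /plane_pt !mxE; ring. Qed.

Definition inward F E : 'rV[R]_3 := - omegaFE F E *: nFE F E.

Lemma inward_unit F E : E \in edgesF F -> dot (inward F E) (inward F E) = 1.
Proof.
by move=> EF; rewrite /inward dotZl dotZr nFE_unit// mulr1 mulrNN omegaFE_sq.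
Qed.

(** On the normal to [E] in the plane of [F], the boundary of [F] is met only at the edge itself, so
    membership is constant on each side; [omegaFE_out] decides both sides close to the edge. *)
Lemma face_near_edge F E s0 (r : R) : E \in edgesF F -> 0 < s0 < hE E ->
  (forall E' y, E' != E -> (forall i, `|y 0 i - param E s0 0 i| < r) -> ~ closure (edgeS E') y) ->
  forall s, s != 0 -> `|s| < r ->
  ~ bdry (faceS F) (param E s0 + s *: inward F E) /\
  (faceS F (param E s0 + s *: inward F E) <-> 0 < s).
Proof.
move=> EF s0E rE; set x0 := param E s0; set d := inward F E.
have d1 : dot d d = 1 by exact: inward_unit.
have dt : dot d (tE E) = 0 by rewrite /d /inward dotZl dotC tE_nFE mulr0.
have dn : dot d (nF F) = 0 by rewrite /d /inward dotZl nFE_nF mulr0.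
have x0F : dot (x0 - xF F) (nF F) = 0.
  exact: edge_in_plane.
have pl s : dot (x0 + s *: d - xF F) (nF F) = 0.
  have -> : x0 + s *: d - xF F = (x0 - xF F) + s *: d by rewrite addrAC.
  by rewrite dotDl (dotZl s) x0F dn mulr0 addr0.
have near s s' i : `|(x0 + s *: d) 0 i - (x0 + s' *: d) 0 i| <= `|s - s'|.
  by rewrite rowB_scale normrM ler_piMr// unit_coord.
have near0 s i : `|(x0 + s *: d) 0 i - x0 0 i| <= `|s|.
  by have := near s 0 i; rewrite scale0r addr0 subr0.
have nb s : s != 0 -> `|s| < r -> ~ bdry (faceS F) (x0 + s *: d).
  move=> sn0 sr /bdry_faceP[E' E'F cE']; have [EE'|EE'] := eqVneq E' E.
    move: cE'; rewrite EE' => /closure_edgeP[s' _ e].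
    have : s *: d = (s' - s0) *: tE E.
      have -> : s *: d = param E s' - x0 by rewrite -e addrAC subrr add0r.
      by rewrite /x0 /param opprD addrACA subrr add0r -scalerBl.
    move=> e2; have : dot (s *: d) d = 0 by rewrite e2 (dotZl (s' - s0)) (dotC (tE E)) dt mulr0.
    by rewrite (dotZl s) d1 mulr1 => /eqP; rewrite (negPf sn0).
  by apply: (rE E' _ EE' _ cE') => i; apply: le_lt_trans sr.
have Es : edgeS E x0 by apply/edgeSP; exists s0.
have [dl dl0 Hd] := near0P (omegaFE_out EF Es).
have cst a b : a <= b -> (forall s, a <= s <= b -> s != 0 /\ `|s| < r) ->
    (faceS F (x0 + a *: d) <-> faceS F (x0 + b *: d)).
  move=> ab H; apply: (@connected_itv _ (fun s => faceS F (x0 + s *: d))) => // s sab.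
  have [sn sr] := H s sab.
  have [e e0 He] := face_locally_constant (pl s) (nb s sn sr).
  exists e => // s' _ ss'; apply: He => // i; exact: le_lt_trans ss'.
have wE : d = - (omegaFE F E *: nFE F E) by rewrite /d /inward scaleNr.
move=> s sn0 sr; split; first exact: nb.
have [sp|sn|s0'] := ltgtP s 0; last by rewrite s0' eqxx in sn0.
  split=> // Fs; exfalso.
  pose e := Num.min (dl / 2) (- s).
  have e0 : 0 < e by rewrite lt_min divr_gt0//= oppr_gt0.
  have el : e < dl.
    by have : e <= dl / 2; [rewrite ge_min lexx|lra].
  have es : e <= - s by rewrite ge_min lexx orbT.
  have [_ H] := Hd e (ltac:(by rewrite e0 el)).
  apply: H; apply: subset_closure.
  have -> : x0 + e *: (omegaFE F E *: nFE F E) = x0 + (- e) *: d by rewrite wE scaleNr scalerN opprK.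
  apply/(cst s (- e)) => //; first by lra.
  move=> s' /andP[s1 s2]; split; first by rewrite lt_eqF//; lra.
  by move: sr; rewrite !ltr0_norm//; lra.
split=> // _.
pose e := Num.min (dl / 2) s.
have e0 : 0 < e by rewrite lt_min divr_gt0.
have el : e < dl.
  by have : e <= dl / 2; [rewrite ge_min lexx|lra].
have es : e <= s by rewrite ge_min lexx orbT.
have [H _] := Hd e (ltac:(by rewrite e0 el)).
apply/(cst e s) => //.
  move=> s' /andP[s1 s2]; split; first by rewrite gt_eqF//; lra.
  by move: sr; rewrite !gtr0_norm//; lra.
by rewrite wE scalerN.
Qed.

(** This is [rays_sum] in the plane orthogonal to [E] at its midpoint. By [face_near_edge] each face
    adjacent to [E] cuts this plane near the midpoint along a ray directed by [inward], and the
    determinant of [inward] and the outer normal is the opposite of the product of the two signs. *)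
Lemma edge_sum T E :
  \sum_(F in facesT T | E \in edgesF F) omegaTF T F * omegaFE F E = 0.
Proof.
pose J := [pred F | (F \in facesT T) && (E \in edgesF F)].
have [[F0 /andP[_ EF0]]|none] := pselect (exists F, J F); last first.
  by apply: big1 => F JF; case: none; exists F.
pose sg F := - (omegaTF T F * omegaFE F E).
suff S0 : \sum_(F | J F) sg F = 0.
  by rewrite -[RHS]oppr0 -[in RHS]S0 -sumrN; apply: eq_bigr => F _; rewrite opprK.
pose s0 := hE E / 2; have h0 := hE_gt0 E.
have s0E : 0 < s0 < hE E by rewrite /s0; apply/andP; split; lra.
pose x0 := param E s0.
(* Near the midpoint only [E] and the faces adjacent to it are met. The constant 4 leaves room both
   for [plane_pt_near] and for the parameter of a point of a ray lying in the ball. *)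
have [r [r0 rF rE]] : exists r : R, [/\ 0 < r,
    forall F y, E \notin edgesF F -> (forall i, `|y 0 i - x0 0 i| < 4 * r) -> ~ closure (faceS F) y
    & forall E' y, E' != E -> (forall i, `|y 0 i - x0 0 i| < 4 * r) -> ~ closure (edgeS E') y].
  have HF F : exists e : R, 0 < e /\ (forall y, E \notin edgesF F ->
      (forall i, `|y 0 i - x0 0 i| < e) -> ~ closure (faceS F) y).
    have [EF|nEF] := boolP (E \in edgesF F); first by exists 1.
    have [e e0 He] := not_closure_near (edge_disjoint_closure_face nEF s0E).
    by exists e; split=> // y _; exact: He.
  have HE E' : exists e : R, 0 < e /\ (forall y, E' != E ->
      (forall i, `|y 0 i - x0 0 i| < e) -> ~ closure (edgeS E') y).
    have [->|nEE] := eqVneq E' E; first by exists 1.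
    have EE' : E != E' by rewrite eq_sym.
    have [e e0 He] := not_closure_near (edge_disjoint_closure EE' s0E).
    by exists e; split=> // y _; exact: He.
  have [f fP] := choice HF; have [g gP] := choice HE.
  have [d d0 Hd] := fin_min (fun F => (fP F).1).
  have [d' d'0 Hd'] := fin_min (fun E' => (gP E').1).
  exists (Num.min d d' / 4); have e2 : 4 * (Num.min d d' / 4) = Num.min d d' by field.
  split; first by rewrite divr_gt0// lt_min d0.
    move=> F y EF yx; apply: (fP F).2 => // i; apply: lt_le_trans (yx i) _.
    by rewrite e2; apply: le_trans (Hd F); rewrite ge_min lexx.
  move=> E' y EE' yx; apply: (gP E').2 => // i; apply: lt_le_trans (yx i) _.
  by rewrite e2; apply: le_trans (Hd' E'); rewrite ge_min lexx orbT.
(* An orthonormal frame of the plane orthogonal to t_E, taken from one adjacent face and oriented by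
   cross e1 e2 = t_E. *)
pose e1 := nFE F0 E; pose e2 := nF F0.
have u1 : dot e1 e1 = 1 by exact: nFE_unit.
have u2 : dot e2 e2 = 1 by exact: nF_unit.
have u12 : dot e1 e2 = 0 by exact: nFE_nF.
have ct : cross e1 e2 = tE E.
  by rewrite /e1 /e2 /nFE crossC cross_cross nF_unit (dotC (nF _)) tE_nF// scale0r sub0r opprK scale1r.
have dec w : dot w (tE E) = 0 -> dot w e1 *: e1 + dot w e2 *: e2 = w.
  move=> wt; have := frame_decomp w u1 u2 u12; rewrite ct wt scale0r addr0; by move=> <-.
have dect w : dot w (tE E) = 0 -> dot w w = dot w e1 * dot w e1 + dot w e2 * dot w e2.
  move=> wt; rewrite -{1}(dec w wt) dotDl (dotZl (dot w e1)) (dotZl (dot w e2)).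
  by rewrite !(dotC _ w).
clearbody e1 e2.
pose d F := inward F E; pose n F := omegaTF T F *: nF F.
have dt F : dot (d F) (tE E) = 0 by rewrite /d /inward dotZl dotC tE_nFE mulr0.
have nt F : E \in edgesF F -> dot (n F) (tE E) = 0.
  by move=> EF; rewrite /n dotZl dotC tE_nF// mulr0.
have d_unit F : J F -> dot (d F) (d F) = 1 by case/andP => _ /inward_unit.
have det F : J F -> dot (cross (d F) (n F)) (tE E) = sg F.
  case/andP => FT EF; rewrite /d /n /inward crossZl crossZr scalerA.
  have -> : cross (nFE F E) (nF F) = tE E.
    by rewrite /nFE crossC cross_cross nF_unit (dotC (nF _)) tE_nF// scale0r sub0r opprK scale1r.
  by rewrite (dotZl (_ * _)) tE_unit /sg; ring.

pose P := plane_pt x0 e1 e2.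
have x0t w : dot w (tE E) = 0 -> x0 + w = P (dot w e1) (dot w e2).
  by move=> wt; rewrite -{1}(dec w wt) /P /plane_pt addrA.
have Pray F s : P (s * dot (d F) e1) (s * dot (d F) e2) = x0 + s *: d F.
  rewrite x0t; last by rewrite (dotZl s) dt mulr0.
  by rewrite !(dotZl s).
have small F s : J F -> inball r (s * dot (d F) e1) (s * dot (d F) e2) -> `|s| < 4 * r.
  move=> JF [b1 b2]; rewrite -(@ltr_pXn2r _ 2) ?nnegrE ?mulr_ge0// ?ltW// ?mulr_gt0//.
  rewrite real_normK ?num_real//.
  have -> : s ^+ 2 = (s * dot (d F) e1) ^+ 2 + (s * dot (d F) e2) ^+ 2.
    by rewrite -[LHS]mulr1 -(d_unit _ JF) dect//; ring.
  have h1 : (s * dot (d F) e1) ^+ 2 < r ^+ 2 by rewrite -real_normK ?num_real// ltr_pXn2r ?nnegrE// ltW.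
  have h2 : (s * dot (d F) e2) ^+ 2 < r ^+ 2 by rewrite -real_normK ?num_real// ltr_pXn2r ?nnegrE// ltW.
  have r2 : 0 <= r ^+ 2 by exact: sqr_ge0.
  have -> : (4 * r) ^+ 2 = 16 * r ^+ 2 by ring.
  lra.
have half F s : J F -> s != 0 -> `|s| < 4 * r ->
    ~ bdry (faceS F) (x0 + s *: d F) /\ (faceS F (x0 + s *: d F) <-> 0 < s).
  by case/andP => _ EF; exact: (face_near_edge EF s0E rE).
have rays F F' s s' : J F -> J F' -> 0 < s -> 0 < s' ->
    s * dot (d F) e1 = s' * dot (d F') e1 -> s * dot (d F) e2 = s' * dot (d F') e2 -> F = F'.
  move=> JF JF' sp s'p q1 q2; apply/eqP/negPn/negP => FF'.
  have ss : s = s'.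
    have : s ^+ 2 = s' ^+ 2.
      rewrite -[LHS]mulr1 -(d_unit _ JF) -[RHS]mulr1 -(d_unit _ JF') !dect//.
      transitivity ((s * dot (d F) e1) ^+ 2 + (s * dot (d F) e2) ^+ 2); first by ring.
      by rewrite q1 q2; ring.
    by move/eqP; rewrite eqrXn2 ?ltW// => /eqP.
  rewrite -ss in q1 q2; have s_neq0 : s != 0 by rewrite gt_eqF.
  have dd : d F = d F'.
    by rewrite -(dec _ (dt F)) -(dec _ (dt F')) (mulfI s_neq0 q1) (mulfI s_neq0 q2).
  have rr : `|r| < 4 * r by rewrite gtr0_norm//; lra.
  have rn0 : r != 0 by rewrite gt_eqF.
  have [_ [_ /(_ r0) h1]] := half F r JF rn0 rr.
  have [_ [_ /(_ r0) h2]] := half F' r JF' rn0 rr.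
  rewrite -dd in h2; have /seteqP[H _] := face_disjoint FF'; exact: (H _ (conj h1 h2)).
apply: (@rays_sum R _ J (fun F => dot (d F) e1) (fun F => dot (d F) e2)
  (fun F => dot (n F) e1) (fun F => dot (n F) e2) sg (fun a b => eltS T (P a b)) r) => //.
- move=> a b ab0 [ar br] off.
  have near i : `|P a b 0 i - x0 0 i| < 2 * r by exact: plane_pt_near.
  have near4 i : `|P a b 0 i - x0 0 i| < 4 * r by apply: lt_le_trans (near i) _; lra.
  have nb : ~ bdry (eltS T) (P a b).
    rewrite elt_boundary => -[F /= FT cF].
    have [EF|nEF] := boolP (E \in edgesF F); last exact: (rF F _ nEF near4).
    have JF : J F by rewrite /J /= FT EF.
    pose w := P a b - x0; pose s := dot w (d F).
    have wE : w = a *: e1 + b *: e2 by rewrite /w /P /plane_pt -(addrA x0) addrAC subrr add0r.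
    have wt : dot w (tE E) = 0.
      rewrite wE dotDl (dotZl a) (dotZl b) -ct dot_cross_self dot_cross_selfr; ring.
    have wn : dot w (nF F) = 0.
      have h1 := closure_face_plane cF.
      have h2 : dot (x0 - xF F) (nF F) = 0.
        exact: edge_in_plane.
      have -> : w = (P a b - xF F) - (x0 - xF F) by rewrite /w opprB addrA subrK.
      by rewrite dotBl h1 h2 subrr.
    have ws : w = s *: d F.
      have ut : dot (nF F) (tE E) = 0 by rewrite dotC tE_nF.
      have := frame_decomp w (tE_unit E) (nFE_unit EF) (tE_nFE F E).
      rewrite cross_tE_nFE// wt wn !scale0r add0r addr0 => e.
      rewrite /s /d /inward (dotZr (- _)) scalerA.
      have -> : - omegaFE F E * dot w (nFE F E) * - omegaFE F E =
        (omegaFE F E * omegaFE F E) * dot w (nFE F E) by ring.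
      by rewrite omegaFE_sq// mul1r -e.
    have sE : P a b = x0 + s *: d F by rewrite -ws /w addrC subrK.
    have [a_s b_s] : a = s * dot (d F) e1 /\ b = s * dot (d F) e2.
      rewrite -!(dotZl s) -ws wE !dotDl !(dotZl a) !(dotZl b) u1 u2 u12 (dotC e2) u12.
      by split; ring.
    (* A boundary point with s < 0 contradicts [half], s > 0 puts it on a ray, and s = 0 at the
       centre. *)
    have [sn|sp|sz] := ltgtP s 0.
    + have sr : `|s| < 4 * r by apply: (small F) => //; split; rewrite -?a_s -?b_s.
      have [h1 h2] := half F s JF (ltac:(by rewrite lt_eqF)) sr.
      rewrite sE in cF; have [Fs|nFs] := pselect (faceS F (x0 + s *: d F)).
        by move/h2: Fs; rewrite ltNge (ltW sn).
      by apply: h1; split.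
    + by apply: (off F JF s sp).
    + by apply: ab0; rewrite a_s b_s sz !mul0r.
  have [e e0 He] := elt_locally_constant nb.
  exists (e / 2) => [|a' b' a'a b'b]; first by rewrite divr_gt0.
  apply: He => i.
  have -> : P a' b' 0 i - P a b 0 i =
      plane_pt 0 e1 e2 (a' - a) (b' - b) 0 i - (0 : 'rV[R]_3) 0 i.
    exact: plane_pt_sub.
  have <- : 2 * (e / 2) = e by field.
  exact: plane_pt_near.
- move=> F s JF sp bs; have /andP[FT EF] := JF.
  have [_ [_ /(_ sp) Fs]] := half F s JF (ltac:(by rewrite gt_eqF)) (small F s JF bs).
  have [dl dl0 Hd] := near0P (omegaTF_out FT Fs).
  exists dl => // e /Hd [h1 h2].
  have Pn c : P (s * dot (d F) e1 + c * dot (n F) e1) (s * dot (d F) e2 + c * dot (n F) e2) =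
     x0 + s *: d F + c *: n F.
    rewrite -addrA x0t; last by rewrite dotDl (dotZl s) (dotZl c) dt nt// !mulr0 addr0.
    by rewrite !dotDl !(dotZl s) !(dotZl c).
  have -> : s * dot (d F) e1 - e * dot (n F) e1 = s * dot (d F) e1 + (- e) * dot (n F) e1 by ring.
  have -> : s * dot (d F) e2 - e * dot (n F) e2 = s * dot (d F) e2 + (- e) * dot (n F) e2 by ring.
  by rewrite !Pn scaleNr; split=> // h3; apply: h2; exact: subset_closure.
- move=> F /andP[FT EF]; rewrite /sg.
  by case: (omegaTF_sign FT) => ->; case: (omegaFE_sign EF) => ->;
    rewrite ?mulrNN ?mulr1 ?mul1r ?opprK; auto.
- move=> F JF; rewrite dot_frame2 ct det// /sg mulrNN; case/andP: JF => FT EF.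
  have -> : omegaTF T F * omegaFE F E * (omegaTF T F * omegaFE F E) =
    (omegaTF T F * omegaTF T F) * (omegaFE F E * omegaFE F E) by ring.
  by rewrite omegaTF_sq// omegaFE_sq// mulr1.
Qed.

End EdgeSum.

(** * Faces *)

Section FaceIntegrals.
Context {R : realType} (M : mesh R).
Implicit Types (F : face M) (E : edge M) (x : 'rV[R]_3).
Local Notation leb := (@lebesgue_measure R).
Local Notation P2 := (mpoly 2 R).
Local Notation V2 := 'rV[mpoly 2 R]_2.

Definition faceU F : set (R * R) := chart F @^-1` faceS F.
(** Integrals on a face are reduced to this linear form on polynomials in the face coordinates, as
    those on an edge are to [edge_int] on univariate polynomials. *)
Definition fint F (p : P2) : R := pint (leb \x leb)%E (faceU F) coord2 p.

Lemma faceU_domain F : poly_domain (leb \x leb)%E (faceU F) coord2.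
Proof. by have [U0 oU bU _ _] := face_region F; exact: poly_domain2. Qed.

Lemma fintD F p q : fint F (p + q) = fint F p + fint F q.
Proof. exact: pintD (faceU_domain F) p q. Qed.
Lemma fintZ F c p : fint F (c *: p) = c * fint F p.
Proof. exact: pintZ (faceU_domain F) c p. Qed.
Lemma fintN F p : fint F (- p) = - fint F p.
Proof. exact: pintN (faceU_domain F) p. Qed.
Lemma fint0 F : fint F 0 = 0.
Proof. exact: pint0 (faceU_domain F). Qed.

Lemma chart_sub F (y : R * R) i : dot (chart F y - xF F) (tau F i) = coord2 y i.
Proof.
have -> : chart F y - xF F = y.1 *: tau F 0 + y.2 *: tau F 1.
  by rewrite /chart -(addrA (xF F)) addrAC subrr add0r.
rewrite dotDl !dotZl !tau_orthonormal /coord2.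
by case: (ord2 i) => -> /=; rewrite ?mulr1 ?mulr0 ?addr0 ?add0r.
Qed.

Lemma evalF_chart F p (y : R * R) : evalF F p (chart F y) = meval (coord2 y) p.
Proof. by apply: meval_eq => i; rewrite chart_sub. Qed.

Lemma evalFD F p q x : evalF F (p + q) x = evalF F p x + evalF F q x.
Proof. exact: mevalD. Qed.
Lemma evalFM F p q x : evalF F (p * q) x = evalF F p x * evalF F q x.
Proof. exact: mevalM. Qed.
Lemma evalFZ F c p x : evalF F (c *: p) x = c * evalF F p x.
Proof. exact: mevalZ. Qed.
Lemma evalF0 F x : evalF F 0 x = 0.
Proof. exact: meval0. Qed.

Lemma intF_eval F p : intF F (evalF F p) = fint F p.
Proof. by apply: eq_Rintegral => y _; rewrite evalF_chart. Qed.

Lemma eq_intF F f g : (forall y, f (chart F y) = g (chart F y)) -> intF F f = intF F g.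
Proof. by move=> fg; apply: eq_Rintegral => y _; rewrite fg. Qed.

Lemma prodFE F p q : prodF F p q = fint F (p * q).
Proof. by rewrite -intF_eval; apply: eq_intF => y; rewrite evalFM. Qed.

Lemma dot_evalvF F (u v : V2) x : dot (evalvF F u x) (evalvF F v x) = evalF F (dot u v) x.
Proof.
rewrite /evalvF !sum2 dotDl !dotZl !dotDr !dotZr !tau_orthonormal /= /dot sum2.
by rewrite evalFD !evalFM; ring.
Qed.

Lemma dotFE F u v : dotF F u v = fint F (dot u v).
Proof. by rewrite -intF_eval; apply: eq_intF => y; rewrite dot_evalvF. Qed.

Lemma dotF_eq0 F u : dotF F u u = 0 -> u = 0.
Proof.
have dom := faceU_domain F.
rewrite dotFE => H; have : dot u u = 0.
  apply: (pint_pos0 dom) H => y _; rewrite raddf_sum; apply: sumr_ge0 => i _ /=.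
  by rewrite mevalM -expr2 sqr_ge0.
move=> u0; apply/rowP => i; rewrite mxE.
have H0 j : fint F (u 0 j * u 0 j) = 0.
  have ge j' : 0 <= fint F (u 0 j' * u 0 j').
    by apply: Rintegral_ge0 => y _; rewrite mevalM -expr2 sqr_ge0.
  have : fint F (u 0 0 * u 0 0) + fint F (u 0 1 * u 0 1) = 0.
    by rewrite -fintD; move: H; rewrite /dot sum2.
  by have := ge 0; have := ge 1; case: (ord2 j) => ->; lra.
exact: (pint_sq0 dom (H0 i)).
Qed.

Lemma dotFDl F u v w : dotF F (u + v) w = dotF F u w + dotF F v w.
Proof. by rewrite !dotFE dotDl fintD. Qed.
Lemma dotFC F u v : dotF F u v = dotF F v u.
Proof. by rewrite !dotFE dotC. Qed.
Lemma dotFDr F u v w : dotF F w (u + v) = dotF F w u + dotF F w v.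
Proof. by rewrite dotFC dotFDl !(dotFC _ w). Qed.
Lemma dotFZl F c u w : dotF F (mpolyC 2 c *: u) w = c * dotF F u w.
Proof. by rewrite !dotFE dotZl mul_mpolyC fintZ. Qed.
Lemma dotFZr F c u w : dotF F w (mpolyC 2 c *: u) = c * dotF F w u.
Proof. by rewrite dotFC dotFZl (dotFC _ w). Qed.
Lemma dotF0l F u : dotF F 0 u = 0.
Proof. by rewrite dotFE dot0l fint0. Qed.
Lemma dotF0r F u : dotF F u 0 = 0.
Proof. by rewrite dotFC dotF0l. Qed.
Lemma dotF_ge0 F u : 0 <= dotF F u u.
Proof.
by rewrite /dotF /intF; apply: Rintegral_ge0 => y _; exact: dot_ge0.
Qed.
Lemma prodF0l F p : prodF F 0 p = 0.
Proof. by rewrite prodFE mul0r fint0. Qed.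
Lemma prodF0r F p : prodF F p 0 = 0.
Proof. by rewrite prodFE mulr0 fint0. Qed.
Lemma prodFDr F p q r : prodF F p (q + r) = prodF F p q + prodF F p r.
Proof. by rewrite !prodFE mulrDr fintD. Qed.
Lemma prodFZr F p c q : prodF F p (c *: q) = c * prodF F p q.
Proof. by rewrite !prodFE -scalerAr fintZ. Qed.
Lemma prodF_eq0 F p : prodF F p p = 0 -> p = 0.
Proof. by rewrite prodFE; exact: (pint_sq0 (faceU_domain F)). Qed.

Definition edge_int E (p : {poly R}) : R := \int[leb]_(s in `[0, hE E]%classic) p.[s].

Lemma edge_int_integrable E (p : {poly R}) :
  leb.-integrable `[0, hE E]%classic (EFin \o (fun s => p.[s])).
Proof. by apply: (@integrable_horner _ p 0 (hE E)) => //; exact: measurable_itv. Qed.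

Lemma edge_intD E p q : edge_int E (p + q) = edge_int E p + edge_int E q.
Proof.
rewrite /edge_int -RintegralD//; try exact: edge_int_integrable.
by apply: eq_Rintegral => s _; rewrite hornerD.
Qed.

Lemma edge_intZ E c p : edge_int E (c *: p) = c * edge_int E p.
Proof.
rewrite /edge_int -RintegralZl//; try exact: edge_int_integrable.
by apply: eq_Rintegral => s _; rewrite hornerZ.
Qed.

Lemma edge_int0 E : edge_int E 0 = 0.
Proof. by rewrite -(scale0r (0 : {poly R})) edge_intZ mul0r. Qed.

Lemma edge_int_deriv E p : edge_int E p^`() = p.[hE E] - p.[0].
Proof. by apply: FTC_horner; exact: ltW (hE_gt0 E). Qed.

Lemma intE_horner E f (p : {poly R}) : (forall s, f (param E s) = p.[s]) -> intE E f = edge_int E p.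
Proof. by move=> H; apply: eq_Rintegral => s _; rewrite H. Qed.

Definition edge_src F E : 'rV[R]_2 := \row_i dot (vpos (src E) - xF F) (tau F i).
Definition edge_dir F E : 'rV[R]_2 := \row_i dot (tE E) (tau F i).
Definition edge_poly F E (p : P2) : {poly R} := line p (edge_src F E) (edge_dir F E).

Lemma edge_polyD F E p q : edge_poly F E (p + q) = edge_poly F E p + edge_poly F E q.
Proof. exact: mmapD. Qed.
Lemma edge_polyM F E p q : edge_poly F E (p * q) = edge_poly F E p * edge_poly F E q.
Proof. exact: (rmorphM (mmap _ _)). Qed.
Lemma edge_polyC F E c : edge_poly F E (mpolyC 2 c) = c%:P.
Proof. exact: mmapC. Qed.
Lemma edge_poly0 F E : edge_poly F E 0 = 0.
Proof. exact: mmap0. Qed.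

Lemma evalF_param F E p s : evalF F p (param E s) = (edge_poly F E p).[s].
Proof.
rewrite /edge_poly horner_line; apply: meval_eq => i.
rewrite !mxE.
have -> : param E s - xF F = (vpos (src E) - xF F) + s *: tE E by rewrite /param addrAC.
by rewrite dotDl (dotZl s).
Qed.

Lemma evalE_param E (q : {poly R}) s : evalE E q (param E s) = q.[s].
Proof.
rewrite /evalE; have -> : param E s - vpos (src E) = s *: tE E.
  by rewrite /param addrAC subrr add0r.
by rewrite (dotZl s) tE_unit mulr1.
Qed.

Lemma dot_evalvF_edge F E (v : V2) (w : 'rV[R]_3) s :
  dot (evalvF F v (param E s)) w =
  (\sum_i dot (tau F i) w *: edge_poly F E (v 0 i)).[s].
Proof.
rewrite /evalvF !sum2 dotDl !dotZl hornerD !hornerZ !evalF_param.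
by congr (_ + _); rewrite mulrC.
Qed.

Definition normal_poly F E (v : V2) : {poly R} :=
  \sum_i dot (tau F i) (nFE F E) *: edge_poly F E (v 0 i).
Definition tangent_poly F E (v : V2) : {poly R} :=
  \sum_i dot (tau F i) (tE E) *: edge_poly F E (v 0 i).

Lemma normal_polyD F E u v : normal_poly F E (u + v) = normal_poly F E u + normal_poly F E v.
Proof.
by rewrite /normal_poly -big_split; apply: eq_bigr => i _; rewrite mxE edge_polyD scalerDr.
Qed.
Lemma normal_polyZ F E c u : normal_poly F E (mpolyC 2 c *: u) = c *: normal_poly F E u.
Proof.
rewrite /normal_poly scaler_sumr; apply: eq_bigr => i _.
by rewrite mxE edge_polyM edge_polyC mul_polyC !scalerA mulrC.
Qed.
Lemma tangent_poly0 F E : tangent_poly F E 0 = 0.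
Proof. by apply: big1 => i _; rewrite mxE edge_poly0 scaler0. Qed.

Lemma bfluxE F q v : bflux F q v =
  \sum_(E in edgesF F) omegaFE F E * edge_int E (q E * normal_poly F E v).
Proof.
apply: eq_bigr => E _; congr (_ * _); apply: intE_horner => s.
by rewrite evalE_param dot_evalvF_edge hornerM.
Qed.

Lemma bfluxD F q u v : bflux F q (u + v) = bflux F q u + bflux F q v.
Proof.
rewrite !bfluxE -big_split; apply: eq_bigr => E _ /=.
by rewrite normal_polyD mulrDr edge_intD mulrDr.
Qed.
Lemma bfluxZ F q c u : bflux F q (mpolyC 2 c *: u) = c * bflux F q u.
Proof.
rewrite !bfluxE mulr_sumr; apply: eq_bigr => E _ /=.
by rewrite normal_polyZ -scalerAr edge_intZ mulrCA.
Qed.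
Lemma bflux0 F q : bflux F q 0 = 0.
Proof. by rewrite -(scale0r 0) -mpolyC0 bfluxZ mul0r. Qed.

Lemma bcirc_eq0 F v r : (forall E, E \in edgesF F -> v E = 0) -> bcirc F v r = 0.
Proof.
move=> H; apply: big1 => E EF; rewrite (intE_horner (p := 0)) ?edge_int0 ?mulr0// => s.
by rewrite H// evalE_param !horner0 mul0r.
Qed.

Lemma tangent_polyE F E v : tangent_poly F E v = \sum_i edge_dir F E 0 i *: edge_poly F E (v 0 i).
Proof. by apply: eq_bigr => i _; congr (_ *: _); rewrite mxE dotC. Qed.

Lemma deriv_edge_poly F E p : (edge_poly F E p)^`() = tangent_poly F E (grad p).
Proof.
by rewrite /edge_poly deriv_line tangent_polyE; apply: eq_bigr => i _; congr (_ *: _);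
rewrite mxE.
Qed.

Lemma edge_sq_eq0 E p : edge_int E (p * p) = 0 -> p = 0.
Proof.
move=> H; apply: (Rintegral_sq_eq0 (hE_gt0 E)); rewrite -[RHS]H.
by apply: eq_Rintegral => s _; rewrite hornerM.
Qed.

Lemma edge_sq_ge0 E p : 0 <= edge_int E (p * p).
Proof. by apply: Rintegral_ge0 => s _; rewrite hornerM -expr2 sqr_ge0. Qed.

End FaceIntegrals.

(** * Edges of a face in different directions *)

Section TransversalEdge.
Context {R : realType} (M : mesh R).
Implicit Types (F : face M) (E : edge M) (x : 'rV[R]_3).

Lemma face_bounded F : exists K : R, forall x, faceS F x -> forall i,
  `|dot (x - xF F) (tau F i)| <= K.
Proof.
have [_ _ /bounded_pairP[K HK] _ _] := face_region F; exists K => x Fx i.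
have [y _ yx] := face_planar Fx; have := HK y; rewrite /preimage /= yx => /(_ Fx) [h1 h2].
by rewrite -yx chart_sub /coord2; case: ifP.
Qed.

Lemma tE_expand F E x : E \in edgesF F ->
  dot x (tE E) = dot (tE E) (tau F 0) * dot x (tau F 0) + dot (tE E) (tau F 1) * dot x (tau F 1).
Proof.
move=> EF; have key (t : 'rV[R]_3) : dot t (tau F 0) *: tau F 0 + dot t (tau F 1) *: tau F 1 = t ->
    dot x t = dot t (tau F 0) * dot x (tau F 0) + dot t (tau F 1) * dot x (tau F 1).
  by move=> e; rewrite -{1}e dotDr !dotZr.
exact: key _ (tE_frame EF).
Qed.

(* A line of direction [t_E] through a point of the bounded face [F] leaves [F]. *)
Lemma transversal_edge F E : E \in edgesF F ->
  exists2 E', E' \in edgesF F & dot (tE E') (nFE F E) != 0.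
Proof.
move=> EF; apply: contrapT => H.
have par E' : E' \in edgesF F -> dot (tE E') (nFE F E) = 0.
  by move=> E'F; apply/eqP/negPn/negP => ne; apply: H; exists E'.
pose w := nFE F E; have w1 : dot w w = 1 by exact: nFE_unit.
have wn : dot w (nF F) = 0 by exact: nFE_nF.
have wt : dot (tE E) w = 0 by exact: tE_nFE.
have tn := tE_nF EF.
have parw E' : E' \in edgesF F -> dot (tE E') w = 0 := par E'.
have [[y Uy] _ _ _ _] := face_region F; pose x1 := chart F y.
have Fx1 : faceS F x1 by [].
have p1 : dot (x1 - xF F) (nF F) = 0 by apply/planeE/face_planar.
have nb1 : ~ bdry (faceS F) x1 by case.
have [e e0 He] := face_locally_constant p1 nb1.
(* If all edges are parallel to t_E, [b E'] is the offset from x1 of the line of [E'] in the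
   direction [w]. A small positive [s0] different from all offsets gives a line that avoids the
   boundary of [F]. *)
pose b E' := dot (vpos (src E')) w - dot x1 w.
have b0 E' : 0 < (if 0 < b E' then b E' else 1) by case: ifP.
have [d d0 Hd] := fin_min b0.
clearbody w.
pose s0 := Num.min d e / 2.
have s0p : 0 < s0 by rewrite divr_gt0// lt_min d0.
have s0d : s0 < d.
  have : Num.min d e <= d by rewrite ge_min lexx.
  by rewrite /s0; lra.
have s0e : s0 < e.
  have : Num.min d e <= e by rewrite ge_min lexx orbT.
  by rewrite /s0; lra.
clearbody s0.
have s0b E' : s0 != b E'.
  apply/eqP => s0b; have := Hd E'; rewrite -s0b s0p; lra.
pose x0 := x1 + s0 *: w.
have p0 s : dot (x0 + s *: tE E - xF F) (nF F) = 0.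
  have -> : x0 + s *: tE E - xF F = (x1 - xF F) + s0 *: w + s *: tE E.
    by rewrite /x0 addrAC (addrAC x1).
  by rewrite dotDl (dotZl s) tn (dotDl (x1 - _)) dotZl p1 wn; ring.
have Fx0 : faceS F (x0 + 0 *: tE E).
  rewrite scale0r addr0; apply/He => //; first by have := p0 0; rewrite scale0r addr0.
  move=> i; have := @rowB_scale R 3 x1 w s0 0 i; rewrite scale0r addr0 subr0 => ->.
  by rewrite normrM gtr0_norm//; apply: le_lt_trans s0e; apply: ler_piMr; [exact: ltW|exact: unit_coord].
have nb s : ~ bdry (faceS F) (x0 + s *: tE E).
  move=> /bdry_faceP[E' E'F /closure_edgeP[s' _ e']].
  have q1 : dot (param E' s') w = dot (vpos (src E')) w.
    by rewrite /param dotDl (dotZl s') parw// mulr0 addr0.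
  have q2 : dot (x0 + s *: tE E) w = dot x1 w + s0.
    by rewrite dotDl (dotZl s) wt mulr0 addr0 /x0 dotDl dotZl w1 mulr1.
  by rewrite e' q1 in q2; case/eqP: (s0b E'); rewrite /b q2; ring.
have [K HK] := face_bounded F.
pose c0 := dot (tE E) (tau F 0); pose c1 := dot (tE E) (tau F 1).
(* [L] exceeds the extent of [F] in the direction t_E, so that the point at parameter [L] cannot be
   in [F]. *)
pose L := `|c0| * `|K| + `|c1| * `|K| + `|dot (x0 - xF F) (tE E)| + 1.
have L0 : 0 <= L by rewrite /L !addr_ge0// mulr_ge0.
have FL : faceS F (x0 + L *: tE E).
  apply/(@connected_itv _ (fun s => faceS F (x0 + s *: tE E)) 0 L) => // s _.
  have [e' e'0 He'] := face_locally_constant (p0 s) (nb s).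
  exists e' => // s' _ ss'; apply: He' => // i; rewrite rowB_scale normrM.
  by apply: le_lt_trans ss'; rewrite ler_piMr// (unit_coord _ (tE_unit E)).
have := tE_expand (x0 + L *: tE E - xF F) EF; rewrite -/c0 -/c1.
have -> : dot (x0 + L *: tE E - xF F) (tE E) = dot (x0 - xF F) (tE E) + L.
  by rewrite addrAC dotDl (dotZl L) tE_unit mulr1.
have k0 := HK _ FL 0; have k1 := HK _ FL 1.
have KK := ler_norm K.
set a0 := dot _ (tau F 0); set a1 := dot _ (tau F 1).
have h0 : `|c0 * a0| <= `|c0| * `|K|.
  by rewrite normrM ler_wpM2l//; apply: le_trans KK.
have h1 : `|c1 * a1| <= `|c1| * `|K|.
  by rewrite normrM ler_wpM2l//; apply: le_trans KK.
have := ler_norm (c0 * a0); have := ler_norm (c1 * a1).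
have := ler_norm (- dot (x0 - xF F) (tE E)); rewrite normrN /L; lra.
Qed.

End TransversalEdge.

(** * Uniqueness in the serendipity problem on a face *)

Section Serendipity.
Context {R : realType} (M : mesh R) (B : selection M) (k : nat).
Implicit Types (F : face M) (E : edge M) (x : 'rV[R]_3).
Local Notation P2 := (mpoly 2 R).
Local Notation V2 := 'rV[mpoly 2 R]_2.

(** The boundary of a face is covered by its closed edges, on which [p] is zero. *)
Lemma faceU_green F (p : P2) i : (forall E, E \in edgesF F -> edge_poly F E p = 0) ->
  fint F (mderiv i p) = 0.
Proof.
move=> pE; have [U0 oU bU _ _] := face_region F.
apply: green_boundary0 => // y nUy Hy.
have /bdry_faceP[E EF /closure_edgeP[s _ e]] : bdry (faceS F) (chart F y).
  split=> //; apply/closure_rowP => e e0.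
  have [y' Uy' [h1 h2]] := Hy (e / 2) (divr_gt0 e0 (ltr0n R 2)).
  exists (chart F y') => // j.
  have -> : chart F y' 0 j - chart F y 0 j =
      plane_pt 0 (tau F 0) (tau F 1) (y'.1 - y.1) (y'.2 - y.2) 0 j - (0 : 'rV[R]_3) 0 j.
    exact: plane_pt_sub.
  have <- : 2 * (e / 2) = e by field.
  by apply: plane_pt_near => //; exact: tau_unit.
by rewrite -(evalF_chart F) e evalF_param pE// horner0.
Qed.

(** The affine form (x - x_E) . n_FE in the coordinates of [F]: up to sign and scaling, the distance
    function of the boundaries selection. *)
Definition edge_affine F E : P2 :=
  affine (dot (xF F - xE E) (nFE F E)) (\row_i dot (tau F i) (nFE F E)).

Lemma edge_affine_eval F E (y : R * R) :
  meval (coord2 y) (edge_affine F E) = dot (chart F y - xE E) (nFE F E).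
Proof.
rewrite meval_affine sum2 !mxE /coord2 /=.
have -> : chart F y - xE E = (xF F - xE E) + y.1 *: tau F 0 + y.2 *: tau F 1.
  by rewrite /chart addrAC (addrAC (xF F)).
by rewrite [in RHS]dotDl [in RHS](dotDl (xF F - _)) !dotZl; ring.
Qed.

Lemma edge_affine_unit F E : E \in edgesF F ->
  dot (\row_i dot (tau F i) (nFE F E)) (\row_i dot (tau F i) (nFE F E)) = 1.
Proof.
move=> EF; rewrite /dot sum2 !mxE -/(dot _ _).
have key (t : 'rV[R]_3) : dot t (tau F 0) *: tau F 0 + dot t (tau F 1) *: tau F 1 = t ->
    dot t t = dot (tau F 0) t * dot (tau F 0) t + dot (tau F 1) t * dot (tau F 1) t.
  by move=> e; rewrite -{1}e dotDl !dotZl !(dotC (tau F _)).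
by have := key _ (nFE_frame F E); rewrite nFE_unit.
Qed.

Lemma row_coord2 (z : 'rV[R]_2) : (fun i => z 0 i) =1 coord2 (z 0 0, z 0 1).
Proof. by move=> i; rewrite /coord2; case: (ord2 i) => ->. Qed.

Lemma edge_poly_factor F E (l : int) (p : P2) : E \in edgesF F -> Pol l p ->
  edge_poly F E p = 0 -> exists2 q, Pol (l - 1) q & p = edge_affine F E * q.
Proof.
move=> EF Hp pE; have aa := edge_affine_unit EF.
have [|q pq] := @affine_factor R 2 (dot (xF F - xE E) (nFE F E)) _ p aa.
  move=> z; rewrite (meval_eq (v2 := coord2 (z 0 0, z 0 1))); last exact: row_coord2.
  rewrite -/(edge_affine F E) edge_affine_eval => h.
  rewrite (meval_eq (v2 := coord2 (z 0 0, z 0 1))); last exact: row_coord2.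
  rewrite -(evalF_chart F); set x := chart F _ in h *.
  have [s0 _ s0E] := xE_line E.
  have xn : dot (x - vpos (src E)) (nFE F E) = 0.
    have -> : x - vpos (src E) = (x - xE E) + s0 *: tE E.
      by rewrite -s0E /param opprD addrA subrK.
    by rewrite dotDl h add0r (dotZl s0) tE_nFE mulr0.
  have xF0 : dot (x - vpos (src E)) (nF F) = 0.
    have h1 : dot (x - xF F) (nF F) = 0 by apply/planeE; exists (z 0 0, z 0 1).
    have h2 : dot (vpos (src E) - xF F) (nF F) = 0.
      by rewrite -param_src edge_in_plane.
    have -> : x - vpos (src E) = (x - xF F) - (vpos (src E) - xF F) by rewrite opprB addrA subrK.
    by rewrite dotBl h1 h2 subrr.
  have := frame_decomp (x - vpos (src E)) (tE_unit E) (nFE_unit EF) (tE_nFE F E).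
  rewrite cross_tE_nFE// xn xF0 !scale0r !addr0 => e.
  have -> : x = param E (dot (x - vpos (src E)) (tE E)).
    by rewrite /param -e addrC subrK.
  by rewrite evalF_param pE horner0.
exists q => //; apply: (@Pol_divl R 2 l (edge_affine F E)); last by rewrite -pq.
exact: msize_affine.
Qed.

(** By [selF_dist] the form of [E] is nonzero at the point x_E' of the line of [E']. This allows the
    forms of the selected edges to be divided out one after the other. *)
Lemma edge_poly_affine_neq0 F E E' : E \in selF B F -> E' \in selF B F -> E != E' ->
  edge_poly F E' (edge_affine F E) != 0.
Proof.
move=> EB E'B EE'; apply/eqP => e0.
have E'F := fintype.subsetP (selF_sub B F) _ E'B.
have [s _ sE] := xE_line E'.
have := selF_dist EB E'B EE'; have := theta_gt0 B.
have : dot (xE E' - xE E) (nFE F E) = 0.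
  have pl : dot (xE E' - xF F) (nF F) = 0 by rewrite -sE edge_in_plane.
  have cE := chart_plane pl.
  by rewrite -cE -edge_affine_eval -(evalF_chart F) cE -sE evalF_param e0 horner0.
by rewrite /distF dotNr dotZr => ->; rewrite mulr0 oppr0 mulr0; lra.
Qed.

Lemma edge_polys_factor F (es : seq (edge M)) (l : int) (p : P2) : uniq es ->
  {subset es <= selF B F} -> Pol l p -> (forall E, E \in es -> edge_poly F E p = 0) ->
  exists2 q, Pol (l - (size es)%:Z) q & p = (\prod_(E <- es) edge_affine F E) * q.
Proof.
elim: es l p => [|E es IH] l p /=; first by exists p; rewrite ?subr0// big_nil mul1r.
move=> /andP[Ees ues] sub Hp pE.
have EB : E \in selF B F by apply: sub; rewrite mem_head.
have EF := fintype.subsetP (selF_sub B F) _ EB.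
have [q Hq pq] := edge_poly_factor EF Hp (pE E (mem_head _ _)).
have [||||q' Hq' qq'] := IH (l - 1) q => //.
- by move=> E' E's; apply: sub; rewrite inE E's orbT.
- move=> E' E's; have := pE E'; rewrite inE E's orbT => /(_ isT).
  rewrite pq edge_polyM => /eqP; rewrite mulf_eq0 => /orP[|/eqP //].
  rewrite (negPf (edge_poly_affine_neq0 _ _ _))//.
    by apply: sub; rewrite inE E's orbT.
  by apply: contraNneq Ees => ->.
exists q'; last by rewrite big_cons -mulrA -qq'.
have -> : l - (size es).+1%:Z = l - 1 - (size es)%:Z by lia.
exact: Hq'.
Qed.

Lemma edge_affine_sign F E (y : R * R) : E \in selF B F -> faceU F y -> 0 < hF F ->
  0 <= - omegaFE F E * meval (coord2 y) (edge_affine F E).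
Proof.
move=> EB Uy h0; have := selF_one_side EB Uy.
rewrite /distF pmulr_rge0 ?invr_gt0// dotNr dotZr edge_affine_eval mulNr; exact.
Qed.

(** [hF] is a supremum, so besides two points of [F] at positive distance, a bound on all distances
    is needed. *)
Lemma hF_gt0 F : 0 < hF F.
Proof.
have [K HK] := face_bounded F.
have [[y Uy] oU _ _ _] := face_region F; have [e e0 He] := open_pairP oU Uy.
pose D := [set enorm (z.1 - z.2) | z in faceS F `*` faceS F].
have Fy : faceS F (chart F y) by [].
have Fy' : faceS F (chart F (y.1 + e / 2, y.2)).
  apply: He => /=; last by rewrite subrr normr0.
  by rewrite addrAC subrr add0r gtr0_norm; lra.
have e_norm : enorm (chart F (y.1 + e / 2, y.2) - chart F y) = e / 2.
  have -> : chart F (y.1 + e / 2, y.2) - chart F y = (e / 2) *: tau F 0.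
    by rewrite /chart /= opprD addrACA subrr addr0 opprD addrACA subrr add0r -scalerBl addrAC subrr add0r.
  rewrite /enorm dotZl dotZr tau_unit mulr1 -expr2 sqrtr_sqr gtr0_norm//; lra.
apply: (@lt_le_trans _ _ (e / 2)); first lra.
apply: ub_le_sup; last first.
  by exists (chart F (y.1 + e / 2, y.2), chart F y).
(* Both coordinates of a - b in the plane are at most 2 K in absolute value, and sqrt t <= 1 + t. *)
exists (1 + 8 * K ^+ 2) => _ [[a b] [/= Fa Fb] <-].
have n1 (t : R) : 0 <= t -> Num.sqrt t <= 1 + t.
  move=> t0; rewrite -(@ler_pXn2r _ 2) ?nnegrE ?sqrtr_ge0//; last lra.
  by rewrite sqr_sqrtr// sqrrD expr1n mul1r; have := sqr_ge0 t; lra.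
apply: le_trans (n1 _ (dot_ge0 _)) _; rewrite lerD2l.
have pa : dot (a - b) (nF F) = 0.
  have -> : a - b = (a - xF F) - (b - xF F) by rewrite opprB addrA subrK.
  have /planeE h1 := face_planar Fa; have /planeE h2 := face_planar Fb.
  by rewrite dotBl h1 h2 subrr.
have := frame_decomp (a - b) (tau_unit F 0) (tau_unit F 1) (tau_ortho F).
rewrite -/(nF F) pa scale0r addr0 => dec.
have -> : dot (a - b) (a - b) = dot (a - b) (tau F 0) ^+ 2 + dot (a - b) (tau F 1) ^+ 2.
  by rewrite [X in dot X _]dec dotDl !dotZl !(dotC _ (a - b)) !expr2.
have bd i : dot (a - b) (tau F i) ^+ 2 <= 4 * K ^+ 2.
  have -> : a - b = (a - xF F) - (b - xF F) by rewrite opprB addrA subrK.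
  rewrite dotBl; have := HK _ Fa i; have := HK _ Fb i.
  have K0 : 0 <= K by apply: le_trans (HK _ Fa i).
  have -> : 4 * K ^+ 2 = (2 * K) ^+ 2 by ring.
  move=> h1 h2; rewrite -real_normK ?num_real// ler_pXn2r ?nnegrE//; last lra.
  by apply: le_trans (ler_normB _ _) _; lra.
by have := bd 0; have := bd 1; lra.
Qed.

Lemma edge_lines_meet F E E' : E \in edgesF F -> E' \in edgesF F ->
  dot (tE E') (nFE F E) != 0 -> exists s s', param E s = param E' s'.
Proof.
move=> EF E'F ne.
pose s' := - dot (vpos (src E') - vpos (src E)) (nFE F E) / dot (tE E') (nFE F E).
pose z := param E' s' - vpos (src E).
have zE : z = (vpos (src E') - vpos (src E)) + s' *: tE E' by rewrite /z /param addrAC.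
have zn : dot z (nFE F E) = 0.
  by rewrite zE dotDl (dotZl s') /s' divfK// subrr.
have zF : dot z (nF F) = 0.
  rewrite zE dotDl (dotZl s') tE_nF// mulr0 addr0.
  have p1 := edge_in_plane 0 EF; have p2 := edge_in_plane 0 E'F.
  rewrite !param_src in p1 p2.
  have -> : vpos (src E') - vpos (src E) = (vpos (src E') - xF F) - (vpos (src E) - xF F).
    by rewrite opprB addrA subrK.
  by rewrite dotBl p1 p2 subrr.
exists (dot z (tE E)), s'.
have := frame_decomp z (tE_unit E) (nFE_unit EF) (tE_nFE F E).
rewrite cross_tE_nFE// zn zF !scale0r !addr0 => e.
by rewrite [in LHS]/param -e /z addrC subrK.
Qed.

(** The edges of a face need not form a connected set, so constants are not propagated along the
    boundary. Instead [p] is constant on the whole line of each edge: two lines that are not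
    parallel meet, and parallel ones are compared through a third edge. *)
Lemma edge_poly_const_eq F (p : P2) (c : edge M -> R) :
  (forall E, E \in edgesF F -> edge_poly F E p = (c E)%:P) ->
  forall E E', E \in edgesF F -> E' \in edgesF F -> c E = c E'.
Proof.
move=> pc; have tr E E' : E \in edgesF F -> E' \in edgesF F ->
    dot (tE E') (nFE F E) != 0 -> c E = c E'.
  move=> EF E'F /(edge_lines_meet EF E'F)[s [s' e]].
  by have := evalF_param F E p s; rewrite e evalF_param !pc// !hornerC.
move=> E E' EF E'F; have [par|] := eqVneq (dot (tE E') (nFE F E)) 0; last exact: tr.
have [E2 E2F ne] := transversal_edge EF.
rewrite (tr E E2)//; apply/esym/tr => //; apply: contra_neq ne => z.
have tt : tE E' = dot (tE E') (tE E) *: tE E.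
  have := frame_decomp (tE E') (tE_unit E) (nFE_unit EF) (tE_nFE F E).
  by rewrite cross_tE_nFE// par (tE_nF E'F) !scale0r !addr0.
have nn : nFE F E' = dot (tE E') (tE E) *: nFE F E by rewrite /nFE {1}tt crossZr.
move: z; rewrite nn (dotZr (dot (tE E') (tE E))) => /eqP; rewrite mulf_eq0 => /orP[/eqP z|/eqP//].
have := tE_unit E'; rewrite {1}tt z scale0r dot0l => /eqP.
by rewrite eq_sym oner_eq0.
Qed.

(** [s] is the gradient of some phi vanishing on all edges, so phi = b psi with b the product of the
    forms of the selected edges. For mu in R^c with divergence psi, Green's formula turns
    orthogonality into the vanishing of the integral of phi psi = b psi^2. As b keeps a sign on [F],
    psi = 0. *)
Lemma serendipity_unique F (s : V2) : VPol k s ->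
  (forall E, E \in edgesF F -> tangent_poly F E s = 0) -> rotF s = 0 ->
  (forall mu, RcF (ellF B k F + 1) mu -> dotF F s mu = 0) -> s = 0.
Proof.
move=> Hs sE rs orth; have [phi0 Hphi0 sphi0] := rotfree_grad Hs rs.
have cst E : E \in edgesF F -> edge_poly F E phi0 = ((edge_poly F E phi0)`_0)%:P.
  by move=> EF; apply: deriv_eq0_const; rewrite deriv_edge_poly -sphi0 sE.
have [E0 E0B] : exists E, E \in selF B F.
  by apply/set0Pn; rewrite -card_gt0; apply: leq_trans (selF_card B F).
have E0F := fintype.subsetP (selF_sub B F) _ E0B.
pose c := (edge_poly F E0 phi0)`_0; pose phi := phi0 - mpolyC 2 c.
have Hphi : Pol (k%:Z + 1) phi by apply: PolB => //; exact: PolC.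
have gphi : grad phi = s.
  by rewrite sphi0 /phi -mpolyCN gradD gradC addr0.
have phiE E : E \in edgesF F -> edge_poly F E phi = 0.
  move=> EF; rewrite /phi -mpolyCN edge_polyD edge_polyC cst//.
  by rewrite (edge_poly_const_eq cst EF E0F) -polyCD subrr.
have [|||psi Hpsi phiE'] := @edge_polys_factor F (enum (selF B F)) _ phi _ _ Hphi.
- exact: enum_uniq.
- by move=> E; rewrite mem_enum.
- by move=> E; rewrite mem_enum => /(fintype.subsetP (selF_sub B F)); exact: phiE.
rewrite -cardE -/(ellF B k F) in Hpsi.
(* Each selected edge costs [phi], of degree k + 1, one degree: psi has degree at most [ellF], which
   is exactly what makes [mu] an admissible test field. *)
have [q Hq dq] := div_shift_surj Hpsi.
pose mu : V2 := q *: shift 0.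
have mu_Rc : RcF (ellF B k F + 1) mu by exists q => //; rewrite addrK.
have green : fint F (div (phi *: mu)) = 0.
  have g i : fint F (mderiv i ((phi *: mu) 0 i)) = 0.
    by apply: faceU_green => E EF; rewrite mxE edge_polyM phiE// mul0r.
  by rewrite div2 fintD !g addr0.
have J0 : fint F (phi * psi) = 0.
  have := orth mu mu_Rc; rewrite dotFE -gphi => o.
  have dE : div (phi *: mu) = dot (grad phi) mu + phi * psi.
    rewrite -dq /div /dot mulr_sumr -big_split; apply: eq_bigr => i _ /=.
    by rewrite [(phi *: mu) 0 i]mxE mderivM [grad phi 0 i]mxE.
  by move: green; rewrite dE fintD o add0r.
pose b := \prod_(E <- enum (selF B F)) edge_affine F E.
(* Up to the sign [sg], the product of the forms is nonnegative on [F], which lies on one side of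
   each selected edge. *)
pose sg := \prod_(E <- enum (selF B F)) - omegaFE F E.
have sgb (y : R * R) : faceU F y -> 0 <= sg * meval (coord2 y) b.
  move=> Uy; rewrite /sg /b rmorph_prod -big_split big_seq /=; apply: prodr_ge0 => E.
  by rewrite mem_enum => EB; apply: edge_affine_sign => //; exact: hF_gt0.
have sg0 : sg != 0.
  rewrite /sg prodf_seq_neq0; apply/allP => E; rewrite mem_enum => EB /=.
  have := omegaFE_sq (fintype.subsetP (selF_sub B F) _ EB).
  by apply: contra_eq_neq => /eqP; rewrite oppr_eq0 => /eqP ->; rewrite mul0r eq_sym oner_neq0.
have b0 : b != 0.
  rewrite /b prodf_seq_neq0; apply/allP => E; rewrite mem_enum => EB /=.
  by apply: affine_neq0; apply: edge_affine_unit; exact: (fintype.subsetP (selF_sub B F) _ EB).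
have z : sg *: (b * (psi * psi)) = 0.
  apply: (pint_pos0 (faceU_domain F)) => [y Uy|].
    rewrite mevalZ mevalM mulrA; apply: mulr_ge0; first exact: sgb.
    by rewrite mevalM -expr2 sqr_ge0.
  have -> : b * (psi * psi) = phi * psi by rewrite phiE' -/b mulrA.
  by rewrite -/(fint F _) fintZ J0 mulr0.
have psi0 : psi = 0.
  move/eqP: z; rewrite scaler_eq0 (negPf sg0) /= mulf_eq0 (negPf b0) /=.
  by rewrite mulf_eq0 orbb => /eqP.
by rewrite -gphi phiE' psi0 mulr0 -[0]mpolyC0 gradC.
Qed.

Lemma RcF0 (l : int) : RcF l (0 : V2).
Proof. by exists 0; [exact: Pol0|rewrite scale0r]. Qed.

Lemma xget_cases (T : choiceType) (x0 : T) (P : set T) : xget x0 P = x0 \/ P (xget x0 P).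
Proof.
have [H|H] := pselect (exists y, P y); first by right; exact: xgetPex.
by left; apply: xgetPN => y Py; apply: H; exists y.
Qed.

(** The tests (0, mu) give orthogonality; then (sigma, 0) gives the vanishing of the tangential
    components and of rot, and [serendipity_unique] applies. The second hypothesis receives the
    identity of [s] with the solution because, for the gradient, orthogonality is known of the
    solution itself and is not read on [L]. Without a solution, the default pair is 0. *)
Lemma solveF_eq0 F (L : V2 -> V2 -> R) : (forall t, VPol k t -> L t 0 = 0) ->
  (forall s, VPol k s -> (forall mu, RcF (ellF B k F + 1) mu -> dotF F s mu = L 0 mu) ->
     s = (solveF B k F L).1 -> forall mu, RcF (ellF B k F + 1) mu -> dotF F s mu = 0) ->
  (solveF B k F L).1 = 0.
Proof.
move=> Lt Hmu; have := xget_cases (0, 0) [set s : V2 * V2 | [/\ VPol k s.1, RcF (ellF B k F + 1) s.2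
    & forall t mu, VPol k t -> RcF (ellF B k F + 1) mu -> AF F s.1 s.2 t mu = L t mu]].
rewrite -/(solveF B k F L); case=> [->//|]; set s := solveF B k F L in Hmu *.
move=> [/= H1 H2 H3].
have rot0 : rotF (0 : V2) = 0 by rewrite rotFE !mxE !mderiv0 subrr.
have mu0 mu : RcF (ellF B k F + 1) mu -> dotF F s.1 mu = 0.
  apply: Hmu => // {}mu Hmu'; rewrite -(H3 0 mu (@VPol0 _ _ _) Hmu') /AF.
  rewrite rot0 prodF0r mulr0 dotF0l subr0 addr0 big1 ?mulr0 ?add0r// => E _.
  rewrite (intE_horner (p := 0)) ?edge_int0// => u.
  by rewrite dot_evalvF_edge -/(tangent_poly F E 0) dot_evalvF_edge -/(tangent_poly F E 0)
    tangent_poly0 !horner0 mulr0.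
have := H3 s.1 0 H1 (RcF0 _); rewrite (Lt _ H1) /AF dotF0r addr0 mu0// subr0.
have sumE : \sum_(E in edgesF F)
    intE E (fun x => dot (evalvF F s.1 x) (tE E) * dot (evalvF F s.1 x) (tE E)) =
    \sum_(E in edgesF F) edge_int E (tangent_poly F E s.1 * tangent_poly F E s.1).
  apply: eq_bigr => E _; apply: intE_horner => u.
  by rewrite dot_evalvF_edge -/(tangent_poly F E s.1) hornerM.
rewrite sumE.
have a0 : 0 <= \sum_(E in edgesF F) edge_int E (tangent_poly F E s.1 * tangent_poly F E s.1).
  by apply: sumr_ge0 => E _; exact: edge_sq_ge0.
have r0 : 0 <= prodF F (rotF s.1) (rotF s.1).
  by apply: Rintegral_ge0 => y _; rewrite -expr2 sqr_ge0.
have h0 := hF_gt0 F; have h20 : 0 < hF F ^+ 2 by rewrite exprn_gt0.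
move/eqP; rewrite paddr_eq0 ?mulr_ge0 ?(ltW h0) ?(ltW h20)//.
rewrite !mulf_eq0 !(gt_eqF h0) /= => /andP[sE /eqP/prodF_eq0 rs].
apply: (@serendipity_unique F) => // E EF; apply: (edge_sq_eq0 (E := E)); apply/eqP.
by move: sE; rewrite psumr_eq0 => [/allP/(_ E)|? _]; rewrite ?mem_index_enum ?EF ?edge_sq_ge0// => /(_ isT).
Qed.

End Serendipity.

(** * Discrete operators on a face *)

Section FaceOperators.
Context {R : realType} (M : mesh R) (B : selection M) (k : nat).
Implicit Types (F : face M) (E : edge M).
Local Notation P2 := (mpoly 2 R).
Local Notation V2 := 'rV[mpoly 2 R]_2.

Definition row_of_ffun n (f : {ffun 'I_n -> mpoly n R}) : 'rV[mpoly n R]_n := \row_i f i.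

Lemma div_0 : div 0 = 0 :> P2.
Proof. by rewrite div2 !mxE !mderiv0 addr0. Qed.

Lemma row_of_ffunD n (f g : {ffun 'I_n -> mpoly n R}) :
  row_of_ffun (f + g) = row_of_ffun f + row_of_ffun g.
Proof. by apply/rowP => i; rewrite !mxE ffunE. Qed.

Lemma row_of_ffunZ n c (f : {ffun 'I_n -> mpoly n R}) :
  row_of_ffun (c *: f) = mpolyC n c *: row_of_ffun f.
Proof. by apply/rowP => i; rewrite !mxE ffunE mul_mpolyC. Qed.

Lemma row_of_ffunK n (v : 'rV[mpoly n R]_n) : row_of_ffun [ffun i => v 0 i] = v.
Proof. by apply/rowP => i; rewrite mxE ffunE. Qed.

(* As 'rV[mpoly n R]_n is a module over mpoly n R, the real vector space
   structure of VPol is the one of {ffun 'I_n -> mpoly n R}. *)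
Lemma riesz_VPol n (l : int) (b : 'rV[mpoly n R]_n -> 'rV[mpoly n R]_n -> R)
    (L : 'rV[mpoly n R]_n -> R) :
  (forall u v w, b (u + v) w = b u w + b v w) ->
  (forall a u w, b (mpolyC n a *: u) w = a * b u w) ->
  (forall u w, b u w = b w u) -> (forall u, 0 <= b u u) ->
  (forall u v, L (u + v) = L u + L v) -> (forall a u, L (mpolyC n a *: u) = a * L u) ->
  (forall w, b w w = 0 -> L w = 0) ->
  exists2 g, VPol l g & forall w, VPol l w -> b g w = L w.
Proof.
move=> bD bZ bC b0 LD LZ L0; have [s sP] := @ffPol_span R n l.
have [|||||||g sg Hg] := @riesz R _ (fun f g => b (row_of_ffun f) (row_of_ffun g)) _ _ _ _
  s (L \o @row_of_ffun n).
- by move=> u v w; rewrite row_of_ffunD bD.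
- by move=> a u w; rewrite row_of_ffunZ bZ.
- by move=> u w; exact: bC.
- by move=> u; exact: b0.
- by move=> u v; rewrite /= row_of_ffunD LD.
- by move=> a u; rewrite /= row_of_ffunZ LZ.
- by move=> w _; exact: L0.
exists (row_of_ffun g); first by move=> i; rewrite mxE; move/sP: sg; exact.
move=> w Hw; rewrite -[w]row_of_ffunK; apply: Hg; apply/sP => i.
by rewrite ffunE; exact: Hw.
Qed.

Lemma riesz_Pol (l : int) (b : P2 -> P2 -> R) (L : P2 -> R) :
  (forall u v w, b (u + v) w = b u w + b v w) ->
  (forall a u w, b (a *: u) w = a * b u w) ->
  (forall u w, b u w = b w u) -> (forall u, 0 <= b u u) ->
  (forall u v, L (u + v) = L u + L v) -> (forall a u, L (a *: u) = a * L u) ->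
  (forall w, b w w = 0 -> L w = 0) ->
  exists2 g, Pol l g & forall w, Pol l w -> b g w = L w.
Proof.
move=> bD bZ bC b0 LD LZ L0; have [s sP] := @Pol_span R 2 l.
have [|g sg Hg] := @riesz R _ b bD bZ bC b0 s L LD LZ; first by move=> w _; exact: L0.
by exists g => [|w /sP]; [exact/sP|exact: Hg].
Qed.

Lemma shift_scaleD (p q : P2) : (p + q) *: shift 0 = p *: shift 0 + q *: shift 0 :> V2.
Proof. exact: scalerDl. Qed.

Lemma shift_scaleZ a (p : P2) : (a *: p) *: shift 0 = mpolyC 2 a *: (p *: shift 0) :> V2.
Proof. by rewrite scalerA mul_mpolyC. Qed.

Lemma riesz_RcF F (l : int) (L : V2 -> R) :
  (forall u v, L (u + v) = L u + L v) -> (forall a u, L (mpolyC 2 a *: u) = a * L u) ->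
  exists2 g, RcF l g & forall w, RcF l w -> dotF F g w = L w.
Proof.
move=> LD LZ; have L0 : L 0 = 0 by rewrite -(scale0r 0) -mpolyC0 LZ mul0r.
have [|||||||p Hp Hg] := @riesz_Pol (l - 1) (fun p q => dotF F (p *: shift 0) (q *: shift 0))
  (fun p => L (p *: shift 0)).
- by move=> u v w; rewrite shift_scaleD dotFDl.
- by move=> a u w; rewrite shift_scaleZ dotFZl.
- by move=> u w; rewrite dotFC.
- by move=> u; exact: dotF_ge0.
- by move=> u v; rewrite shift_scaleD LD.
- by move=> a u; rewrite shift_scaleZ LZ.
- by move=> w /dotF_eq0 ->.
by exists (p *: shift 0) => [|_ [q Hq <-]]; [exists p|exact: Hg].
Qed.

(** The divergence is injective on R^c, so the form (div ., div .) is definite there, and [g] is the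
    divergence of a Riesz representative. *)
Lemma riesz_divF F (l : int) (L : V2 -> R) :
  (forall u v, L (u + v) = L u + L v) -> (forall a u, L (mpolyC 2 a *: u) = a * L u) ->
  exists2 g, Pol l g & forall w, RcF (l + 1) w -> prodF F g (div w) = L w.
Proof.
move=> LD LZ; have L0 : L 0 = 0 by rewrite -(scale0r 0) -mpolyC0 LZ mul0r.
have [|||||||p Hp Hg] := @riesz_Pol l
   (fun p q => prodF F (div (p *: shift 0)) (div (q *: shift 0))) (fun p => L (p *: shift 0)).
- by move=> u v w; rewrite shift_scaleD divD !prodFE mulrDl fintD.
- by move=> a u w; rewrite shift_scaleZ divZ !prodFE -scalerAl fintZ.
- by move=> u w; rewrite !prodFE mulrC.
- by move=> u; apply: Rintegral_ge0 => y _; rewrite -expr2 sqr_ge0.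
- by move=> u v; rewrite shift_scaleD LD.
- by move=> a u; rewrite shift_scaleZ LZ.
- by move=> w /prodF_eq0/div_shift_eq0 ->; rewrite scale0r.
exists (div (p *: shift 0)) => [|_ [q Hq <-]]; last by apply: Hg; rewrite addrK in Hq.
have := @Pol_div R 2 (l + 1) (p *: shift 0); rewrite addrK; apply.
by apply: VPolZ => //; exact: VPol_shift.
Qed.

Lemma GFkP F (q : @XgradF R M) : VPol k (GFk k F q) /\ forall v, VPol k v ->
  dotF F (GFk k F q) v = - prodF F (gF q) (div v) + bflux F (gFE q) v.
Proof.
rewrite /GFk; set S := [set g | _].
have [|||||||g Hg Eg] := @riesz_VPol 2 k (dotF F) (fun v => - prodF F (gF q) (div v) + bflux F (gFE q) v).
- by move=> *; exact: dotFDl.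
- by move=> *; exact: dotFZl.
- by move=> *; exact: dotFC.
- by move=> *; exact: dotF_ge0.
- by move=> u v; rewrite divD prodFDr bfluxD; ring.
- by move=> a u; rewrite divZ prodFZr bfluxZ; ring.
- by move=> w /dotF_eq0 ->; rewrite bflux0 div_0 prodF0r oppr0 addr0.
by have : S (xget 0 S) by apply: xgetPex; exists g.
Qed.

(** [gammaF] and [eF] are instances. Their equations are used to compute, so a solution has to exist
    behind [xget]. *)
Lemma prodF_div_xget F (l l1 : int) (L : V2 -> R) : l1 = l + 1 ->
  (forall u v, L (u + v) = L u + L v) -> (forall a u, L (mpolyC 2 a *: u) = a * L u) ->
  let S := [set g | Pol l g /\ forall v, RcF l1 v -> prodF F g (div v) = L v] in
  S (xget 0 S).
Proof.
move=> -> LD LZ S; have [g Hg Eg] := riesz_divF F l LD LZ.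
by apply: xgetPex; exists g.
Qed.

Lemma gammaFP F (q : @XgradF R M) v : RcF (k%:Z + 2) v ->
  prodF F (gammaF k F q) (div v) = - dotF F (GFk k F q) v + bflux F (gFE q) v.
Proof.
have [|||_ H] := @prodF_div_xget F (k%:Z + 1) (k%:Z + 2)
  (fun v => - dotF F (GFk k F q) v + bflux F (gFE q) v) _.
- by rewrite -addrA.
- by move=> u w; rewrite dotFDr bfluxD; ring.
- by move=> a u; rewrite dotFZr bfluxZ; ring.
exact: H.
Qed.

Lemma eFP F (q : @XgradF R M) w : RcF k w ->
  prodF F (eF B k F q) (div w) = - dotF F (SgradF B k F q) w + bflux F (gFE q) w.
Proof.
have [|||_ H] := @prodF_div_xget F (k%:Z - 1) k
  (fun v => - dotF F (SgradF B k F q) v + bflux F (gFE q) v) _.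
- by rewrite subrK.
- by move=> u v; rewrite dotFDr bfluxD; ring.
- by move=> a u; rewrite dotFZr bfluxZ; ring.
exact: H.
Qed.

Lemma projF_RcP F (l : int) (v : V2) w : RcF l w ->
  dotF F (projF F (RcF l) v) w = dotF F v w.
Proof.
rewrite /projF; set S := [set p | _] => Hw.
have [||g Hg Eg] := @riesz_RcF F l (dotF F v).
- by move=> *; exact: dotFDr.
- by move=> *; exact: dotFZr.
have [_ H] : S (xget 0 S) by apply: xgetPex; exists g.
exact: H.
Qed.

(** Existence of the projection is not at stake: the default value of [xget] is 0 as well. The same
    alternative recurs for the other operators that have to vanish. *)
Lemma projF_eq0 F (X : set V2) (v : V2) : (forall w, X w -> dotF F v w = 0) -> projF F X v = 0.
Proof.
move=> H; rewrite /projF; set S := [set p | _].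
have [//|[XS ES]] := xget_cases 0 S.
by apply: dotF_eq0 (F) _ _; rewrite ES// H.
Qed.

Lemma CFk_eq0 F (v : @XcurlF R M) : cRF v = 0 -> (forall E, E \in edgesF F -> cFE v E = 0) ->
  CFk k F v = 0.
Proof.
move=> v0 vE; rewrite /CFk; set S := [set p | _].
have [//|[XS ES]] := xget_cases 0 S.
by apply: (prodF_eq0 (F := F)); rewrite ES// v0 dotF0l bcirc_eq0// subrr.
Qed.

Lemma gammatF_eq0 F (v : @XcurlF R M) : cRF v = 0 -> cRcF v = 0 ->
  (forall E, E \in edgesF F -> cFE v E = 0) -> gammatF k F v = 0.
Proof.
move=> v0 vc vE; rewrite /gammatF; set S := [set p | _].
have [//|[XS ES]] := xget_cases 0 S.
apply: (dotF_eq0 (F := F)); have [r [q [Hr Hq e]]] := vrotF_shift_decomp XS.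
have one : fint F 1 != 0 by rewrite gt_eqF// (pint1_gt0 (faceU_domain F)).
(* The test functions r have zero average; subtracting the average does not change vrotF r, so the
   value of [gammatF] can be tested with itself. *)
pose r0 := r - mpolyC 2 (fint F r / fint F 1).
have e' : xget 0 S = vrotF r0 + q *: shift 0.
  by rewrite {1}e /r0 -mpolyCN vrotFD vrotFC addr0.
rewrite {2}e' ES.
- by rewrite vc dotF0l CFk_eq0// prodF0l bcirc_eq0// !addr0.
- by apply: PolB => //; exact: PolC.
- rewrite intF_eval /r0 fintD fintN -[mpolyC _ _]mulr1 mul_mpolyC fintZ divfK// subrr //.
- by exists q.
Qed.

Lemma ScurlF_eq0 F (v : @XcurlF R M) : cRF v = 0 -> cRcF v = 0 ->
  (forall E, E \in edgesF F -> cFE v E = 0) -> ScurlF B k F v = 0.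
Proof.
move=> v0 vc vE; apply: solveF_eq0.
  move=> t Ht; rewrite v0 vc !dotF0l bcirc_eq0// subrr mulr0 !addr0 big1 ?mulr0// => E EF.
  rewrite (intE_horner (p := 0)) ?edge_int0// => s.
  by rewrite vE// evalE_param !horner0 mul0r.
move=> s _ Hs _ mu Hmu; rewrite Hs// v0 vc !dotF0l bcirc_eq0// subrr mulr0 !addr0.
rewrite big1 ?mulr0// => E EF; rewrite (intE_horner (p := 0)) ?edge_int0// => u.
by rewrite vE// evalE_param !horner0 mul0r.
Qed.

Lemma gammat_EcurlF_eq0 F (v : @XcurlF R M) : cRF v = 0 -> cRcF v = 0 ->
  (forall E, E \in edgesF F -> cFE v E = 0) -> gammatF k F (EcurlF B k F v) = 0.
Proof.
move=> v0 vc vE; apply: gammatF_eq0 => //=; apply: projF_eq0 => w _.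
by rewrite ScurlF_eq0// dotF0l.
Qed.

Lemma RcF_le (l l' : int) (w : V2) : l <= l' -> RcF l w -> RcF l' w.
Proof. by move=> ll [p Hp <-]; exists p => //; apply: Pol_le Hp; rewrite lerD2r. Qed.

Lemma VPol_RcF (l : int) (w : V2) : RcF l w -> VPol l w.
Proof.
by case=> p Hp <-; have := VPolZ Hp (@VPol_shift R 2 0); rewrite subrK.
Qed.

Lemma ellF_le F : ellF B k F + 1 <= k%:Z.
Proof. by rewrite /ellF; have := selF_card B F; lia. Qed.

(** n_FE is t_E turned by pi/2 and [perp] turns by -pi/2: the angle between the two rotations is a
    half turn, hence the sign. *)
Lemma normal_poly_perp F E (z : V2) : normal_poly F E (perp z) = - tangent_poly F E z.
Proof.
rewrite /normal_poly /tangent_poly !sum2 ![perp z 0 _]mxE /=.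
have t0 : dot (tau F 0) (nFE F E) = - dot (tau F 1) (tE E).
  rewrite /nFE -dot_crossC /nF cross_cross tau_ortho tau_unit scale0r scale1r sub0r.
  by rewrite dotNl.
have t1 : dot (tau F 1) (nFE F E) = dot (tau F 0) (tE E).
  rewrite /nFE -dot_crossC /nF cross_cross (dotC (tau F 1)) tau_ortho tau_unit scale0r scale1r.
  by rewrite subr0.
have -> : edge_poly F E (- z 0 0) = - edge_poly F E (z 0 0) by exact: (rmorphN (mmap _ _)).
by rewrite t0 t1 scalerN scaleNr opprD addrC.
Qed.

(** The normal component of vrotF r on an edge is minus the tangential derivative of r, so each edge
    contributes end values of r. The constants may differ between edges that are not connected to
    each other; the sum is regrouped by vertices, where [vertex_sum] applies. *)
Lemma bflux_vrotF F (q : edge M -> {poly R}) (c : edge M -> R) (phi : vert M -> R) r :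
  (forall E, E \in edgesF F -> q E = (c E)%:P) ->
  (forall E, E \in edgesF F -> phi (src E) = c E /\ phi (tgt E) = c E) ->
  bflux F q (vrotF r) = 0.
Proof.
move=> qc phic; rewrite bfluxE; pose rV (V : vert M) := evalF F r (vpos V).
have -> : \sum_(E in edgesF F) omegaFE F E * edge_int E (q E * normal_poly F E (vrotF r)) =
    \sum_(E in edgesF F) \sum_V - (phi V * rV V) *
      (omegaFE F E * ((tgt E == V)%:R - (src E == V)%:R)).
  apply: eq_bigr => E EF; have [p1 p2] := phic E EF.
  rewrite qc// mul_polyC /vrotF normal_poly_perp -deriv_edge_poly scalerN -scaleNr edge_intZ.
  rewrite edge_int_deriv -!evalF_param param_src param_tgt -/(rV _) -/(rV _).
  under eq_bigr do rewrite mulrCA mulrBr.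
  rewrite -mulr_sumr sumrB; congr (_ * _).
  have pick V0 : \sum_V - (phi V * rV V) * (V0 == V)%:R = - (phi V0 * rV V0).
    rewrite (bigD1 V0) //= eqxx mulr1 big1 ?addr0// => V /negPf ne.
    by rewrite eq_sym ne mulr0.
  by rewrite !pick p1 p2; ring.
rewrite exchange_big big1 //= => V _.
by rewrite -mulr_sumr vertex_sum mulr0.
Qed.

(* Uniqueness in the serendipity problem gives [SgradF B k F q = 0]; then the
   gradient is orthogonal to [RcF k], and to the [vrotF r] by [qrot]. *)
Lemma face_gradient_eq0 F (q : @XgradF R M) :
  (forall E, E \in edgesF F -> (gFE q E)^`() = 0) ->
  (forall r, bflux F (gFE q) (vrotF r) = 0) ->
  projF F (RcF (ellF B k F + 1)) (projF F (RcF k) (GFk k F (EgradF B k F q))) = 0 ->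
  GFk k F (EgradF B k F q) = 0.
Proof.
move=> q' qrot pG; have [HG EG] := GFkP F (EgradF B k F q); set G := GFk k F _ in HG EG pG *.
have orth mu : RcF (ellF B k F + 1) mu -> dotF F (SgradF B k F q) mu = 0.
  move=> Hmu; have Hk := RcF_le (ellF_le F) Hmu.
  have VPk := VPol_RcF Hk.
  have : dotF F G mu = 0 by rewrite -(projF_RcP F G Hk) -(projF_RcP F _ Hmu) pG dotF0l.
  by rewrite EG//= eFP//; lra.
have S0 : SgradF B k F q = 0.
  apply: solveF_eq0.
    move=> t Ht; rewrite bflux0 div_0 prodF0r subr0 addr0.
    rewrite big1 ?mulr0// => E EF; rewrite (intE_horner (p := 0)) ?edge_int0// => s.
    by rewrite q'// evalE_param !horner0 mul0r.
  by move=> s _ _ -> mu; exact: orth.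
have Rc0 w : RcF k w -> dotF F G w = 0.
  move=> Hw; have VPk := VPol_RcF Hw.
  by rewrite EG//= eFP// S0 dotF0l; ring.
have [r [p [Hr Hp e]]] := vrotF_shift_decomp HG.
apply: (dotF_eq0 (F := F)); rewrite {2}e dotFDr [X in _ + X]Rc0; last by exists p.
rewrite addr0 EG; last first.
  have -> : vrotF r = G - p *: shift 0 by rewrite e addrK.
  by apply: VPolD => //; apply/VPolN/VPol_RcF; exists p.
by rewrite /= div_vrotF prodF0r oppr0 add0r qrot.
Qed.

End FaceOperators.

(** * Elements *)

Section ElementIntegrals.
Context {R : realType} (M : mesh R) (B : selection M) (k : nat).
Implicit Types (T : elt M) (F : face M) (E : edge M) (x : 'rV[R]_3).
Local Notation leb := (@lebesgue_measure R).
Local Notation P3 := (mpoly 3 R).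
Local Notation V3 := 'rV[mpoly 3 R]_3.
Local Notation P2 := (mpoly 2 R).
Local Notation V2 := 'rV[mpoly 2 R]_2.

Definition eltU T : set (R * R * R) := @pt3 R @^-1` eltS T.
Definition tint T (p : P3) : R :=
  pint ((leb \x leb) \x leb)%E (eltU T) (fun y i => pt3 y 0 i) p.

Lemma eltU_domain T : poly_domain ((leb \x leb) \x leb)%E (eltU T) (fun y i => pt3 y 0 i).
Proof. by have [U0 oU bU _ _] := elt_region T; exact: poly_domain3. Qed.

Lemma dot_evalv n (u v : 'rV[mpoly n R]_n) (x : 'rV[R]_n) :
  dot (evalv u x) (evalv v x) = meval (fun i => x 0 i) (dot u v).
Proof. by rewrite /dot raddf_sum; apply: eq_bigr => i _ /=; rewrite !mxE mevalM. Qed.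

Lemma dotTE T (u v : V3) : dotT T u v = tint T (dot u v).
Proof. by apply: eq_Rintegral => y _; rewrite dot_evalv. Qed.

Lemma dotTDl T (u v w : V3) : dotT T (u + v) w = dotT T u w + dotT T v w.
Proof. by rewrite !dotTE dotDl /tint (pintD (eltU_domain T)). Qed.
Lemma dotTC T (u v : V3) : dotT T u v = dotT T v u.
Proof. by rewrite !dotTE dotC. Qed.
Lemma dotTZl T c (u w : V3) : dotT T (mpolyC 3 c *: u) w = c * dotT T u w.
Proof. by rewrite !dotTE dotZl mul_mpolyC /tint (pintZ (eltU_domain T)). Qed.
Lemma dotT0l T (u : V3) : dotT T 0 u = 0.
Proof. by rewrite dotTE dot0l /tint (pint0 (eltU_domain T)). Qed.
Lemma dotT0r T (u : V3) : dotT T u 0 = 0.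
Proof. by rewrite dotTC dotT0l. Qed.
Lemma dotT_ge0 T (u : V3) : 0 <= dotT T u u.
Proof. by apply: Rintegral_ge0 => y _; exact: dot_ge0. Qed.

Lemma dotT_eq0 T (u : V3) : dotT T u u = 0 -> u = 0.
Proof.
have dom := eltU_domain T; rewrite dotTE => H.
have sq_ge0 j : 0 <= tint T (u 0 j * u 0 j).
  by apply: Rintegral_ge0 => y _; rewrite mevalM -expr2 sqr_ge0.
have : \sum_j tint T (u 0 j * u 0 j) = 0 by apply: etrans H; exact: (esym (pint_sum dom (index_enum _) xpredT (fun j => u 0 j * u 0 j))).
move=> /eqP; rewrite psumr_eq0 => [/allP H0|? _]; last exact: sq_ge0.
apply/rowP => i; rewrite mxE; apply: (pint_sq0 dom); apply/eqP.
by apply: H0; rewrite mem_index_enum.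
Qed.

Lemma prodT0r T (p : P3) : prodT T p 0 = 0.
Proof.
rewrite -[RHS](pint0 (eltU_domain T)); apply: eq_Rintegral => y _.
by rewrite /evalT meval0 mulr0.
Qed.

Lemma projT_perp T (X : set V3) (v w : V3) : X w -> dotT T v w = 0 ->
  dotT T (projT T X v) w = 0.
Proof.
move=> Xw vw; rewrite /projT; set S := [set p | _].
by have [->|[_ ->]] := xget_cases 0 S; rewrite ?dotT0l.
Qed.

Lemma projT_eq0 T (X : set V3) (v : V3) : (forall w, X w -> dotT T v w = 0) ->
  projT T X v = 0.
Proof.
move=> H; rewrite /projT; set S := [set p | _].
have [//|[XS ES]] := xget_cases 0 S.
by apply: dotT_eq0 (T) _ _; rewrite ES// H.
Qed.

(* Removing from the top degree field of [curl_cross_top] its projection for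
   the semi-inner product (curl ((x - x_T) x .), curl ((x - x_T) x .)). *)
Lemma orthogonal_curl T : (0 < k)%N -> exists p : V3,
  [/\ VPol (k%:Z - 1) p, curl (cross (shift (xT T)) p) != 0
    & forall q, VPol (k%:Z - 2) q ->
        dotT T (curl (cross (shift (xT T)) p)) (curl (cross (shift (xT T)) q)) = 0].
Proof.
case: k => // l _; pose C (p : V3) := curl (cross (shift (xT T)) p).
have CD p q : C (p + q) = C p + C q by rewrite /C crossDr curlD.
have CZ a p : C (mpolyC 3 a *: p) = mpolyC 3 a *: C p by rewrite /C crossZr curlZ.
(* Here l = k - 1: [t] has degree exactly k - 1, and the correction found next has degree at most k
   - 2. *)
pose t : V3 := \row_i if i == 1 then shift (xT T) 0 0 ^+ l else 0.
have [|||||||p Hp Ep] := @riesz_VPol R 3 (l%:Z - 1) (fun p q => dotT T (C p) (C q))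
  (fun q => - dotT T (C q) (C t)).
- by move=> u v w; rewrite CD dotTDl.
- by move=> a u w; rewrite CZ dotTZl.
- by move=> u w; exact: dotTC.
- by move=> u; exact: dotT_ge0.
- by move=> u v; rewrite CD dotTDl opprD.
- by move=> a u; rewrite CZ dotTZl mulrN.
- by move=> w /dotT_eq0 ->; rewrite dotT0l oppr0.
exists (t + p); split.
- apply: VPolD; last by apply: VPol_le Hp; lia.
  move=> i; rewrite mxE; case: ifP => _; last exact: Pol0.
  by apply: (PolXn (@VPol_shift R 3 (xT T) 0)); lia.
- exact: curl_cross_top.
- move=> q Hq; rewrite -/(C _) -/(C q) CD dotTDl Ep.
    by rewrite (dotTC _ (C q)) subrr.
  by apply: VPol_le Hq; lia.
Qed.

Definition pull F (p : P3) : P2 :=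
  mmap (@mpolyC 2 R) (fun i => affine (xF F 0 i) (\row_j tau F j 0 i)) p.

Lemma evalF_pull F p (y : R * R) : evalF F (pull F p) (chart F y) = evalT p (chart F y).
Proof.
rewrite evalF_chart /evalT; elim/mpoly_ring_ind: p => [c|i|p q Hp Hq|p q Hp Hq].
- by rewrite /pull mmapC !mevalC.
- rewrite /pull mmapX mmap1U mevalXU meval_affine sum2 !mxE /coord2 /=; ring.
- by rewrite /pull mmapD !mevalD -!/(pull F _) Hp Hq.
- by rewrite /pull (rmorphM (mmap _ _)) !mevalM -!/(pull F _) Hp Hq.
Qed.

Lemma pullD F p q : pull F (p + q) = pull F p + pull F q.
Proof. exact: mmapD. Qed.
Lemma pullN F p : pull F (- p) = - pull F p.
Proof. exact: (rmorphN (mmap _ _)). Qed.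

Lemma Pol_pull F (l : int) p : Pol l p -> Pol l (pull F p).
Proof. by apply: Pol_mmap => i; exact: Pol_affine. Qed.

Lemma mderiv_pull F j p :
  mderiv j (pull F p) = \sum_i tau F j 0 i *: pull F (mderiv i p).
Proof.
rewrite /pull (@mmap_derivation _ _ _ (@mpolyC 2 R) _ (mderiv j)).
- apply: eq_bigr => i _; rewrite /affine mderivD mderivC add0r linear_sum /=.
  rewrite (bigD1 j) //= big1 => [|l lj]; rewrite mderivZ mderivXU.
    by rewrite eqxx addr0 mxE -scalerAl mul1r.
  by rewrite eq_sym (negPf lj) scaler0.
- by move=> ? ?; rewrite mderivD.
- by move=> ? ?; rewrite mderivM.
- by move=> c; rewrite mderivC.
Qed.

(* components of the tangential trace of w in the frame (tau F 0, tau F 1) *)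
Definition ftrace F (w : V3) : V2 := \row_j \sum_i tau F j 0 i *: pull F (w 0 i).

Lemma VPol_ftrace F (l : int) w : VPol l w -> VPol l (ftrace F w).
Proof. by move=> Hw j; rewrite mxE; apply: Pol_sum => i _; apply/PolZ/Pol_pull. Qed.

(** By the chain rule the left side is an antisymmetric expression in the two vectors of the frame,
    hence depends on them through their cross product n_F only. *)
Lemma rotF_ftrace F w : rotF (ftrace F w) = \sum_i nF F 0 i *: pull F (curl w 0 i).
Proof.
rewrite rotFE !mxE !sum3 !mderivD !mderivZ !mderiv_pull !sum3.
rewrite !curlE /nF !crossE !pullD !pullN -!mul_mpolyC !mpolyCB !mpolyCM.
ring.
Qed.

Lemma intF_curl F g w :
  intF F (fun x => evalF F g x * dot (evalv (curl w) x) (nF F)) =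
  prodF F g (rotF (ftrace F w)).
Proof.
apply: eq_intF => y; congr (_ * _); rewrite rotF_ftrace sum3 !evalFD !evalFZ !evalF_pull.
by rewrite dot3 ![evalv _ _ 0 _]mxE /evalT; ring.
Qed.

Lemma edge_int_ftrace F E w : E \in edgesF F ->
  edge_int E (tangent_poly F E (ftrace F w)) = intE E (fun x => dot (evalv w x) (tE E)).
Proof.
move=> EF; apply/esym/intE_horner => s; rewrite -dot_evalvF_edge.
rewrite -(chart_plane (edge_in_plane s EF)); set y := (_, _); rewrite /evalvF sum2 dotDl !dotZl.
have ev j : evalF F (ftrace F w 0 j) (chart F y) = dot (evalv w (chart F y)) (tau F j).
  rewrite mxE sum3 !evalFD !evalFZ !evalF_pull dot3 ![evalv _ _ 0 _]mxE /evalT; ring.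
by rewrite !ev (tE_expand _ EF) !(dotC (tE E)); ring.
Qed.

(** Only the R^c part of [perp z] has a divergence; on it the equation of gamma_F integrates by
    parts, and as G_F = 0 only edge terms remain. [qrot] restores the other part of [perp z], whose
    normal component is minus the tangential component of [z]. *)
Lemma gammaF_rotF F (q : @XgradF R M) (c : edge M -> R) z : VPol k z ->
  GFk k F q = 0 -> (forall E, E \in edgesF F -> gFE q E = (c E)%:P) ->
  (forall r, bflux F (gFE q) (vrotF r) = 0) ->
  prodF F (gammaF k F q) (rotF z) =
  - \sum_(E in edgesF F) omegaFE F E * (c E * edge_int E (tangent_poly F E z)).
Proof.
move=> Hz G0 qc qrot.
have Hp : VPol k (perp z).
  by move=> i; rewrite mxE; case: ifP => _; [|apply: PolN]; exact: Hz.
have [r [p [Hr Hpp e]]] := vrotF_shift_decomp Hp.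
rewrite /rotF e divD div_vrotF add0r gammaFP; last first.
  by apply: (@RcF_le _ k%:Z); [lia|exists p].
have -> : bflux F (gFE q) (p *: shift 0) = bflux F (gFE q) (perp z).
  by rewrite e bfluxD qrot add0r.
rewrite G0 dotF0l oppr0 add0r bfluxE -sumrN.
apply: eq_bigr => E EF; rewrite qc// mul_polyC edge_intZ normal_poly_perp.
by rewrite -scaleN1r edge_intZ; ring.
Qed.

(* Stokes on the boundary of T for a function whose values on the edges are
   the constants c E: each edge is met twice, with opposite signs. *)
Lemma gamma_curl_flux T (q : face M -> @XgradF R M) (c : edge M -> R) w : VPol k w ->
  (forall F, F \in facesT T -> GFk k F (q F) = 0) ->
  (forall F E, F \in facesT T -> E \in edgesF F -> gFE (q F) E = (c E)%:P) ->
  (forall F r, F \in facesT T -> bflux F (gFE (q F)) (vrotF r) = 0) ->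
  \sum_(F in facesT T) omegaTF T F *
    intF F (fun x => evalF F (gammaF k F (q F)) x * dot (evalv (curl w) x) (nF F)) = 0.
Proof.
move=> Hw G0 qc qrot; pose i E := intE E (fun x => dot (evalv w x) (tE E)).
transitivity (- \sum_(F in facesT T) \sum_(E in edgesF F)
   c E * i E * (omegaTF T F * omegaFE F E)).
  rewrite -sumrN; apply: eq_bigr => F FT; rewrite intF_curl (gammaF_rotF (c := c)).
  - rewrite mulrN mulr_sumr; congr (- _); apply: eq_bigr => E EF.
    by rewrite edge_int_ftrace// -/(i E); ring.
  - exact: VPol_ftrace.
  - exact: G0.
  - by move=> E; exact: qc.
  - by move=> r; exact: qrot.
rewrite (exchange_big_dep xpredT) //= big1 ?oppr0// => E _.
by rewrite -mulr_sumr edge_sum mulr0.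
Qed.

Lemma tflux_eq0 T (g : face M -> V2) w : (forall F, F \in facesT T -> g F = 0) ->
  tflux T g w = 0.
Proof.
move=> g0; apply: big1 => F FT; rewrite g0//.
have -> : intF F (fun x => dot (evalvF F 0 x) (cross (evalv w x) (nF F))) = intF F (evalF F 0).
  apply: eq_intF => y; rewrite evalF0 /evalvF big1 ?dot0l// => i _.
  by rewrite mxE evalF0 scale0r.
by rewrite intF_eval fint0 mulr0.
Qed.

Lemma CTk_perp T (v : @XcurlT R M) w : VPol k w ->
  (forall F, F \in facesT T -> gammatF k F (curlT_restr v F) = 0) ->
  dotT T (cRT v) (curl w) = 0 -> dotT T (CTk k T v) w = 0.
Proof.
move=> Hw g0 vw; rewrite /CTk; set S := [set p | _].
have [->|[_ ->//]] := xget_cases 0 S; first by rewrite dotT0l.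
by rewrite vw tflux_eq0 ?addr0.
Qed.

Lemma GTk_perp T (q : @XgradT R M) v : VPol k v -> div v = 0 ->
  \sum_(F in facesT T) omegaTF T F *
    intF F (fun x => evalF F (gammaF k F (gradT_restr q F)) x * dot (evalv v x) (nF F)) = 0 ->
  dotT T (GTk k T q) v = 0.
Proof.
move=> Hv dv fl; rewrite /GTk; set S := [set p | _].
have [->|[_ ->//]] := xget_cases 0 S; first by rewrite dotT0l.
by rewrite fl dv prodT0r oppr0 addr0.
Qed.

Lemma GcT_le T (l l' : int) w : l <= l' -> GcT T l w -> GcT T l' w.
Proof. by move=> ll [p Hp <-]; exists p => //; apply: VPol_le Hp; rewrite lerD2r. Qed.

Lemma VPol_GcT T (l : int) w : GcT T l w -> VPol l w.
Proof.
by case=> p Hp <-; have := @VPol_cross R 1 (l - 1) _ _ (@VPol_shift R 3 (xT T)) Hp; rewrite addrC subrK.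
Qed.

(** Continuity on the skeleton supplies the vertex values [phi], shared by all the edges that end at
    a vertex. *)
Lemma Pc_edges_const T (q : edge M -> {poly R}) : Pc_edges k T q ->
  (forall E, E \in edgesT T -> (q E)^`() = 0) ->
  exists (c : edge M -> R) (phi : vert M -> R), forall E, E \in edgesT T ->
    [/\ q E = (c E)%:P, phi (src E) = c E & phi (tgt E) = c E].
Proof.
move=> [_ [phi [_ phiE]]] dq; exists (fun E => (q E)`_0), (fun V => phi (vpos V)) => E ET.
have qE := deriv_eq0_const (dq E ET).
have h0 := ltW (hE_gt0 E).
have ev s : 0 <= s <= hE E -> phi (param E s) = (q E)`_0.
  move=> sE; rewrite (phiE E ET); last by apply/closure_edgeP; exists s.
  by rewrite evalE_param [in LHS]qE hornerC.
by split => //; rewrite -?param_src -?param_tgt ev ?lexx ?h0.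
Qed.

Lemma edgesF_T T F E : F \in facesT T -> E \in edgesF F -> E \in edgesT T.
Proof. by move=> FT EF; apply/bigcupP; exists F. Qed.

End ElementIntegrals.

(** * A field of the kernel that is not in the image *)

Theorem mainTheorem10 (R : realType) (M : mesh R) (B : selection M)
    (k : nat) (T : elt M) (m : int) :
  (0 < k)%N -> m < k%:Z - 1 ->
  ~ (ker_hatC B k T m `<=` im_hatG B k T).
Proof.
move=> k0 mk; have [p [Hp C0 Cperp]] := @orthogonal_curl R M k T k0.
pose w0 := cross (shift (xT T)) p; have w0G : GcT T k w0 by exists p.
have w0V := VPol_GcT w0G; pose vR := curl w0.
(* The bound on [m] matters here: the fields of G^c of index m + 1 come from polynomials of degree m
   <= k - 2. *)
have w0perp w : GcT T (m + 1) w -> dotT T vR (curl w) = 0.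
  by case=> q Hq <-; apply: Cperp; apply: VPol_le Hq; lia.
have vRR : RT (k%:Z - 1) vR by exists w0 => //; rewrite subrK.
pose v : @XcurlT R M := MkXcurlT vR 0 (fun=> 0) (fun=> 0) (fun=> 0).
move=> /(_ v) H; have kerv : ker_hatC B k T m v.
  split.
    split=> //=; first by exists 0; rewrite ?scale0r//; exact: Pol0.
      move=> F FT; split; last exact: RcF0.
      by exists 0; [exact: Pol0|rewrite -mpolyC0 vrotFC].
    by move=> E _; rewrite size_poly0.
  have gam F : F \in facesT T -> gammatF k F (curlT_restr (EcurlT B k T v) F) = 0.
    by move=> _; apply: (@gammat_EcurlF_eq0 R M B k F (curlT_restr v F)).
  have Cw w : VPol k w -> dotT T vR (curl w) = 0 ->
      dotT T (CTk k T (EcurlT B k T v)) w = 0.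
    by move=> Hw vw; apply: CTk_perp.
  split=> /=.
  - apply: projT_eq0 => _ [r Hr <-]; apply: Cw; last by rewrite curl_grad dotT0r.
    by move=> i; rewrite mxE; have := Pol_mderiv (i := i) Hr; rewrite subrK; apply: Pol_le; lia.
  (* The component to be projected on G^c of index m + 1 is itself a projection on the larger G^c of
     index k, so orthogonality passes through both. *)
  - apply: projT_eq0 => w Hw; have Hw' : GcT T k w by apply: GcT_le Hw; lia.
    by apply: projT_perp => //; apply: Cw; [exact: VPol_GcT Hw'|exact: w0perp].
  - by move=> F FT; apply: CFk_eq0.
have [q [_ _ Hq] [/= eR _ eF eE]] := H kerv.
have dq E : E \in edgesT T -> (gTE q E)^`() = 0 by move=> /eE.
have [c [phi cE]] := Pc_edges_const Hq dq.
have rot0 F r : F \in facesT T -> bflux F (gTE q) (vrotF r) = 0.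
  move=> FT; apply: (@bflux_vrotF _ _ F (gTE q) c phi).
    by move=> E EF; have [] := cE E (edgesF_T FT EF).
  by move=> E EF; have [] := cE E (edgesF_T FT EF).
have G0 F : F \in facesT T -> GFk k F (EgradF B k F (gradT_restr q F)) = 0.
  (* The zero complement component of [v] on [F] gives the orthogonality that uniqueness in the
     serendipity problem requires. *)
  move=> FT; apply: face_gradient_eq0; last by have [_ <-] := eF F FT.
    by move=> E EF; apply: dq; exact: edgesF_T EF.
  by move=> r; exact: rot0.
have P0 F X : F \in facesT T -> projF F X (GFk k F (gradT_restr (EgradT B k T q) F)) = 0.
  by move=> FT; apply: projF_eq0 => w _; rewrite G0// dotF0l.
(* The square norm of v_R is computed by the equation of r_T, in which w0 is admissible as a field
   of G^c of index k. *)
case/eqP: C0; apply: (@dotT_eq0 _ _ T); rewrite -/w0 -/vR {1}eR /rT.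
set S := [set r | _]; have [->|[_ ->//]] := xget_cases 0 S; first by rewrite dotT0l.
rewrite tflux_eq0 => [|F FT]; last first.
  apply: gammat_EcurlF_eq0 => [||E EF] /=; first exact: P0.
    by apply: projF_eq0 => w _; rewrite P0// dotF0l.
  by apply: dq; exact: edgesF_T EF.
rewrite subr0; apply: CTk_perp => // [F FT|/=].
  apply: gammatF_eq0 => [||E EF] /=; [exact: P0|exact: P0|].
  by apply: dq; exact: edgesF_T EF.
(* What remains is the projection of G_T on R^(k-1) tested with curl w0. This field belongs to that
   space, so the projection drops, and it is divergence-free, so only the face fluxes are left. *)
apply: projT_perp => //; apply: GTk_perp; rewrite ?div_curl//.
  by apply: VPol_le (VPol_curl w0V); lia.
apply: (gamma_curl_flux (c := c) w0V) => [F FT|F E FT EF|F r FT] /=; [exact: G0| |exact: rot0].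
by have [] := cE E (edgesF_T FT EF).
Qed.
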